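(* Let $\{X_t\}_{t\ge 0}$ be a $d$-dimensional super-Brownian motion started from $X_0=\delta_0$ with branching mechanism $$\psi(u)=-\beta u+\alpha u^2+\int_0^\infty\left(e^{-uy}-1+uy\right)n(dy),\qquad u\ge 0,$$ where $\beta>0$, $\alpha>0$, and $n$ is a $\sigma$-finite measure on $(0,\infty)$ with $\int_0^\infty (y^2\wedge y)\,n(dy)<\infty$. Assume moreover that there exists $\gamma>0$ such that $$\int_1^\infty y(\log y)^{2+\gamma}\,n(dy)<\infty.$$ Let $R_t:=\inf\{r>0: X_s(\{x\in\mathbb{R}^d:|x|\ge r\})=0 \text{ for all } 0\le s\le t\}$. Then for every $\rho\in(\sqrt{2\beta},\infty)$, $$\lim_{t\to\infty}\frac{1}{t}\log\mathbb{P}(R_t\ge \rho t)=-\left(\frac{\rho^2}{2}-\beta\right).$$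
   Context: $M_F(\mathbb{R}^d)$ denotes the space of finite Borel measures on $\mathbb{R}^d$, and $\nu(f):=\int f\,d\nu$. The super-Brownian motion with branching mechanism $\psi$ is the $M_F(\mathbb{R}^d)$-valued Markov process whose law $\mathbb{P}_\mu$ started from $\mu$ is characterized by: for every positive bounded function $g$ on $\mathbb{R}^d$, $\mathbb{E}_\mu[e^{-X_t(g)}]=e^{-\mu(v(t,\cdot))}$, where $v$ is the unique locally bounded positive solution of $\partial_t v=\frac12\Delta v-\psi(v)$, $v(0,x)=g(x)$. Here $\mathbb{P}=\mathbb{P}_{\delta_0}$. *)

(* Defs.v *)
From HB Require Import structures.
From mathcomp Require Import all_boot all_order all_algebra.
From mathcomp Require Import all_classical all_reals all_analysis.
Set Implicit Arguments. Unset Strict Implicit. Unset Printing Implicit Defensive.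
Import Order.TTheory GRing.Theory Num.Theory.
Import numFieldNormedType.Exports.
Local Open Scope classical_set_scope.
Local Open Scope ring_scope.

(* R^d is represented by row vectors 'rV[R]_d, with its usual (product =
   Euclidean) topology; Rd R d is the same carrier equipped with the Borel
   sigma-algebra (generated by the open sets). *)
Definition Rd (R : realType) (d : nat) := g_sigma_algebraType (@open 'rV[R]_d).

Definition enorm (R : realType) (d : nat) (x : 'rV[R]_d) : R :=
  Num.sqrt (\sum_(i < d) x ord0 i ^+ 2).

Definition mint (R : realType) (d : nat) (nu : set (Rd R d) -> \bar R)
  (f : 'rV[R]_d -> R) : R :=
  fine (\int[nu]_x (f x)%:E)%E.

Definition heat1 (R : realType) (d : nat) (i : 'I_d) (t : R)
  (f : 'rV[R]_d -> R) (x : 'rV[R]_d) : R :=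
  fine (\int[lebesgue_measure]_y
          ((f (x + y *: delta_mx ord0 i)) * normal_pdf 0 (Num.sqrt t) y)%:E)%E.

(* Brownian (heat) semigroup P_t f(x) = E[f(x + B_t)], generator (1/2)Laplacian;
   the d-dimensional Gaussian is the product of d one-dimensional ones. *)
Definition heat (R : realType) (d : nat) (t : R) (f : 'rV[R]_d -> R) :
  'rV[R]_d -> R :=
  if t <= 0 then f else foldr (fun i h => heat1 i t h) f (enum 'I_d).

Definition psi (R : realType) (beta alpha : R)
  (n : {measure set R -> \bar R}) (u : R) : R :=
  - beta * u + alpha * u ^+ 2
  + fine (\int[n]_(y in (`]0%R, +oo[ : set R)) (expR (- (u * y)) - 1 + u * y)%:E)%E.

Definition bounded_nonneg_meas (R : realType) (d : nat) (g : 'rV[R]_d -> R) :=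
  measurable_fun setT (g : Rd R d -> R) /\
  (forall x, 0 <= g x) /\ exists M : R, forall x, g x <= M.

(* v is a (locally bounded, nonnegative, jointly measurable) solution of
   dv/dt = (1/2) Laplacian v - psi(v), v(0,.) = g, in the mild sense:
   v(t,x) + \int_0^t P_{t-s}[psi(v(s,.))](x) ds = P_t g (x). *)
Definition pde_solution (R : realType) (d : nat) (ps : R -> R)
  (g : 'rV[R]_d -> R) (v : R -> 'rV[R]_d -> R) : Prop :=
  measurable_fun setT (fun p : R * Rd R d => v p.1 p.2) /\
  (forall t x, 0 <= t -> 0 <= v t x) /\
  (forall T, 0 <= T -> exists C : R, forall t x, 0 <= t <= T -> v t x <= C) /\
  (forall t x, 0 <= t ->
     v t x + fine (\int[lebesgue_measure]_(s in (`[0%R, t] : set R))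
                     (heat (t - s) (fun y => ps (v s y)) x)%:E)%E
     = heat t g x).

Definition bounded_continuous (R : realType) (d : nat) (f : 'rV[R]_d -> R) :=
  continuous f /\ exists M : R, forall x, `|f x| <= M.

Definition cadlag_weak (R : realType) (d : nat)
  (Y : R -> {finite_measure set Rd R d -> \bar R}) : Prop :=
  (forall t0, 0 <= t0 -> forall f, bounded_continuous f ->
     (fun t => mint (Y t) f) @ t0^'+ --> mint (Y t0) f) /\
  (forall t0, 0 < t0 -> exists nu : {finite_measure set Rd R d -> \bar R},
     forall f, bounded_continuous f ->
       (fun t => mint (Y t) f) @ t0^'- --> mint nu f).

Definition natural_filtration (R : realType) (d : nat)
  (dO : measure_display) (Omega : measurableType dO)
  (X : R -> Omega -> {finite_measure set Rd R d -> \bar R}) (s : R) :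
  set (set Omega) :=
  <<s [set A | exists r (B : set (Rd R d)) (C : set R),
         [/\ 0 <= r <= s, measurable B, measurable C &
             A = (fun w => fine (X r w B)) @^-1` C]] >>.

(* X is a super-Brownian motion with branching mechanism ps started from
   delta_0, under P: cadlag measure-valued process, X_0 = delta_0 (in law),
   and Markov w.r.t. its natural filtration with Laplace functional
   E[exp(-X_t g) | F_s] = exp(-X_s(v(t-s,.))). *)
Definition is_SBM (R : realType) (d : nat) (ps : R -> R)
  (dO : measure_display) (Omega : measurableType dO) (P : probability Omega R)
  (X : R -> Omega -> {finite_measure set Rd R d -> \bar R}) : Prop :=
  [/\ (forall t (B : set (Rd R d)), measurable B ->
         measurable_fun setT (fun w => fine (X t w B))),
      (forall w, cadlag_weak (fun t => X t w)),
      (forall g, bounded_nonneg_meas g ->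
         (\int[P]_w (expR (- mint (X 0 w) g))%:E = (expR (- g 0))%:E)%E) &
      (forall s t, 0 <= s <= t -> forall g v,
         bounded_nonneg_meas g -> pde_solution ps g v ->
         forall A, natural_filtration X s A ->
         (\int[P]_(w in A) (expR (- mint (X t w) g))%:E
          = \int[P]_(w in A) (expR (- mint (X s w) (v (t - s))))%:E)%E)].

Definition Rt (R : realType) (d : nat) (dO : measure_display)
  (Omega : measurableType dO)
  (X : R -> Omega -> {finite_measure set Rd R d -> \bar R}) (t : R)
  (w : Omega) : \bar R :=
  ereal_inf [set r%:E | r in [set r : R | 0 < r /\
     forall s, 0 <= s <= t -> X s w [set x | r <= enorm x] = 0%E]].

(* Main.v *)
(* For a unit vector e, testing X against functions G(<e, x>) turns the
   log-Laplace equation into its one-dimensional version, whose solution v with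
   v(0) = G satisfies
     v(t) <= e^{beta t} P_t G   and   v(t) <= beta / alpha + 1 / (alpha t),
   and, for small G and t in a bounded interval, v(t) >= e^{(beta - eps) t} P_t G.

   Lower bound.  Iterating the last inequality over long time steps, with G
   supported in a window of width 1 moving at speed rho, gives
   P(X_t(<e, x> > rho t - 1) > 0) >= c e^{-(rho^2/2 - beta + 2 eps) t}.

   Upper bound.  By compactness of the sphere the complement of a ball is covered
   by finitely many half-spaces.  For one half-space, run over dyadic time grids
   of mesh of order 2^-k with radii r_k increasing by amounts eta_k of order
   t (3/4)^k and thresholds m_k = e^{-rho^2 t / 2} 8^-k.  At mesh k = 0 some mass
   beyond r_0 exceeds m_0 with probability of order t e^{(beta - rho^2/2) t}.
   A jump from mass <= m_k beyond r_k to mass > m_{k+1} beyond r_{k+1} in a time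
   of order 2^-k has probability of order 2^k m_k plus a negligible Gaussian
   term, so the union over the grid times, of number of order t 2^k, is summable
   in k.  Right-continuity transfers the bound from the grid times to all times. *)
Require Import Defs.
From HB Require Import structures.
From mathcomp Require Import all_boot all_order all_algebra.
From mathcomp Require Import all_classical all_reals all_analysis.
From mathcomp Require Import measurable_realfun normal_distribution ring lra.
Import Order.TTheory GRing.Theory Num.Theory.
Import numFieldNormedType.Exports.
Local Open Scope classical_set_scope.
Local Open Scope ring_scope.

Set Implicit Arguments. Unset Strict Implicit. Unset Printing Implicit Defensive.

(** [is_SBM] gives the Laplace functional only along a given solution of the log-Laplace equation,
    so solutions have to be produced first. They are built in dimension one by monotone iteration,
    which preserves both upper bounds; the lower bound comes from starting the iteration at a
    suitable subsolution. The bound [beta / alpha + 1 / (alpha t)] does not see the height of the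
    initial datum, and this makes the chaining work. To detect mass above a tiny threshold [m'] one
    tests with height [1 / m'], which a plain first-moment estimate would pay in full; after a short
    time [delta] the solution is below [beta / alpha + 1 / (alpha delta)], and [1 / m'] survives
    only next to a Gaussian tail. The rates balance as follows. Of order [2^k] grid times, a factor
    [2^k] from [1 / delta] and thresholds [8^-k] leave [2^-k]; radius increments [(3/4)^k] over
    times [2^-k] give Gaussian exponents growing like [(9/8)^k], which beats [8^k e^{rho^2 t / 2}].
    Factors polynomial in [t] disappear after taking [ln] and dividing by [t]. *)

(** * Integration against a measure with a density *)

Section density.
Local Open Scope ereal_scope.
Context d (T : measurableType d) (R : realType).
Variables (mu nu : {measure set T -> \bar R}) (p : T -> R).
Hypothesis mp : measurable_fun setT p.
Hypothesis p0 : forall x, (0 <= p x)%R.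
Hypothesis nuE : forall A, measurable A -> nu A = \int[mu]_(x in A) (p x)%:E.

Import HBNNSimple.

Let density_indic E : measurable E ->
  \int[nu]_x (\1_E x)%:E = \int[mu]_x ((\1_E x)%:E * (p x)%:E).
Proof.
move=> mE; rewrite integral_indic// setIT nuE// integral_mkcond.
apply: eq_integral => x _; rewrite patchE indicE.
by case: ifPn; rewrite ?mul1e ?mul0e.
Qed.

Let density_nnsfun (f : {nnsfun T >-> R}) :
  \int[nu]_x (f x)%:E = \int[mu]_x ((f x)%:E * (p x)%:E).
Proof.
under [LHS]eq_integral do rewrite fimfunE -fsumEFin//.
rewrite [LHS]ge0_integral_fsum//; last 2 first.
  - by move=> r; exact/measurable_EFinP/measurableT_comp.
  - by move=> n x _; rewrite EFinM nnfun_muleindic_ge0.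
under [RHS]eq_integral.
  move=> x xD; rewrite fimfunE -fsumEFin// ge0_mule_fsuml; last first.
    by move=> r; rewrite EFinM nnfun_muleindic_ge0.
  over.
rewrite [RHS]ge0_integral_fsum//; last 2 first.
  - move=> r; apply: emeasurable_funM; last exact/measurable_EFinP.
    by apply/measurable_EFinP; apply/measurableT_comp.
  - move=> n x _; rewrite EFinM mule_ge0//; last by rewrite lee_fin.
    by rewrite nnfun_muleindic_ge0.
apply: eq_fsbigr => r _.
under [RHS]eq_integral do rewrite EFinM -muleA.
rewrite integralZl_indic_nnsfun//= density_indic//.
have [r0|r0] := leP 0%R r.
  rewrite ge0_integralZl//.
  - by apply: emeasurable_funM; exact/measurable_EFinP.
  - by move=> x _; rewrite mule_ge0// lee_fin.
rewrite preimage_nnfun0// indic0.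
under [X in _ = X]eq_integral do rewrite mul0e mule0.
by under eq_integral do rewrite mul0e; rewrite !integral0 mule0.
Qed.

(** Indicators, then simple functions, then monotone limits. The factor [p x] is finite and
    nonnegative, so it passes through the limit even where [f] is infinite. *)
Lemma ge0_integral_density (f : T -> \bar R) :
  measurable_fun setT f -> (forall x, 0 <= f x) ->
  \int[nu]_x f x = \int[mu]_x (f x * (p x)%:E).
Proof.
move=> mf f0; pose f_ := nnsfun_approx measurableT mf.
transitivity (limn (fun n => \int[nu]_x (f_ n x)%:E)).
  rewrite -monotone_convergence//=.
  - apply: eq_integral => x _; apply/esym/cvg_lim => //=.
    exact: cvg_nnsfun_approx.
  - by move=> n; exact/measurable_EFinP/measurable_funTS.
  - by move=> n ? _; rewrite lee_fin.
  - by move=> ? _ ? ? mn; rewrite lee_fin; exact/lefP/nd_nnsfun_approx.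
under [X in limn X]eq_fun do rewrite density_nnsfun.
rewrite -monotone_convergence//=.
- apply: eq_integral => x _; apply/cvg_lim => //=.
  apply: cvgeMr => //; exact: cvg_nnsfun_approx.
- move=> n; apply: emeasurable_funM; last exact/measurable_EFinP.
  by apply/measurable_EFinP.
- by move=> n ? _; rewrite mule_ge0// lee_fin.
- move=> x _ m n mn; rewrite lee_wpmul2r ?lee_fin//.
  exact/lefP/nd_nnsfun_approx.
Qed.

End density.

(** * Affine change of variables for Lebesgue measure *)

Section affine.
Local Open Scope ereal_scope.
Context (R : realType).
Notation mu := (@lebesgue_measure R).

Lemma measurable_affine (a b : R) :
  measurable_fun setT (fun x : measurableTypeR R => (a * x + b)%R : measurableTypeR R).
Proof. by apply: measurable_funD => //; exact: measurable_funM. Qed.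

(** Lebesgue measure is determined by half-open intervals, so it is enough to evaluate the scaled
    pushforward on them. A negative slope swaps the end points and moves the open end to the other
    side, hence the sign split. *)
Lemma lebesgue_affine (a b : R) (A : set R) : a != 0%R -> measurable A ->
  mu A = `|a|%:E * mu ((fun x => (a * x + b)%R) @^-1` A).
Proof.
move=> a0 mA.
pose f := fun x : measurableTypeR R => (a * x + b)%R : measurableTypeR R.
have mf : measurable_fun setT f by exact: measurable_affine.
pose m1 : {measure set (measurableTypeR R) -> \bar R} :=
  measure_function_pushforward__canonical__measure_function_Measure mu mf.
transitivity (mscale (NngNum (normr_ge0 a)) m1 A); last by [].
apply: (@lebesgue_measure_unique _ (mscale (NngNum (normr_ge0 a)) m1)) => //= _ [[c d]] _ <-.
rewrite /mscale /m1 /= /pushforward.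
have [a_gt0|a_lt0|a_eq0] := ltgtP a 0%R; last by rewrite a_eq0 eqxx in a0.
- rewrite (_ : f @^-1` _ = `[(d - b) / a, (c - b) / a[%classic)%R; last first.
    apply/seteqP; split => x /=; rewrite /f !in_itv/= => /andP[h1 h2].
      by rewrite ler_ndivrMr// ltr_ndivlMr// lerBrDr ltrBlDr [(x * a)%R]mulrC h1 h2.
    move: h1 h2; rewrite ler_ndivrMr// ltr_ndivlMr// lerBrDr ltrBlDr [(x * a)%R]mulrC.
    by move=> -> ->.
  rewrite !lebesgue_measure_itv/= !lte_fin ltr_nM2r ?invr_lt0// ltrD2r.
  case: ifPn => cd; last by rewrite mule0.
  by rewrite -!EFinD -EFinM ltr0_norm//; congr EFin; field.
- rewrite (_ : f @^-1` _ = `](c - b) / a, (d - b) / a]%classic)%R; last first.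
    apply/seteqP; split => x /=; rewrite /f !in_itv/= => /andP[h1 h2].
      by rewrite ltr_pdivrMr// ler_pdivlMr// lerBrDr ltrBlDr [(x * a)%R]mulrC h1 h2.
    move: h1 h2; rewrite ltr_pdivrMr// ler_pdivlMr// lerBrDr ltrBlDr [(x * a)%R]mulrC.
    by move=> -> ->.
  rewrite !lebesgue_measure_itv/= !lte_fin ltr_pM2r ?invr_gt0// ltrD2r.
  case: ifPn => cd; last by rewrite mule0.
  by rewrite -!EFinD -EFinM gtr0_norm//; congr EFin; field.
Qed.

Lemma ge0_integral_affine (a b : R) (f : R -> \bar R) : a != 0%R ->
  measurable_fun setT f -> (forall x, 0 <= f x) ->
  \int[mu]_x f x = `|a|%:E * \int[mu]_x f (a * x + b)%R.
Proof.
move=> a0 mf f0.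
pose g := fun x : measurableTypeR R => (a * x + b)%R : measurableTypeR R.
have mg : measurable_fun setT g by exact: measurable_affine.
rewrite -[X in _ * X](ge0_integral_pushforward mg mu measurableT)//.
pose m1 : {measure set (measurableTypeR R) -> \bar R} :=
  measure_function_pushforward__canonical__measure_function_Measure mu mg.
rewrite -(ge0_integral_mscale m1 measurableT (NngNum (normr_ge0 a)))//.
apply: eq_measure_integral => A mA _.
exact: lebesgue_affine.
Qed.
End affine.

(** * The standard Gaussian law: rescaling, convolution, tail and interval estimates *)

Section gauss.
Local Open Scope ereal_scope.
Context (R : realType).
Notation mu := (@lebesgue_measure R).

(** One standard normal law serves for all variances: the scale goes into the argument of the
    integrand, so variance zero is the identity and not a singular case. *)
Definition gauss : probability (measurableTypeR R) R := normal_prob 0 1.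

Let phi (y : R) : R := normal_pdf 0 1 y.

Let phi0 y : (0 <= phi y)%R. Proof. exact: normal_pdf_ge0. Qed.

Let mphi : measurable_fun setT phi. Proof. exact: measurable_normal_pdf. Qed.

Let mphiE : measurable_fun setT (EFin \o phi).
Proof. exact/measurable_EFinP. Qed.

Let peak : R := normal_peak 1.

Let peak0 : (0 < peak)%R. Proof. by rewrite normal_peak_gt0. Qed.

Lemma integral_gauss_cst (k : \bar R) : \int[gauss]_y k = k.
Proof.
rewrite integral_cst//; transitivity (k * 1); last by rewrite mule1.
by congr (_ * _); exact: (probability_setT gauss).
Qed.

Lemma normal_peakE (s : R) : (0 < s)%R -> normal_peak s = (s^-1 * peak)%R.
Proof.
move=> s0; rewrite /peak /normal_peak -[in LHS]mulrnAr expr1n mul1r.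
by rewrite sqrtrM ?sqr_ge0// sqrtr_sqr gtr0_norm// invfM.
Qed.

Lemma normal_pdf_std (m s x : R) : (0 < s)%R ->
  normal_pdf m s x = (s^-1 * normal_pdf 0 1 ((x - m) / s))%R.
Proof.
move=> s0; rewrite !normal_pdfE ?gt_eqF// normal_peakE// -mulrA; congr (_ * (_ * _))%R.
rewrite /normal_fun; congr expR; rewrite subr0; field; by rewrite gt_eqF.
Qed.

Let phiE y : phi y = (peak * expR (- y ^+ 2 / 2))%R.
Proof.
rewrite /phi normal_pdfE//; congr (_ * _)%R; rewrite /normal_fun subr0; congr expR.
by rewrite expr1n.
Qed.

Lemma gaussE (f : R -> \bar R) : measurable_fun setT f -> (forall x, 0 <= f x) ->
  \int[gauss]_y f y = \int[mu]_y (f y * (normal_pdf 0 1 y)%:E).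
Proof. by move=> mf f0; rewrite (ge0_integral_density (mu := mu) mphi). Qed.

Let ge0_gauss_scale_gt0 (a : R) (f : R -> \bar R) : (0 < a)%R ->
  measurable_fun setT f -> (forall x, 0 <= f x) ->
  \int[gauss]_y f (a * y)%R = \int[mu]_y (f y * (normal_pdf 0 a y)%:E).
Proof.
move=> a0 mf f0; have mfa : measurable_fun setT (fun y => f (a * y)%R).
  by apply: (measurableT_comp mf); exact: measurable_funM.
rewrite (gaussE mfa (fun y => f0 _)).
rewrite [RHS](@ge0_integral_affine _ a 0%R)//; first last.
- by move=> x; rewrite mule_ge0// lee_fin normal_pdf_ge0.
- apply: emeasurable_funM => //; apply/measurable_EFinP; exact: measurable_normal_pdf.
- by rewrite gt_eqF.
rewrite -ge0_integralZl//; first last.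
- by move=> x _; rewrite mule_ge0// lee_fin normal_pdf_ge0.
- apply: emeasurable_funM => //.
    by apply: (measurableT_comp mf); exact: measurable_affine.
  apply/measurable_EFinP/measurableT_comp; first exact: measurable_normal_pdf.
  exact: measurable_affine.
apply: eq_integral => y _; rewrite addr0 muleCA; congr *%E.
rewrite -EFinM (@normal_pdf_std 0 a)// gtr0_norm// subr0 mulVKf ?gt_eqF//.
by rewrite mulrAC mulfV ?gt_eqF// mul1r.
Qed.

Lemma ge0_gauss_opp (f : R -> \bar R) : 
  measurable_fun setT f -> (forall x, 0 <= f x) ->
  \int[gauss]_y f (- y)%R = \int[gauss]_y f y.
Proof.
move=> mf f0; rewrite !gaussE//; last by apply: (measurableT_comp mf); exact: measurable_funN.
rewrite [RHS](@ge0_integral_affine _ (-1)%R 0%R)//; first last.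
- by move=> x; rewrite mule_ge0// lee_fin normal_pdf_ge0.
- by apply: emeasurable_funM => //; apply/measurable_EFinP.
rewrite normrN1 mul1e; apply: eq_integral => y _; rewrite mulN1r addr0.
by rewrite -/(phi y) -/(phi (- y)) !phiE sqrrN.
Qed.

Lemma ge0_gauss_abs (a : R) (f : R -> \bar R) :
  measurable_fun setT f -> (forall x, 0 <= f x) ->
  \int[gauss]_y f (`|a| * y)%R = \int[gauss]_y f (a * y)%R.
Proof.
move=> mf f0; have [a0|a0] := leP 0%R a; first by rewrite ger0_norm.
rewrite ltr0_norm//.
rewrite -[RHS](@ge0_gauss_opp (fun y => f (a * y)%R)).
- by apply: eq_integral => y _; rewrite mulrN mulNr.
- by apply: (measurableT_comp mf); exact: measurable_funM.
- by move=> x; exact: f0.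
Qed.

(** Completing the square in [z]: the product splits into a Gaussian in [u / c] and a normal density
    in [z], and the latter integrates to 1. *)
Let phi_square (a b u z : R) : a != 0%R ->
  let c := Num.sqrt (a ^+ 2 + b ^+ 2) in
  (phi ((u - b * z) / a) * phi z =
   `|a| / c * phi (u / c) * normal_pdf (b * u / c ^+ 2) (`|a| / c) z)%R.
Proof.
move=> a0 c.
have a2 : (0 < a ^+ 2)%R by rewrite exprn_even_gt0.
have s0 : (0 < a ^+ 2 + b ^+ 2)%R by rewrite ltr_wpDr ?sqr_ge0.
have c0 : (0 < c)%R by rewrite sqrtr_gt0.
have c2 : (c ^+ 2 = a ^+ 2 + b ^+ 2)%R by rewrite sqr_sqrtr// ltW.
have k0 : (0 < `|a| / c)%R by rewrite divr_gt0 ?normr_gt0.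
rewrite (@normal_pdf_std _ _ _ k0) -/(phi _).
set w := ((z - _) / _)%R.
transitivity (phi (u / c) * phi w)%R; last by rewrite mulrACA divff ?gt_eqF// mul1r.
rewrite !phiE mulrACA [in RHS]mulrACA -!expRD; congr (_ * expR _)%R.
have w2 : (w ^+ 2 = (z - b * u / c ^+ 2) ^+ 2 * (c ^+ 2 / a ^+ 2))%R.
  by rewrite /w exprMn exprVn expr_div_n invf_div real_normK ?num_real.
rewrite w2 [in X in (_ = - X / _ + _)%R]exprMn exprVn c2 .
by field; rewrite a0 /= gt_eqF.
Qed.

(** Stability of the Gaussian law under convolution. Substitute [u = a y + b z] in the inner
    integral, exchange the order by Tonelli, and integrate [z] out with [phi_square]. The
    substitution requires [a != 0], so [a = 0] is done by symmetry of the law. *)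
Lemma ge0_gauss_conv (a b : R) (f : R -> \bar R) :
  measurable_fun setT f -> (forall x, 0 <= f x) ->
  \int[gauss]_z \int[gauss]_y f (a * y + b * z)%R =
  \int[gauss]_y f (Num.sqrt (a ^+ 2 + b ^+ 2) * y)%R.
Proof.
move=> mf f0.
have [->|a0] := eqVneq a 0%R.
  rewrite expr0n/= add0r sqrtr_sqr ge0_gauss_abs//.
  apply: eq_integral => z _.
  under eq_integral do rewrite mul0r add0r.
  by rewrite integral_gauss_cst.
have a2 : (0 < a ^+ 2)%R by rewrite exprn_even_gt0.
have s0 : (0 < a ^+ 2 + b ^+ 2)%R by rewrite ltr_wpDr ?sqr_ge0.
set c := Num.sqrt _; have c0 : (0 < c)%R by rewrite sqrtr_gt0.
have na0 : (0 < `|a|)%R by rewrite normr_gt0.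
have mlin : measurable_fun setT (fun p : measurableTypeR R * measurableTypeR R =>
   ((p.2 - b * p.1) / a)%R).
  apply: measurable_funM => //; apply: measurable_funB => //.
  by apply: measurable_funM.
pose h (p : measurableTypeR R * measurableTypeR R) := f p.2 * (phi ((p.2 - b * p.1) / a)%R)%:E * (phi p.1)%:E.
have mh : measurable_fun setT h.
  apply: emeasurable_funM; last exact: measurableT_comp mphiE measurable_fst.
  apply: emeasurable_funM; first exact: measurableT_comp mf measurable_snd.
  exact: measurableT_comp mphiE mlin.
have h0 p : 0 <= h p by rewrite /h !mule_ge0// lee_fin.
have inner z : \int[gauss]_y f (a * y + b * z)%R =
  `|a|^-1%:E * \int[mu]_u (f u * (phi ((u - b * z) / a)%R)%:E).
  rewrite gaussE//; last by apply: (measurableT_comp mf); exact: measurable_affine.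
  rewrite [in RHS](@ge0_integral_affine _ a (b * z)%R)//; first last.
  - by move=> x; rewrite mule_ge0// lee_fin.
  - apply: emeasurable_funM => //; apply: (measurableT_comp mphiE).
    by apply: measurable_funM => //; apply: measurable_funB.
  rewrite muleA -EFinM mulVf ?gt_eqF// mul1e.
  apply: eq_integral => y _; congr (_ * _%:E).
  by rewrite addrK mulrAC mulfV// mul1r.
under eq_integral do rewrite inner.
have mI : measurable_fun setT (fun z => \int[mu]_u (f u * (phi ((u - b * z) / a)%R)%:E)).
  apply: (measurable_fun_fubini_tonelli_F (m2 := mu) (fun p : measurableTypeR R * measurableTypeR R => f p.2 * (phi ((p.2 - b * p.1) / a)%R)%:E)) => //.
  - apply: emeasurable_funM; first exact: measurableT_comp mf measurable_snd.
    exact: measurableT_comp mphiE mlin.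
  - by move=> p; rewrite mule_ge0// lee_fin.
have I0 z : 0 <= \int[mu]_u (f u * (phi ((u - b * z) / a)%R)%:E).
  by apply: integral_ge0 => u _; rewrite mule_ge0// lee_fin.
rewrite ge0_integralZl// [X in _ * X]gaussE//.
have hE z : \int[mu]_u (f u * (phi ((u - b * z) / a)%R)%:E) * (phi z)%:E = \int[mu]_u h (z, u).
  rewrite -ge0_integralZr//.
  - apply: emeasurable_funM => //; apply: (measurableT_comp mphiE).
    by apply: measurable_funM => //; apply: measurable_funB.
  - by move=> u _; rewrite mule_ge0// lee_fin.
  - by rewrite lee_fin.
under eq_integral => z _ do rewrite -/(phi z) hE.
rewrite (fubini_tonelli (m1 := mu) (m2 := mu) h mh h0).
rewrite (ge0_gauss_scale_gt0 c0)//.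
rewrite -ge0_integralZl//; first last.
- by move=> u _; apply: integral_ge0 => z _.
- exact: measurable_fun_fubini_tonelli_G.
apply: eq_integral => u _.
have mpdf m s : measurable_fun setT (fun y : R => (normal_pdf m s y)%:E).
  by apply/measurable_EFinP; exact: measurable_normal_pdf.
transitivity (`|a|^-1%:E * \int[mu]_z (f u * (`|a| / c * phi (u / c))%:E * (normal_pdf (b * u / c ^+ 2) (`|a| / c) z)%:E)).
  congr *%E; apply: eq_integral => z _; rewrite /h /=.
  by rewrite -!muleA -!EFinM phi_square// -/c.
rewrite ge0_integralZl//; first last.
- by rewrite mule_ge0// lee_fin mulr_ge0// divr_ge0// ltW.
- by move=> z _; rewrite lee_fin normal_pdf_ge0.
- exact: mpdf.
rewrite integral_normal_pdf mule1 muleCA; congr *%E.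
rewrite -EFinM (@normal_pdf_std _ c)// subr0 -/(phi _).
by rewrite mulrA mulrA mulVf ?gt_eqF// mul1r.
Qed.

(** Bridge to [heat1], which integrates signed functions against a density of standard deviation
    [sqrt t]: positive and negative parts are rescaled separately. *)
Lemma gauss_scale (a : R) (f : R -> R) : (0 < a)%R -> measurable_fun setT f ->
  \int[mu]_y (f y * normal_pdf 0 a y)%:E = \int[gauss]_y (f (a * y)%R)%:E.
Proof.
move=> a0 mf; rewrite integralE [RHS]integralE.
pose F := EFin \o f.
have mF : measurable_fun setT F by exact/measurable_EFinP.
have -> : \int[gauss]_x (fun y => (f (a * y)%R)%:E)^\+ x = \int[gauss]_y F^\+ (a * y)%R.
  by apply: eq_integral => y _; rewrite !funeposE.
have -> : \int[gauss]_x (fun y => (f (a * y)%R)%:E)^\- x = \int[gauss]_y F^\- (a * y)%R.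
  by apply: eq_integral => y _; rewrite !funenegE.
rewrite !ge0_gauss_scale_gt0//; [|exact: measurable_funeneg|exact: measurable_funepos].
have p0 := normal_pdf_ge0 0%R a.
congr (_ - _); apply: eq_integral => y _; rewrite ?funeposE ?funenegE /F EFinM.
- by rewrite maxeMl ?lee_fin// mul0e.
- by rewrite -mulNe maxeMl ?mul0e ?lee_fin.
Qed.

(** For [x > a >= 0] one has [x^2 >= a^2 + (x - a)^2], so the density is at most [e^{-a^2/2}] times
    the normal density centred at [a]. *)
Lemma gauss_tail (a : R) : (0 <= a)%R ->
  gauss [set y | (a < y)%R] <= (expR (- a ^+ 2 / 2))%:E.
Proof.
move=> a0.
have mA : measurable [set y : R | (a < y)%R].
  by rewrite (_ : [set y | _] = `]a, +oo[%classic)//; apply/seteqP; split => y /=; rewrite in_itv/= andbT.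
rewrite /gauss /= /normal_prob.
have mp : measurable_fun setT (fun x => (normal_pdf a 1 x)%:E).
  by apply/measurable_EFinP; exact: measurable_normal_pdf.
apply: (@le_trans _ _ (\int[mu]_(x in [set y : R | (a < y)%R]) ((expR (- a ^+ 2 / 2))%:E * (normal_pdf a 1 x)%:E))).
  apply: ge0_le_integral => //.
  - by move=> x _; rewrite lee_fin.
  - exact: measurable_funTS.
  - by apply: measurable_funTS; apply: emeasurable_funM.
  - move=> x /= ax; rewrite -EFinM lee_fin (@normal_pdf_std a 1)// -!/(phi _) !phiE.
    rewrite invr1 mulr1 mul1r mulrCA ler_wpM2l ?(ltW peak0)// -expRD ler_expR.
    nra.
rewrite ge0_integralZl//; first last.
- by move=> x _; rewrite lee_fin normal_pdf_ge0.
- exact: measurable_funTS.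
rewrite -[leRHS]mule1; apply: lee_wpmul2l; first by rewrite lee_fin expR_ge0.
rewrite -(integral_normal_pdf a 1); apply: ge0_subset_integral => //.
by move=> x _; rewrite lee_fin normal_pdf_ge0.
Qed.

(** The density decreases on the positive half-line, so on the interval it is at least its value at
    the right end. *)
Lemma gauss_interval (a w : R) : (0 <= a)%R -> (0 < w)%R ->
  (w * (normal_peak 1 * expR (- (a + w) ^+ 2 / 2)))%:E <= gauss `[a, (a + w)%R]%classic.
Proof.
move=> a0 w0; rewrite /gauss /= /normal_prob.
set k := (normal_peak 1 * _)%R.
have -> : (w * k)%:E = \int[mu]_(x in `[a, (a + w)%R]%classic) k%:E.
  rewrite integral_cst//= lebesgue_measure_itv/= lte_fin ltrDl w0 -EFinB -EFinM.
  by congr EFin; ring.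
apply: ge0_le_integral => //.
- by move=> x _; rewrite lee_fin mulr_ge0 ?expR_ge0// ltW.
- exact: measurable_funTS.
- move=> x /=; rewrite in_itv/= => /andP[ax xw].
  rewrite lee_fin -/(phi x) phiE ler_wpM2l ?(ltW peak0)// ler_expR.
  rewrite ler_pM2r ?invr_gt0// lerN2; nra.
Qed.

End gauss.

(** * The one-dimensional heat semigroup and Duhamel integrals *)

Section heat_kernel.
Local Open Scope ereal_scope.
Context (R : realType).
Notation mu := (@lebesgue_measure R).
Notation RR := (measurableTypeR R).

(** The semigroup [P_t] on the line. Values lie in [\bar R] because the fixed-point arguments run on
    nonnegative functions, through Tonelli and monotone convergence. At [t = 0] the formula is the
    identity. *)
Definition gheat (t : R) (f : R -> \bar R) (x : R) : \bar R :=
  \int[gauss R]_y f (x + Num.sqrt t * y)%R.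

Lemma measurable_sqrt : measurable_fun setT (@Num.sqrt R : RR -> RR).
Proof. exact: (continuous_measurable_fun (@sqrt_continuous R)). Qed.

Lemma gheat_ge0 t f x : (forall z, 0 <= f z) -> 0 <= gheat t f x.
Proof. by move=> f0; apply: integral_ge0. Qed.

Lemma measurable_gheat_arg (f : R -> \bar R) t x : measurable_fun setT (f : RR -> \bar R) ->
  measurable_fun setT (fun y : RR => f (x + Num.sqrt t * y)%R).
Proof.
move=> mf; apply: (measurableT_comp mf).
by apply: measurable_funD => //; exact: measurable_funM.
Qed.

Lemma measurable_gheat d (T : measurableType d) (F : T * RR -> \bar R) (tt xx : T -> RR) :
  measurable_fun setT F -> (forall p, 0 <= F p) ->
  measurable_fun setT tt -> measurable_fun setT xx ->
  measurable_fun setT (fun p => gheat (tt p) (fun z => F (p, z)) (xx p)).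
Proof.
move=> mF F0 mt mx.
apply: (measurable_fun_fubini_tonelli_F (m2 := gauss R)
  (fun q : T * RR => F (q.1, xx q.1 + Num.sqrt (tt q.1) * q.2)%R)) => //.
apply: (measurableT_comp mF); apply: measurable_fun_pair => //=.
apply: measurable_funD; first exact: measurableT_comp mx measurable_fst.
apply: measurable_funM => //.
apply: (measurableT_comp measurable_sqrt).
exact: measurableT_comp mt measurable_fst.
Qed.

Lemma gheat_le t (f g : R -> \bar R) x : measurable_fun setT (f : RR -> \bar R) ->
  measurable_fun setT (g : RR -> \bar R) ->
  (forall z, 0 <= f z) -> (forall z, f z <= g z) ->
  gheat t f x <= gheat t g x.
Proof.
move=> mf mg f0 fg; apply: ge0_le_integral => //; exact: measurable_gheat_arg.
Qed.

Lemma gheat_cst t k x : gheat t (fun=> k) x = k.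
Proof. exact: integral_gauss_cst. Qed.

Lemma gheatZ t (k : R) f x : measurable_fun setT (f : RR -> \bar R) ->
  (forall z, 0 <= f z) -> (0 <= k)%R ->
  gheat t (fun z => k%:E * f z) x = k%:E * gheat t f x.
Proof.
move=> mf f0 k0; rewrite /gheat ge0_integralZl//.
exact: measurable_gheat_arg.
Qed.

Lemma gheat_semigroup (s t : R) f x : (0 <= s)%R -> (0 <= t)%R ->
  measurable_fun setT (f : RR -> \bar R) -> (forall z, 0 <= f z) ->
  gheat s (gheat t f) x = gheat (s + t) f x.
Proof.
move=> s0 t0 mf f0; rewrite /gheat.
transitivity (\int[gauss R]_z \int[gauss R]_y (fun w => f (x + w)%R) (Num.sqrt t * y + Num.sqrt s * z)%R).
  apply: eq_integral => z _; apply: eq_integral => y _; congr f; ring.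
rewrite (@ge0_gauss_conv R (Num.sqrt t) (Num.sqrt s) (fun w => f (x + w)%R)) //.
  apply: eq_integral => y _; congr (f (x + Num.sqrt _ * y)%R).
  by rewrite !sqr_sqrtr// addrC.
apply: (measurableT_comp mf); exact: measurable_funD.
Qed.

(** Duhamel's integral: the contribution at time [t] of a source [F] to the inhomogeneous heat
    equation. *)
Definition duh (F : R -> R -> \bar R) (t x : R) : \bar R :=
  \int[mu]_(s in `[0%R, t]) gheat (t - s) (F s) x.

Definition jmeas (F : R -> R -> \bar R) := 
  measurable_fun setT (fun p : RR * RR => F p.1 p.2).

Lemma jmeas_sec F s : jmeas F -> measurable_fun setT (F s : RR -> \bar R).
Proof. by move=> mF; exact: (measurableT_comp mF (pair1_measurable s)). Qed.

Lemma duh_ge0 F t x : (forall s z, 0 <= F s z) -> 0 <= duh F t x.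
Proof. by move=> F0; apply: integral_ge0 => s _; exact: gheat_ge0. Qed.

Lemma measurable_duh_arg F t x : jmeas F -> (forall s z, 0 <= F s z) ->
  measurable_fun setT (fun s : RR => gheat (t - s) (F s) x).
Proof.
move=> mF F0.
apply: (@measurable_gheat _ RR (fun p : RR * RR => F p.1 p.2) (fun s => (t - s)%R) (cst x)) => //.
exact: measurable_funB.
Qed.

(** The interval of integration moves with [t]. Encoding it as the indicator of a measurable set of
    triples [((t, x), s)] turns the claim into the measurability part of Tonelli's theorem. *)
Lemma measurable_duh F : jmeas F -> (forall s z, 0 <= F s z) -> jmeas (duh F).
Proof.
move=> mF F0; rewrite /jmeas.
pose D : set ((RR * RR) * RR) := [set q | (0 <= q.2 <= q.1.1)%R].
have mD : measurable D.
  have -> : D = [set q | (0 <= q.2)%R] `&` [set q | (q.2 <= q.1.1)%R].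
    by apply/seteqP; split => q /=; rewrite /D /=; [move/andP|move=> H; apply/andP].
  apply: measurableI.
  - rewrite -[X in measurable X]setTI; apply: measurable_fun_le => //.
  - rewrite -[X in measurable X]setTI; apply: measurable_fun_le => //.
    exact: measurableT_comp measurable_fst measurable_fst.
pose h (q : (RR * RR) * RR) := gheat (q.1.1 - q.2)%R (F q.2) q.1.2 * (\1_D q)%:E.
have h0 q : 0 <= h q by rewrite /h mule_ge0//; exact: gheat_ge0.
have mh : measurable_fun setT h.
  apply: emeasurable_funM; last exact/measurable_EFinP/measurable_indic.
  apply: (@measurable_gheat _ _ (fun p : ((RR * RR) * RR) * RR => F p.1.2 p.2)
    (fun q => (q.1.1 - q.2)%R) (fun q => q.1.2)) => //.
  - apply: (measurableT_comp mF (f := fun p : RR * RR => F p.1 p.2)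
      (g := fun p : ((RR * RR) * RR) * RR => (p.1.2, p.2))).
    apply: measurable_fun_pair => //=.
    exact: measurableT_comp measurable_snd measurable_fst.
  - apply: measurable_funB => //.
    exact: measurableT_comp measurable_fst measurable_fst.
  - exact: measurableT_comp measurable_snd measurable_fst.
have := measurable_fun_fubini_tonelli_F (m2 := mu) h mh h0.
congr measurable_fun; apply/funext => -[t x] /=.
rewrite /duh integral_mkcond; apply: eq_integral => s _.
rewrite /h patchE indicE /D /=; case: ifPn; rewrite ?notin_setE ?inE /= in_itv/= => H.
  by rewrite mem_set// mule1.
by rewrite memNset// mule0.
Qed.

Lemma duh_le F G t x : jmeas F -> jmeas G ->
  (forall s z, 0 <= F s z) -> (forall s z, 0 <= G s z) ->
  (forall s z, (0 <= s <= t)%R -> F s z <= G s z) ->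
  duh F t x <= duh G t x.
Proof.
move=> mF mG F0 G0 FG; apply: ge0_le_integral => //.
- by move=> s _; exact: gheat_ge0.
- by apply: measurable_funTS; exact: measurable_duh_arg.
- by apply: measurable_funTS; exact: measurable_duh_arg.
- move=> s /=; rewrite in_itv/= => st; apply: gheat_le.
  + exact: jmeas_sec.
  + exact: jmeas_sec.
  + exact: F0.
  + by move=> z; exact: FG.
Qed.

(** Tonelli moves the outer expectation under the time integral, where the semigroup property merges
    [t - s] and [s - r] into [t - r]. *)
Lemma gheat_duh F (s t x : R) : jmeas F -> (forall s z, 0 <= F s z) ->
  (0 <= s <= t)%R ->
  gheat (t - s) (duh F s) x = \int[mu]_(r in `[0%R, s]) gheat (t - r) (F r) x.
Proof.
move=> mF F0 /andP[s0 st]; rewrite /gheat /duh.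
pose h (q : RR * RR) := gheat (s - q.2)%R (F q.2) (x + Num.sqrt (t - s) * q.1)%R * (\1_(`[0%R, s]%classic) q.2)%:E.
have h0 q : 0 <= h q by rewrite /h mule_ge0//; exact: gheat_ge0.
have mh : measurable_fun setT h.
  apply: emeasurable_funM; last first.
    apply/measurable_EFinP; apply: (measurableT_comp (measurable_indic _)) => //.
  apply: (@measurable_gheat _ _ (fun p : (RR * RR) * RR => F p.1.2 p.2)
    (fun q => (s - q.2)%R) (fun q => (x + Num.sqrt (t - s) * q.1)%R)) => //.
  - apply: (measurableT_comp mF (f := fun p : RR * RR => F p.1 p.2)
      (g := fun p : (RR * RR) * RR => (p.1.2, p.2))).
    apply: measurable_fun_pair => //=.
    exact: measurableT_comp measurable_snd measurable_fst.
  - exact: measurable_funB.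
  - by apply: measurable_funD => //; exact: measurable_funM.
transitivity (\int[gauss R]_y \int[mu]_r h (y, r)).
  apply: eq_integral => y _; rewrite integral_mkcond; apply: eq_integral => r _.
  by rewrite /h patchE indicE /=; case: ifPn => H; rewrite ?mule1 ?mule0.
rewrite (fubini_tonelli (m1 := gauss R) (m2 := mu) h mh h0).
rewrite [RHS]integral_mkcond; apply: eq_integral => r _.
rewrite /h /= patchE indicE; case: ifPn => H; last first.
  by under eq_integral do rewrite mule0; rewrite integral0.
under eq_integral do rewrite mule1.
move: H; rewrite inE/= in_itv/= => /andP[r0 rs].
rewrite -[LHS]/(gheat (t - s) (gheat (s - r) (F r)) x) gheat_semigroup ?subr_ge0//.
  by rewrite addrA subrK.
exact: jmeas_sec.
Qed.

Lemma integral_exp (c k a b : R) : (a <= b)%R ->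
  \int[mu]_(s in `[a, b]) (c * (k * expR (k * s)))%:E =
  (c * (expR (k * b) - expR (k * a)))%:E.
Proof.
rewrite le_eqVlt => /predU1P[->|ab].
  by rewrite set_itv1 integral_set1 subrr mulr0.
have dE (x : R) : is_derive x 1%R (fun s : R => c * expR (k * s))%R (c * (k * expR (k * x)))%R.
  by apply: is_derive_eq; rewrite /GRing.scale/=; ring.
have cE : continuous (fun s : R => expR (k * s))%R.
  move=> x; apply: (cvg_comp _ expR); last exact: continuous_expR.
  exact: mulrl_continuous.
have cF : continuous (fun s : R => c * expR (k * s))%R.
  by move=> x; apply: cvgM; [exact: cvg_cst|exact: cE].
rewrite (@continuous_FTC2 _ _ (fun s => c * expR (k * s))%R)//.
- by rewrite -EFinB mulrBr.
- apply: continuous_subspaceT => x; do 2 (apply: cvgM; first exact: cvg_cst).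
  exact: cE.
- split.
  + by move=> x _; exact: (@ex_derive _ _ _ _ _ _ _ (dE x)).
  + by apply: cvg_at_right_filter; exact: cF.
  + by apply: cvg_at_left_filter; exact: cF.
- by move=> x _; rewrite derive1E; exact: (@derive_val _ _ _ _ _ _ _ (dE x)).
Qed.

End heat_kernel.

(** * Monotone limits of Duhamel integrals and the logistic supersolution *)

Section mild.
Local Open Scope ereal_scope.
Context (R : realType).
Notation mu := (@lebesgue_measure R).
Notation RR := (measurableTypeR R).
Implicit Types F : R -> R -> \bar R.

Lemma gheat_cvg (f : (R -> \bar R)^nat) (g : R -> \bar R) t x :
  (forall n, measurable_fun setT (f n : RR -> \bar R)) ->
  (forall n z, 0 <= f n z) -> (forall z, nondecreasing_seq (f^~ z)) ->
  (forall z, f ^~ z @ \oo --> g z) ->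
  gheat t (f n) x @[n --> \oo] --> gheat t g x.
Proof.
move=> mf f0 ndf fg; rewrite /gheat.
under eq_integral do rewrite -(cvg_lim _ (fg _))//.
apply: cvg_monotone_convergence => //.
- by move=> n; exact: measurable_gheat_arg.
Qed.

Lemma duh_cvg (F_ : nat -> R -> R -> \bar R) F t x :
  (forall n, jmeas (F_ n)) -> (forall n s z, 0 <= F_ n s z) ->
  (forall s z, nondecreasing_seq (fun n => F_ n s z)) ->
  (forall s z, F_ n s z @[n --> \oo] --> F s z) ->
  duh (F_ n) t x @[n --> \oo] --> duh F t x.
Proof.
move=> mF F0 ndF cF; rewrite /duh.
have cg s : gheat (t - s) (F_ n s) x @[n --> \oo] --> gheat (t - s) (F s) x.
  by apply: gheat_cvg => // n; exact: jmeas_sec.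
under eq_integral do rewrite -(cvg_lim _ (cg _))//.
apply: cvg_monotone_convergence => //.
- by move=> n; apply: measurable_funTS; exact: measurable_duh_arg.
- by move=> n s _; exact: gheat_ge0.
- move=> s _ m n mn; apply: gheat_le => //; [exact: jmeas_sec|exact: jmeas_sec|].
  by move=> z; exact: ndF.
Qed.

(** [P_{t-s} P_s f = P_t f] does not depend on [s], so only the scalar integral of [c e^{c s}]
    remains. *)
Lemma duhZ_exp (c : R) (f : R -> \bar R) (t x : R) : (0 <= c)%R -> (0 <= t)%R ->
  measurable_fun setT (f : RR -> \bar R) -> (forall z, 0 <= f z) ->
  duh (fun s z => (c * expR (c * s))%:E * gheat s f z) t x =
  (expR (c * t) - 1)%:E * gheat t f x.
Proof.
move=> c0 t0 mf f0; rewrite /duh.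
have mgf s : measurable_fun setT (gheat s f : RR -> \bar R).
  apply: (@measurable_gheat _ _ RR (fun p : RR * RR => f p.2) (cst s) id) => //.
  exact: measurableT_comp mf measurable_snd.
rewrite (eq_integral (fun s : RR => (c * expR (c * s))%:E * gheat t f x)); last first.
  move=> s; rewrite inE/= in_itv/= => /andP[s0 st].
  rewrite gheatZ//; last 2 first.
    by move=> z; exact: gheat_ge0.
    by rewrite mulr_ge0// expR_ge0.
  by rewrite gheat_semigroup ?subr_ge0// subrK.
rewrite ge0_integralZr//; first last.
- exact: gheat_ge0.
- by move=> s _; rewrite lee_fin mulr_ge0// expR_ge0.
- apply/measurable_EFinP/measurable_funTS; apply: measurable_funM => //.
  apply: (measurableT_comp (@measurable_expR R)); exact: measurable_funM.
under eq_integral do rewrite -[(c * _)%R]mul1r.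
by rewrite integral_exp// mulr0 expR0 mul1r.
Qed.

(* [dom] is the explicit supersolution beta/alpha + 1/(alpha t + 1/M0) of the
   logistic equation k' = beta k - alpha k^2; its bound for t > 0 does not
   depend on M0. *)
Definition dom (beta alpha M0 t : R) : R := beta / alpha + (alpha * t + M0^-1)^-1.

Section dom.
Variables (beta alpha M0 : R).
Hypotheses (beta0 : (0 < beta)%R) (alpha0 : (0 < alpha)%R) (M00 : (0 < M0)%R).
Local Notation k := (dom beta alpha M0).

Lemma dom_gt (t : R) : (0 <= t)%R -> (beta / alpha <= k t)%R.
Proof.
move=> t0; rewrite /dom lerDl invr_ge0 addr_ge0//.
  by rewrite mulr_ge0// ltW.
by rewrite invr_ge0 ltW.
Qed.

Lemma dom_le (t : R) : (0 <= t)%R -> (k t <= beta / alpha + M0)%R.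
Proof.
move=> t0; rewrite /dom lerD2l -[leRHS]invrK lef_pV2 ?posrE ?invr_gt0//.
  by rewrite lerDr mulr_ge0// ltW.
by rewrite ltr_wpDl ?mulr_ge0 ?invr_gt0// ltW.
Qed.

Lemma dom_le_inv (t : R) : (0 < t)%R -> (k t <= beta / alpha + (alpha * t)^-1)%R.
Proof.
move=> t0; rewrite /dom lerD2l lef_pV2 ?posrE ?mulr_gt0//.
  by rewrite lerDl invr_ge0 ltW.
by rewrite addr_gt0 ?mulr_gt0 ?invr_gt0.
Qed.

(** The derivative of [k]. *)
Let D (t : R) : R := (- alpha * (alpha * t + M0^-1)^-2)%R.

Lemma integral_dom (K t : R) : (0 <= t)%R ->
  \int[mu]_(s in `[0%R, t]) (expR (K * s) * (K * k s + D s))%:E =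
  (expR (K * t) * k t - (beta / alpha + M0))%:E.
Proof.
rewrite le_eqVlt => /predU1P[<-|t0].
  rewrite set_itv1 integral_set1 mulr0 expR0 mul1r /dom mulr0 add0r invrK.
  by rewrite subrr.
have pos (s : R) : (0 <= s)%R -> (0 < alpha * s + M0^-1)%R.
  by move=> s0; rewrite ltr_wpDl ?mulr_ge0 ?invr_gt0// ltW.
have dE (s : R) : (0 <= s)%R ->
    is_derive s 1%R (fun s : R => expR (K * s) * k s)%R (expR (K * s) * (K * k s + D s))%R.
  move=> s0; have ps := pos s s0; have ns := lt0r_neq0 ps.
  apply: is_derive_eq.
  rewrite /GRing.scale/= /D; set w := (alpha * s + _)%R in ns *; field; exact: ns.
have cM (c : R) : continuous (fun s : R => c * s)%R by exact: mulrl_continuous.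
have cE : continuous (fun s : R => expR (K * s))%R.
  by move=> x; apply: (cvg_comp _ expR); [exact: cM|exact: continuous_expR].
have cV (s : R) : (0 <= s)%R -> {for s, continuous (fun r : R => (alpha * r + M0^-1)^-1)}%R.
  move=> s0; apply: cvgV; first by rewrite gt_eqF// pos.
  by apply: cvgD; [exact: cM|exact: cvg_cst].
have cF (s : R) : (0 <= s)%R -> {for s, continuous (fun r : R => expR (K * r) * k r)%R}.
  move=> s0; apply: cvgM; first exact: cE.
  by apply: cvgD; [exact: cvg_cst|exact: cV].
rewrite (@continuous_FTC2 _ _ (fun s => expR (K * s) * k s)%R)//.
- by rewrite mulr0 expR0 mul1r [in k 0%R]/dom mulr0 add0r invrK -EFinB.
- apply/continuous_in_subspaceT => s; rewrite inE/= in_itv/= => /andP[s0 _].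
  apply: cvgM; first exact: cE.
  apply: cvgD.
    apply: cvgM; first exact: cvg_cst.
    by apply: cvgD; [exact: cvg_cst|exact: cV].
  apply: cvgM; first exact: cvg_cst.
  rewrite (_ : (fun _ => _) = (fun s => ((alpha * s + M0^-1)^-1) ^+ 2)%R); last first.
    by apply/funext => y; rewrite exprVn.
  rewrite -exprVn.
  by apply: (cvg_comp _ (fun x => x ^+ 2)%R); [exact: cV|exact: sqr_continuous].
- split.
  + move=> x; rewrite in_itv/= => /andP[x0 _]; exact: (@ex_derive _ _ _ _ _ _ _ (dE x (ltW x0))).
  + by apply: cvg_at_right_filter; exact: cF.
  + by apply: cvg_at_left_filter; apply: cF; rewrite ltW.
- move=> x; rewrite in_itv/= => /andP[x0 _].
  by rewrite derive1E; exact: (@derive_val _ _ _ _ _ _ _ (dE x (ltW x0))).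
Qed.

(** With [b = beta / alpha] and [w = k t - b], the left side equals [- alpha b w - alpha w^2] and
    the right side is [- alpha w^2]. *)
Lemma dom_super (t : R) : (0 <= t)%R ->
  (beta * k t - alpha * k t ^+ 2 <= D t)%R.
Proof.
move=> t0; rewrite /D /dom.
have : (0 < (alpha * t + M0^-1)^-1)%R.
  by rewrite invr_gt0 ltr_wpDl ?mulr_ge0 ?invr_gt0// ltW.
rewrite -exprVn; set w := (_^-1)%R; set b := (_ / _)%R => w0.
have -> : beta = (alpha * b)%R by rewrite /b mulrC divfK// gt_eqF.
have b0 : (0 < b)%R by rewrite divr_gt0.
have : (0 <= alpha * (b * w))%R by apply: mulr_ge0; [exact: ltW|apply: mulr_ge0; exact: ltW].
clear -alpha0; nra.
Qed.

End dom.
End mild.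

(** * Tonelli on a triangle, and differences of nonnegative integrals *)

Section triangle.
Local Open Scope ereal_scope.
Context (R : realType).
Notation mu := (@lebesgue_measure R).
Notation RR := (measurableTypeR R).

(** Exchange of order on [0 <= r <= s <= t]. It will be used with [c] an exponential kernel, to
    remove the damping from the fixed-point equation. *)
Lemma ge0_integral_triangle (A : R -> \bar R) (c : R -> R) (t : R) :
  measurable_fun setT (A : RR -> \bar R) -> (forall r, 0 <= A r) ->
  measurable_fun setT (c : RR -> RR) -> (forall s, (0 <= c s)%R) ->
  \int[mu]_(s in `[0%R, t]) ((c s)%:E * \int[mu]_(r in `[0%R, s]) A r) =
  \int[mu]_(r in `[0%R, t]) (A r * \int[mu]_(s in `[r, t]) (c s)%:E).
Proof.
move=> mA A0 mc c0.
pose D : set (RR * RR) := [set q | (0 <= q.2)%R] `&` [set q | (q.2 <= q.1)%R] `&` [set q | (q.1 <= t)%R].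
have mD : measurable D.
  apply: measurableI; first apply: measurableI.
  - by rewrite -[X in measurable X]setTI; apply: measurable_fun_le.
  - by rewrite -[X in measurable X]setTI; apply: measurable_fun_le.
  - by rewrite -[X in measurable X]setTI; apply: measurable_fun_le.
pose h (q : RR * RR) := (c q.1)%:E * A q.2 * (\1_D q)%:E.
have h0 q : 0 <= h q by rewrite /h !mule_ge0// lee_fin.
have mce : measurable_fun setT (EFin \o c : RR -> \bar R) by exact/measurable_EFinP.
have mh : measurable_fun setT h.
  apply: emeasurable_funM; last exact/measurable_EFinP/measurable_indic.
  apply: emeasurable_funM; first exact: (measurableT_comp mce).
  exact: (measurableT_comp mA).
have DE s r : (s, r) \in D = [&& 0 <= r, r <= s & s <= t]%R.
  by apply/idP/idP => [/set_mem[[/= -> ->] ->//]|/and3P[a b d]]; apply/mem_set.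
transitivity (\int[mu]_s \int[mu]_r h (s, r)).
  rewrite integral_mkcond; apply: eq_integral => s _; rewrite patchE.
  case: ifPn; rewrite ?notin_setE ?inE /= in_itv/= => st; last first.
    rewrite (eq_integral (cst 0)) ?integral0// => r _; rewrite /h indicE DE.
    case: and3P => [[r0 rs st']|_]; last by rewrite mule0.
    by exfalso; apply: st; rewrite (le_trans r0 rs).
  rewrite -ge0_integralZl//; last 2 first.
    exact: measurable_funTS.
    by rewrite lee_fin.
  rewrite integral_mkcond; apply: eq_integral => r _; rewrite patchE /h indicE DE.
  case/andP: st => _ ->; rewrite andbT.
  by case: ifPn; rewrite ?notin_setE ?inE /= in_itv/=; [move=> ->|move=> /negP/negbTE ->]; rewrite ?mule1 ?mule0.
rewrite (fubini_tonelli (m1 := mu) (m2 := mu) h mh h0).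
rewrite [RHS]integral_mkcond; apply: eq_integral => r _; rewrite patchE.
case: ifPn; rewrite ?notin_setE ?inE /= in_itv/= => rt; last first.
  rewrite (eq_integral (cst 0)) ?integral0// => s _; rewrite /h indicE DE.
  case: and3P => [[r0 rs st']|_]; last by rewrite mule0.
  by exfalso; apply: rt; rewrite r0 (le_trans rs st').
rewrite -ge0_integralZl//; last 2 first.
  exact: measurable_funTS.
  by move=> s _; rewrite lee_fin.
rewrite [RHS]integral_mkcond; apply: eq_integral => s _; rewrite patchE /h indicE DE.
case/andP: rt => -> _; rewrite andTb.
case: ifPn; rewrite ?notin_setE ?inE /= in_itv/=; [move=> ->|move=> /negP/negbTE ->]; rewrite ?mule1 ?mule0//.
by rewrite muleC.
Qed.

Lemma measurable_integral_itv (A : R -> \bar R) :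
  measurable_fun setT (A : RR -> \bar R) -> (forall r, 0 <= A r) ->
  measurable_fun setT (fun s : RR => \int[mu]_(r in `[0%R, s]) A r).
Proof.
move=> mA A0.
pose D : set (RR * RR) := [set q | (0 <= q.2)%R] `&` [set q | (q.2 <= q.1)%R].
have mD : measurable D.
  by apply: measurableI; rewrite -[X in measurable X]setTI; apply: measurable_fun_le.
pose h (q : RR * RR) := A q.2 * (\1_D q)%:E.
have h0 q : 0 <= h q by rewrite /h !mule_ge0// lee_fin.
have mh : measurable_fun setT h.
  apply: emeasurable_funM; last exact/measurable_EFinP/measurable_indic.
  exact: (measurableT_comp mA).
have DE s r : (s, r) \in D = (0 <= r <= s)%R.
  by apply/idP/idP => [/set_mem[/= -> ->]//|/andP[a b]]; apply/mem_set.
have := measurable_fun_fubini_tonelli_F (m2 := mu) h mh h0.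
congr measurable_fun; apply/funext => s /=.
rewrite [RHS]integral_mkcond; apply: eq_integral => r _.
rewrite /h patchE indicE DE.
by case: ifPn; rewrite ?notin_setE ?inE /= in_itv/=; [move=> ->|move=> /negP/negbTE ->]; rewrite ?mule1 ?mule0.
Qed.

Lemma ge0_integrable d (T : measurableType d) (m : {measure set T -> \bar R}) (D : set T) (f : T -> R) :
  measurable_fun D f -> (forall x, D x -> (0 <= f x)%R) -> \int[m]_(x in D) (f x)%:E < +oo ->
  m.-integrable D (EFin \o f).
Proof.
move=> mf f0 fi; apply/integrableP; split; first exact/measurable_EFinP.
rewrite (eq_integral (EFin \o f))// => x; rewrite inE => Dx.
by rewrite /= ger0_norm// f0.
Qed.

Lemma ge0_integralB d (T : measurableType d) (m : {measure set T -> \bar R}) (D : set T) (f g : T -> R) :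
  measurable D -> measurable_fun D f -> measurable_fun D g ->
  (forall x, D x -> (0 <= f x)%R) -> (forall x, D x -> (0 <= g x)%R) ->
  \int[m]_(x in D) (f x)%:E < +oo -> \int[m]_(x in D) (g x)%:E < +oo ->
  \int[m]_(x in D) (f x - g x)%:E = \int[m]_(x in D) (f x)%:E - \int[m]_(x in D) (g x)%:E.
Proof.
move=> mD mf mg f0 g0 fi gi.
by rewrite -(integralB_EFin mD (ge0_integrable mf f0 fi) (ge0_integrable mg g0 gi)).
Qed.

Lemma gheatD t (f g : R -> \bar R) x : measurable_fun setT (f : RR -> \bar R) ->
  measurable_fun setT (g : RR -> \bar R) ->
  (forall z, 0 <= f z) -> (forall z, 0 <= g z) ->
  gheat t (fun z => f z + g z) x = gheat t f x + gheat t g x.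
Proof.
by move=> mf mg f0 g0; rewrite /gheat ge0_integralD//; exact: measurable_gheat_arg.
Qed.

End triangle.

(** The interface through which the equation sees the branching mechanism. The quadratic lower bound
    gives the supersolution [dom]; the Lipschitz bound from above makes [K u - ps u] monotone; the
    lower bound on slopes makes [ps u + beta u] monotone, hence [ps] measurable on the half-line;
    the last clause, slope almost [- beta] near 0, gives the lower bound for small data. *)
Definition branching (R : realType) (beta alpha : R) (ps : R -> R) : Prop :=
  [/\ ps 0 = 0,
      forall u, 0 <= u -> alpha * u ^+ 2 - beta * u <= ps u,
      forall M, exists2 K, 0 < K &
        forall u w, 0 <= u -> u <= w -> w <= M -> ps w - ps u <= K * (w - u),
      forall u w, 0 <= u -> u <= w -> - beta * (w - u) <= ps w - ps u &
      forall eps, 0 < eps -> exists2 u1, 0 < u1 &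
        forall u, 0 <= u -> u <= u1 -> ps u <= (eps - beta) * u].

(** * Existence of mild solutions by monotone iteration *)

Section mild.
Local Open Scope ereal_scope.
Context (R : realType).
Notation mu := (@lebesgue_measure R).
Notation RR := (measurableTypeR R).
Variables (beta alpha : R) (ps : R -> R).
Hypotheses (beta0 : (0 < beta)%R) (alpha0 : (0 < alpha)%R).
Hypothesis (bps : branching beta alpha ps).
Variables (M0 : R) (G : R -> R).
Hypotheses (M00 : (0 < M0)%R) (mG : measurable_fun setT (G : RR -> RR)).
Hypotheses (G0 : forall x, (0 <= G x)%R) (GM : forall x, (G x <= M0)%R).

Local Notation k := (dom beta alpha M0).
Let M := (beta / alpha + M0)%R.
Variable K : R.
Hypotheses (K0 : (0 < K)%R)
  (lipK : forall u w : R, (0 <= u)%R -> (u <= w)%R -> (w <= M)%R ->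
    (ps w - ps u <= K * (w - u))%R).

Let M_gt0 : (0 < M)%R. Proof. by rewrite addr_gt0// divr_gt0. Qed.

(** The constant [K] controls [ps] only on [[0, M]]. Clamping makes [phi] below monotone on the
    whole line; solutions stay in [[0, M]], where the clamp is the identity. *)
Let clamp (u : R) : R := Num.max 0%R (Num.min u M).

Let clamp_ge0 u : (0 <= clamp u)%R. Proof. by rewrite /clamp le_max lexx. Qed.

Let clamp_leM u : (clamp u <= M)%R.
Proof. by rewrite /clamp ge_max (ltW M_gt0) ge_min lexx orbT. Qed.

Let clamp_nd u w : (u <= w)%R -> (clamp u <= clamp w)%R.
Proof.
move=> uw; rewrite /clamp ge_max le_max lexx/= le_max; apply/orP; right.
by rewrite le_min !ge_min lexx uw/= orbT.
Qed.

Let clampE u : (0 <= u)%R -> (u <= M)%R -> clamp u = u.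
Proof. by move=> u0 uM; rewrite /clamp min_l// max_r. Qed.

Let clamp_lip u w : (u <= w)%R -> (clamp w - clamp u <= w - u)%R.
Proof.
move=> uw; rewrite /clamp; have := ltW M_gt0.
by case: (leP u M) => ?; case: (leP w M) => ?; case: (leP 0%R u) => ?;
  case: (leP 0%R w) => ?; case: (leP 0%R M) => ?; lra.
Qed.

(** Writing the equation as [v' = v''/2 - K v + phi(v)] gives a nondecreasing nonnegative reaction
    term, as monotone iteration requires. *)
Let phi (u : R) : R := (K * clamp u - ps (clamp u))%R.

Let phi_nd u w : (u <= w)%R -> (phi u <= phi w)%R.
Proof.
move=> uw; rewrite /phi.
have := lipK (clamp_ge0 u) (clamp_nd uw) (clamp_leM w); lra.
Qed.

Let phi_ge0 u : (0 <= phi u)%R.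
Proof.
have [ps0 _ _ _ _] := bps.
have := lipK (lexx 0%R) (clamp_ge0 u) (clamp_leM u); rewrite /phi ps0; lra.
Qed.

Let phi_lip u w : (u <= w)%R -> (phi w - phi u <= (K + beta) * (w - u))%R.
Proof.
move=> uw; rewrite /phi; have [_ _ _ lb _] := bps.
have h := lb _ _ (clamp_ge0 u) (clamp_nd uw).
have := ler_wpM2l (ltW (addr_gt0 K0 beta0)) (clamp_lip uw); lra.
Qed.

Let mphi : measurable_fun setT (phi : RR -> RR).
Proof. by apply: nondecreasing_measurable => // u w; exact: phi_nd. Qed.

Let phi_cvg (u_ : nat -> R) (u : R) : (forall n, (u_ n <= u)%R) ->
  (u_ n @[n --> \oo] --> u)%R -> (phi (u_ n) @[n --> \oo] --> phi u)%R.
Proof.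
move=> ub uc.
have h : (phi u - (K + beta) * (u - u_ n))%R @[n --> \oo] --> phi u.
  rewrite -[X in _ --> X]subr0; apply: cvgB; first exact: cvg_cst.
  rewrite -[X in _ --> X](mulr0 (K + beta)%R); apply: cvgM; first exact: cvg_cst.
  by rewrite -(subrr u); apply: cvgB => //; exact: cvg_cst.
apply: (squeeze_cvgr _ h (cvg_cst (phi u))).
apply: nearW => n; rewrite (phi_nd (ub n)) andbT.
have := phi_lip (ub n); lra.
Qed.

(** Variation of constants for the equation with damping [- K v]: multiplying by [e^{K t}] removes
    the damping and puts the weight [e^{K s}] on the source. *)
Let iter_op (u : R -> R -> R) (t x : R) : \bar R :=
  (expR (- (K * t)))%:E * (gheat t (EFin \o G) x +
     duh (fun s z => (expR (K * s) * phi (u s z))%:E) t x).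

Let mfun2 (u : R -> R -> R) := measurable_fun setT (fun p : RR * RR => u p.1 p.2 : RR).

Let meG : measurable_fun setT (EFin \o G : RR -> \bar R).
Proof. exact/measurable_EFinP. Qed.

Let eG0 z : 0 <= (EFin \o G) z. Proof. by rewrite lee_fin. Qed.

Let F (u : R -> R -> R) := (fun s z => (expR (K * s) * phi (u s z))%:E).

Let F0 u s z : 0 <= F u s z. Proof. by rewrite lee_fin mulr_ge0// expR_ge0. Qed.

Let mexpK d (T : measurableType d) (f : T -> RR) (c : R) : measurable_fun setT f ->
  measurable_fun setT (fun p => expR (c * f p) : RR).
Proof.
move=> mf; apply: (measurableT_comp (@measurable_expR R)).
exact: measurable_funM.
Qed.

Let mF u : mfun2 u -> jmeas (F u).
Proof.
move=> mu_; apply/measurable_EFinP; apply: measurable_funM; first exact: mexpK.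
exact: (measurableT_comp mphi).
Qed.

Let mgG : jmeas (fun t x => gheat t (EFin \o G) x).
Proof.
apply: (@measurable_gheat _ _ (RR * RR)%type (fun p : (RR * RR) * RR => (EFin \o G) p.2) fst snd) => //.
exact: (measurableT_comp meG).
Qed.

Let iter_op_ge0 u t x : 0 <= iter_op u t x.
Proof.
by rewrite /iter_op mule_ge0// adde_ge0//; [apply: gheat_ge0|apply: duh_ge0 => s z; exact: F0].
Qed.

Let miter_op u : mfun2 u -> jmeas (iter_op u).
Proof.
move=> mu_; apply: emeasurable_funM.
  apply/measurable_EFinP; rewrite (_ : (fun _ => _) = (fun p : RR * RR => expR ((- K) * p.1))%R).
    exact: mexpK.
  by apply/funext => p; rewrite mulNr.
apply: emeasurable_funD; first exact: mgG.
by apply: measurable_duh; [exact: mF|move=> *; exact: F0].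
Qed.

Let iter_op_le u w t x : mfun2 u -> mfun2 w ->
  (forall s z, (0 <= s <= t)%R -> (u s z <= w s z)%R) ->
  iter_op u t x <= iter_op w t x.
Proof.
move=> mu_ mw uw; rewrite /iter_op; apply: lee_wpmul2l; first by rewrite lee_fin expR_ge0.
apply: leeD2l; apply: duh_le; [exact: mF|exact: mF|exact: F0|exact: F0|].
by move=> s z st; rewrite lee_fin ler_wpM2l ?expR_ge0// phi_nd// uw.
Qed.

Let gG_le t x : gheat t (EFin \o G) x <= M0%:E.
Proof.
rewrite -[leRHS](gheat_cst t M0%:E x); exact: gheat_le.
Qed.

Let gG_fin t x : gheat t (EFin \o G) x \is a fin_num.
Proof. by rewrite ge0_fin_numE ?gheat_ge0// (le_lt_trans (gG_le _ _))// ltry. Qed.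

Let phi_le_dom s u : (0 <= s)%R -> (u <= k s)%R ->
  (phi u <= K * k s + - alpha * (alpha * s + M0^-1) ^- 2)%R.
Proof.
move=> s0 uk; apply: (le_trans (phi_nd uk)).
have ba : (0 < beta / alpha)%R by rewrite divr_gt0.
have k0 : (0 <= k s)%R by rewrite (le_trans (ltW ba))// dom_gt.
rewrite /phi clampE// ?dom_le//.
have [_ lb _ _ _] := bps; have := lb _ k0.
have := dom_super beta0 alpha0 M00 s0; lra.
Qed.

(** Below [k] the reaction is at most [K k + k'], whose weighted integral is exactly
    [e^{K t} k(t) - k(0)]. Since [P_t G <= M0 <= k(0)], the image stays below [k]. *)
Let iter_op_dom u t x : (0 <= t)%R -> mfun2 u ->
  (forall s z, (0 <= s <= t)%R -> (u s z <= k s)%R) ->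
  iter_op u t x <= (k t)%:E.
Proof.
move=> t0 mu_ uk; rewrite /iter_op.
apply: (@le_trans _ _ ((expR (- (K * t)))%:E * (M0%:E + (expR (K * t) * k t - M)%:E))); last first.
  rewrite -EFinD -EFinM lee_fin.
  have -> : (M0 + (expR (K * t) * k t - M) = expR (K * t) * k t - beta / alpha)%R.
    by rewrite /M; ring.
  rewrite mulrBr mulrA -expRD addNr expR0 mul1r lerBlDr lerDl.
  by rewrite mulr_ge0 ?expR_ge0// divr_ge0// ltW.
apply: lee_wpmul2l; first by rewrite lee_fin expR_ge0.
apply: leeD => //.
rewrite -(integral_dom beta alpha0 M00 K t0) /duh.
apply: ge0_le_integral => //.
- by move=> s _; apply: gheat_ge0 => z; exact: F0.
- by apply: measurable_funTS; apply: measurable_duh_arg; [exact: mF|exact: F0].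
(* Truncating time at 0 keeps the denominator positive everywhere, so [w] is nonincreasing on the
   line and therefore measurable. *)
- pose w (s : RR) : RR := (alpha * Num.max s 0 + M0^-1)^-1%R.
  have mw : measurable_fun setT w.
    apply: nonincreasing_measurable => // r s rs; rewrite /w.
    have pos (y : R) : (0 < alpha * Num.max y 0 + M0^-1)%R.
      by rewrite ltr_wpDl ?invr_gt0// mulr_ge0 ?(ltW alpha0)// le_max lexx orbT.
    rewrite lef_pV2 ?posrE// lerD2r ler_pM2l//.
    by rewrite ge_max !le_max rs lexx !orbT.
  apply/measurable_EFinP.
  apply: (eq_measurable_fun (fun s => expR (K * s) *
      (K * (beta / alpha + w s) + - alpha * w s ^+ 2)))%R.
    move=> s; rewrite inE/= in_itv/= => /andP[s0 _].
    by rewrite /w max_l// exprVn.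
  apply/measurable_funTS; apply: measurable_funM; first exact: mexpK.
  apply: measurable_funD; apply: measurable_funM => //.
    exact: measurable_funD.
  exact: measurable_funX.
- move=> s /=; rewrite in_itv/= => /[dup] st /andP[s0 _].
  rewrite -[leRHS](gheat_cst (t - s) _ x); apply: gheat_le => //.
  + exact: (jmeas_sec _ (mF mu_)).
  + by move=> z; exact: F0.
  + by move=> z; rewrite lee_fin ler_wpM2l ?expR_ge0// phi_le_dom// uk.
Qed.

Let iter_op_fin u t x : (0 <= t)%R -> mfun2 u ->
  (forall s z, (0 <= s <= t)%R -> (u s z <= k s)%R) ->
  iter_op u t x \is a fin_num.
Proof.
move=> t0 mu_ uk.
by rewrite ge0_fin_numE// (le_lt_trans (iter_op_dom _ _ mu_ uk))// ltry.
Qed.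

(* (K + c) e^{(K + c) s} P_s G is the source for which Duhamel's formula
   returns e^{c t} P_t G *)
Let iter_op_exp (c t x : R) : (0 <= K + c)%R -> (0 <= t)%R ->
  (expR (- (K * t)))%:E * (gheat t (EFin \o G) x +
    duh (fun s z => ((K + c) * expR ((K + c) * s))%:E * gheat s (EFin \o G) z) t x) =
  (expR (c * t))%:E * gheat t (EFin \o G) x.
Proof.
move=> Kc t0; rewrite duhZ_exp//.
rewrite -[X in X + _]mul1e -ge0_muleDl ?lee_fin//; last first.
  by rewrite subr_ge0 -expR0 ler_expR mulr_ge0.
rewrite -EFinD addrC subrK muleA -EFinM -expRD; congr ((expR _)%:E * _); ring.
Qed.

Let mexpG (c d : R) : jmeas (fun s z => (c * expR (d * s))%:E * gheat s (EFin \o G) z).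
Proof.
apply: emeasurable_funM; last exact: mgG.
by apply/measurable_EFinP; apply: measurable_funM => //; exact: mexpK.
Qed.

(** From [ps u >= - beta u] follows [phi u <= (K + beta) u]. Inserting the assumed bound on [u]
    gives the source of [iter_op_exp] with [c = beta], which reproduces the same bound. *)
Let iter_op_ub u t x : (0 <= t)%R -> mfun2 u ->
  (forall s z, (0 <= s <= t)%R -> (0 <= u s z <= k s)%R) ->
  (forall s z, (0 <= s <= t)%R -> (u s z)%:E <= (expR (beta * s))%:E * gheat s (EFin \o G) z) ->
  iter_op u t x <= (expR (beta * t))%:E * gheat t (EFin \o G) x.
Proof.
move=> t0 mu_ u0k ub; rewrite -(@iter_op_exp beta t x)//; last by rewrite addr_ge0// ltW.
rewrite /iter_op; apply: lee_wpmul2l; first by rewrite lee_fin expR_ge0.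
apply: leeD2l; apply: duh_le; [exact: mF|exact: mexpG|exact: F0| |].
  move=> s z; rewrite mule_ge0 ?gheat_ge0// lee_fin mulr_ge0 ?expR_ge0//.
  by rewrite addr_ge0 ?ltW.
move=> s z st; have /andP[us0 usk] := u0k _ z st.
have s0 : (0 <= s)%R by case/andP: st.
have usM : (u s z <= M)%R by apply: (le_trans usk); exact: dom_le.
apply: (@le_trans _ _ ((expR (K * s) * (K + beta))%:E * (u s z)%:E)).
  rewrite -EFinM lee_fin -mulrA ler_wpM2l ?expR_ge0// /phi clampE//.
  have [_ lb _ _ _] := bps; have := lb _ us0.
  have : (0 <= alpha * u s z ^+ 2)%R by rewrite mulr_ge0 ?sqr_ge0// ltW.
  lra.
apply: (@le_trans _ _ ((expR (K * s) * (K + beta))%:E * ((expR (beta * s))%:E * gheat s (EFin \o G) z))).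
  apply: lee_wpmul2l; last exact: ub.
  by rewrite lee_fin mulr_ge0 ?expR_ge0// addr_ge0 ?ltW.
by rewrite muleA -EFinM mulrAC -expRD -mulrDl mulrC.
Qed.

Section iteration.
Variable u0 : R -> R -> R.
Hypothesis mu0 : mfun2 u0.
Hypothesis u0k : forall t x, (0 <= t)%R -> (0 <= u0 t x <= k t)%R.
Hypothesis u0ub : forall t x, (0 <= t)%R ->
  (u0 t x)%:E <= (expR (beta * t))%:E * gheat t (EFin \o G) x.
Hypothesis u0sub : forall t x, (0 <= t)%R -> (u0 t x)%:E <= iter_op u0 t x.

(** Iterates must be defined, measurable and monotone in [n] at all real times; negative times are
    given the value at time 0. *)
Let pt (t : R) : R := Num.max t 0%R.

Let pt_ge0 t : (0 <= pt t)%R. Proof. by rewrite /pt le_max lexx orbT. Qed.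

Let ptE t : (0 <= t)%R -> pt t = t. Proof. by move=> t0; rewrite /pt max_l. Qed.

Let pt_id t : pt (pt t) = pt t. Proof. by rewrite ptE. Qed.

Let mpt (T : Type) d (S : measurableType d) (f : R -> R -> S) :
  measurable_fun setT (fun p : RR * RR => f p.1 p.2) ->
  measurable_fun setT (fun p : RR * RR => f (pt p.1) p.2).
Proof.
move=> mf; apply: (measurableT_comp mf (g := fun p : RR * RR => (pt p.1 : RR, p.2))).
by apply: measurable_fun_pair => //; exact: measurable_maxr.
Qed.

Let V := fix V (n : nat) : R -> R -> R :=
  if n is n'.+1 then fun t x => fine (iter_op (V n') (pt t) x)
  else fun t x => u0 (pt t) x.

Let mV n : mfun2 (V n).
Proof.
elim: n => [|n ih]; first exact: (mpt unit).
apply: (measurableT_comp (f := @fine R) (fine_measurable measurableT)).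
by apply: (mpt unit (f := iter_op (V n))); exact: miter_op.
Qed.

Let Vpt n t x : V n (pt t) x = V n t x.
Proof. by case: n => [|n] /=; rewrite pt_id. Qed.

Let V0k n t x : (0 <= t)%R -> (0 <= V n t x <= k t)%R.
Proof.
elim: n t x => [|n ih] t x t0 /=; first by rewrite ptE// u0k.
rewrite ptE//; apply/andP; split; first exact: fine_ge0.
rewrite -lee_fin fineK; last by apply: iter_op_fin => // s z /andP[s0 _]; case/andP: (ih s z s0).
by apply: iter_op_dom => // s z /andP[s0 _]; case/andP: (ih s z s0).
Qed.

Let VS n t x : (0 <= t)%R -> (V n.+1 t x)%:E = iter_op (V n) t x.
Proof.
move=> t0; rewrite /= ptE// fineK// iter_op_fin// => s z /andP[s0 _].
by case/andP: (V0k n z s0).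
Qed.

Let Vub n t x : (0 <= t)%R ->
  (V n t x)%:E <= (expR (beta * t))%:E * gheat t (EFin \o G) x.
Proof.
elim: n t x => [|n ih] t x t0; first by rewrite /= ptE// u0ub.
rewrite VS//; apply: iter_op_ub => // s z /andP[s0 _]; [exact: V0k|exact: ih].
Qed.

(** Induction with monotonicity of [iter_op]; it starts from the assumption that [u0] is a
    subsolution. In the base case freezing negative times is harmless, because [iter_op] at time [t]
    reads only times in [[0, t]]. *)
Let V_step n t x : (V n t x <= V n.+1 t x)%R.
Proof.
rewrite -(Vpt n) -(Vpt n.+1).
elim: n t x => [|n ih] t x.
  rewrite -lee_fin VS// /= pt_id.
  have -> : iter_op (fun t x => u0 (pt t) x) (pt t) x = iter_op u0 (pt t) x.
    rewrite /iter_op /duh; congr (_ * (_ + _))%E; apply: eq_integral => s.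
    by rewrite inE/= in_itv/= => /andP[s0 _]; rewrite (ptE s0).
  exact: u0sub.
rewrite -lee_fin [leLHS](VS n x (pt_ge0 t)) [leRHS](VS n.+1 x (pt_ge0 t)).
apply: iter_op_le; [exact: mV|exact: mV|move=> s z /andP[s0 _]].
by have := ih s z; rewrite !ptE.
Qed.

Let V_nd t x : nondecreasing_seq (fun n => V n t x).
Proof. by apply/nondecreasing_seqP => n; exact: V_step. Qed.

Definition mild_sol (t x : R) : R := limn (fun n => V n t x).

Let V_bnd n t x : (V n t x <= k (pt t))%R.
Proof. by rewrite -Vpt; case/andP: (V0k n x (pt_ge0 t)). Qed.

Let V_is_cvg t x : cvgn (fun n => V n t x).
Proof.
apply: (nondecreasing_is_cvgn (V_nd t x)).
by exists (k (pt t)) => _ [n _ <-]; exact: V_bnd.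
Qed.

Let V_cvg t x : (V n t x @[n --> \oo] --> mild_sol t x)%R.
Proof. exact: V_is_cvg. Qed.

Let V_le n t x : (V n t x <= mild_sol t x)%R.
Proof. exact: (nondecreasing_cvgn_le (V_nd t x) (@V_is_cvg t x)). Qed.

Lemma measurable_mild_sol : mfun2 mild_sol.
Proof.
apply: (measurable_fun_cvg (h := fun n (p : RR * RR) => V n p.1 p.2)).
  by move=> n; exact: mV.
by move=> p _; exact: V_cvg.
Qed.

Lemma mild_sol_bounds t x : (0 <= t)%R -> (0 <= mild_sol t x <= k t)%R.
Proof.
move=> t0; apply/andP; split.
  by apply: (le_trans _ (V_le 0 t x)); case/andP: (V0k 0 x t0).
apply: limr_le; first exact: V_is_cvg.
by apply: nearW => n; case/andP: (V0k n x t0).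
Qed.

Lemma mild_sol_ub t x : (0 <= t)%R ->
  (mild_sol t x)%:E <= (expR (beta * t))%:E * gheat t (EFin \o G) x.
Proof.
move=> t0; have gf : (expR (beta * t))%:E * gheat t (EFin \o G) x \is a fin_num.
  by rewrite fin_numM.
rewrite -(fineK gf) lee_fin; apply: limr_le; first exact: V_is_cvg.
by apply: nearW => n; rewrite -lee_fin fineK// Vub.
Qed.

Lemma mild_sol_lb t x : (0 <= t)%R -> (u0 t x <= mild_sol t x)%R.
Proof. by move=> t0; have := V_le 0 t x; rewrite /= ptE. Qed.

(** Both sides are limits of the same sequence: the iterates increase and [phi] is Lipschitz and
    monotone, so monotone convergence passes through [iter_op]. *)
Let mild_sol_fix t x : (0 <= t)%R -> (mild_sol t x)%:E = iter_op mild_sol t x.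
Proof.
move=> t0; apply/esym.
have c1 : iter_op (V n) t x @[n --> \oo] --> iter_op mild_sol t x.
  rewrite /iter_op; apply: cvgeMl => //; apply: cvgeD => //.
  - by rewrite ge0_adde_def// inE; [exact: gheat_ge0|apply: duh_ge0 => s z; exact: F0].
  - exact: cvg_cst.
  apply: (@duh_cvg _ (fun n => F (V n)) (F mild_sol)).
  - by move=> n; exact: mF.
  - by move=> n s z; exact: F0.
  - move=> s z m n mn; rewrite lee_fin ler_wpM2l ?expR_ge0// phi_nd//.
    exact: V_nd.
  - move=> s z; apply: cvg_EFin; first exact: nearW.
    apply: cvgM; first exact: cvg_cst.
    by apply: phi_cvg; [move=> n; exact: V_le|exact: V_cvg].
have c2 : iter_op (V n) t x @[n --> \oo] --> (mild_sol t x)%:E.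
  under eq_fun do rewrite -VS//.
  apply: cvg_EFin; first exact: nearW.
  by have := @V_cvg t x; rewrite -(cvg_shiftS (fun n => V n t x)).
exact: (cvg_unique _ c1 c2).
Qed.

Let v_pt t x : mild_sol (pt t) x = mild_sol t x.
Proof. by rewrite /mild_sol; congr (limn _); apply/funext => n; rewrite Vpt. Qed.

Let v_ge0 t x : (0 <= mild_sol t x)%R.
Proof. by have /andP[] := mild_sol_bounds x (pt_ge0 t); rewrite v_pt. Qed.

Let v_leM t x : (mild_sol t x <= M)%R.
Proof.
have /andP[_] := mild_sol_bounds x (pt_ge0 t); rewrite v_pt => /le_trans; apply.
exact: dom_le.
Qed.

Let E s z : \bar R := (mild_sol s z)%:E.
Let P s z : \bar R := (phi (mild_sol s z))%:E.

Let mE : jmeas E. Proof. by apply/measurable_EFinP; exact: measurable_mild_sol. Qed.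
Let mP : jmeas P.
Proof. by apply/measurable_EFinP; exact: (measurableT_comp mphi measurable_mild_sol). Qed.
Let E0 s z : 0 <= E s z. Proof. by rewrite lee_fin. Qed.
Let P0 s z : 0 <= P s z. Proof. by rewrite lee_fin. Qed.

(** Removal of the damping from the fixed-point equation. The linear term [K v] is kept on the left,
    so all terms are nonnegative and no infinite quantities are subtracted. *)
Let mild_sol_nonneg_eq t x : (0 <= t)%R ->
  E t x + K%:E * duh E t x = gheat t (EFin \o G) x + duh P t x.
Proof.
move=> t0.
pose A r := gheat (t - r) (F mild_sol r) x.
have mFv : jmeas (F mild_sol) by apply: mF; exact: measurable_mild_sol.
have F0v s z : 0 <= F mild_sol s z by exact: F0.
have mA : measurable_fun setT (A : RR -> \bar R) by exact: measurable_duh_arg.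
have A0 r : 0 <= A r by apply: gheat_ge0 => z; exact: F0.
pose c s := (K * expR (- K * s))%R.
have mc : measurable_fun setT (c : RR -> RR) by apply: measurable_funM => //; exact: mexpK.
have c0 s : (0 <= c s)%R by rewrite mulr_ge0 ?expR_ge0// ltW.
have mce : measurable_fun setT (EFin \o c : RR -> \bar R) by exact/measurable_EFinP.
have Cint a b : (a <= b)%R -> \int[mu]_(s in `[a, b]) (c s)%:E = (expR (- K * a) - expR (- K * b))%:E.
  move=> ab; rewrite (eq_integral (fun s : RR => (-1 * (- K * expR (- K * s)))%:E)).
    by rewrite integral_exp// mulN1r opprB.
  by move=> s _; rewrite mulN1r mulNr opprK.
have mexp c' : measurable_fun setT (fun r : RR => (expR (c' * r))%:E).
  by apply/measurable_EFinP; exact: mexpK.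
have Cge0 r : (0 <= r <= t)%R -> (0 <= expR (- K * r) - expR (- K * t))%R.
  by move=> /andP[r0 rt]; rewrite subr_ge0 ler_expR ler_nM2l// oppr_lt0.
(* Applying [P_{t-s}] to the fixed-point equation at time [s] brings everything to time [t]; only
   the cut of the time integral at [s] remembers [s]. *)
have EA s : (0 <= s <= t)%R -> gheat (t - s) (E s) x =
    (expR (- K * s))%:E * (gheat t (EFin \o G) x + \int[mu]_(r in `[0%R, s]) A r).
  move=> st; have /andP[s0 ts] := st.
  have mD : measurable_fun setT (duh (F mild_sol) s : RR -> \bar R).
    by apply: jmeas_sec; exact: measurable_duh.
  have mg : measurable_fun setT (gheat s (EFin \o G) : RR -> \bar R) by exact: (jmeas_sec s mgG).
  have -> : E s = (fun z => (expR (- K * s))%:E * (gheat s (EFin \o G) z + duh (F mild_sol) s z)).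
    by apply/funext => z; rewrite /E mild_sol_fix// /iter_op mulNr.
  rewrite gheatZ//.
  - congr (_ * _); rewrite gheatD//.
    + rewrite gheat_semigroup ?subr_ge0// subrK; congr (_ + _).
      by rewrite gheat_duh.
    + by move=> z; exact: gheat_ge0.
    + by move=> z; exact: duh_ge0.
  - exact: emeasurable_funD.
  - by move=> z; rewrite adde_ge0//; [exact: gheat_ge0|exact: duh_ge0].
have gG0 : 0 <= gheat t (EFin \o G) x by exact: gheat_ge0.
have IA0 s : 0 <= \int[mu]_(r in `[0%R, s]) A r by apply: integral_ge0.
have mIA : measurable_fun setT (fun s : RR => \int[mu]_(r in `[0%R, s]) A r).
  exact: measurable_integral_itv.
(* [EA] integrated against [K e^{-K s}], with the order exchanged on the triangle. The missing
   [e^{-K t}] parts are supplied by [v(t)] itself, through the fixed-point equation. *)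
have -> : K%:E * duh E t x = (1 - expR (- K * t))%:E * gheat t (EFin \o G) x +
    \int[mu]_(r in `[0%R, t]) (A r * (expR (- K * r) - expR (- K * t))%:E).
  rewrite /duh -ge0_integralZl//; last 3 first.
  - by apply: measurable_funTS; exact: measurable_duh_arg.
  - by move=> s _; exact: gheat_ge0.
  - by rewrite lee_fin ltW.
  rewrite (eq_integral (fun s : RR => (c s)%:E * gheat t (EFin \o G) x +
      (c s)%:E * \int[mu]_(r in `[0%R, s]) A r)); last first.
    move=> s; rewrite inE/= in_itv/= => st.
    by rewrite EA// muleA -EFinM ge0_muleDr.
  rewrite ge0_integralD//.
  - congr (_ + _).
      rewrite ge0_integralZr//.
      + by rewrite Cint// mulr0 expR0.
      + exact: measurable_funTS.
      + by move=> s _; rewrite lee_fin.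
    rewrite (ge0_integral_triangle t mA A0 mc c0).
    by apply: eq_integral => r; rewrite inE/= in_itv/= => /andP[_ rt]; rewrite Cint.
  - by move=> s _; rewrite mule_ge0// lee_fin.
  - by apply: measurable_funTS; apply: emeasurable_funM.
  - by move=> s _; rewrite mule_ge0// lee_fin.
  - by apply: measurable_funTS; apply: emeasurable_funM.
rewrite {1}/E mild_sol_fix// /iter_op -mulNr ge0_muleDr//; last exact: duh_ge0.
rewrite addeACA -ge0_muleDl ?lee_fin ?expR_ge0//; last first.
  by rewrite subr_ge0 -[leRHS]expR0 ler_expR mulNr oppr_le0 mulr_ge0// ltW.
rewrite -EFinD [(_ + (1 - _))%R]addrC subrK mul1e; congr (_ + _).
rewrite -[X in _ * X + _]/(\int[mu]_(s in `[0%R, t]) A s) /duh.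
rewrite -ge0_integralZl//; last exact: measurable_funTS.
rewrite -ge0_integralD//; last 4 first.
- by move=> r _; rewrite mule_ge0// lee_fin expR_ge0.
- by apply: measurable_funTS; apply: emeasurable_funM.
- by move=> r; rewrite /= in_itv/= => rt; rewrite mule_ge0// lee_fin Cge0.
- apply: measurable_funTS; apply: emeasurable_funM => //.
  apply/measurable_EFinP; apply: measurable_funB => //; exact: mexpK.
apply: eq_integral => r; rewrite inE/= in_itv/= => rt.
rewrite -/(A r) [X in X + _]muleC -ge0_muleDr ?lee_fin ?expR_ge0 ?Cge0//.
rewrite -EFinD addrC subrK /A.
rewrite (_ : F mild_sol r = (fun z => (expR (K * r))%:E * P r z)); last first.
  by apply/funext => z; rewrite /F /P EFinM.
rewrite gheatZ ?expR_ge0//; last exact: jmeas_sec mP.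
by rewrite muleC muleA -EFinM -expRD mulNr addNr expR0 mul1e.
Qed.

(** On the range of the solution the clamp is the identity, so [K v - phi(v) = ps(v)]. The bounds
    [M] and [phi M] make every integral finite, so the nonnegative form can be subtracted in [R]. *)
Lemma mild_sol_eq t x : (0 <= t)%R ->
  (mild_sol t x + fine (\int[mu]_(s in `[0%R, t])
     (fine (\int[gauss R]_y (ps (mild_sol s (x + Num.sqrt (t - s) * y)))%:E))%:E)
   = fine (gheat t (EFin \o G) x))%R.
Proof.
move=> t0.
have psE s z : (ps (mild_sol s z) = K * mild_sol s z - phi (mild_sol s z))%R.
  by rewrite /phi clampE//; ring.
have phiM : forall s z, (phi (mild_sol s z) <= phi M)%R by move=> s z; exact: phi_nd.
have gEM s : gheat (t - s) (E s) x <= M%:E.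
  rewrite -[leRHS](gheat_cst (t - s) M%:E x); apply: gheat_le => //.
    exact: jmeas_sec mE.
  by move=> z; rewrite lee_fin.
have gPM s : gheat (t - s) (P s) x <= (phi M)%:E.
  rewrite -[leRHS](gheat_cst (t - s) (phi M)%:E x); apply: gheat_le => //.
    exact: jmeas_sec mP.
  by move=> z; rewrite lee_fin.
have gEf s : gheat (t - s) (E s) x \is a fin_num.
  by rewrite ge0_fin_numE ?gheat_ge0// (le_lt_trans (gEM _))// ltry.
have gPf s : gheat (t - s) (P s) x \is a fin_num.
  by rewrite ge0_fin_numE ?gheat_ge0// (le_lt_trans (gPM _))// ltry.
have KEf s : K%:E * gheat (t - s) (E s) x \is a fin_num by rewrite fin_numM.
have inner s : fine (\int[gauss R]_y (ps (mild_sol s (x + Num.sqrt (t - s) * y)))%:E) =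
   (K * fine (gheat (t - s) (E s) x) - fine (gheat (t - s) (P s) x))%R.
  under eq_integral do rewrite psE.
  have ms : measurable_fun setT (fun y : RR => mild_sol s (x + Num.sqrt (t - s) * y) : RR)%R.
    apply: (measurableT_comp (measurableT_comp measurable_mild_sol (pair1_measurable s))).
    by apply: measurable_funD => //; exact: measurable_funM.
  rewrite (ge0_integralB (m := gauss R) (f := fun y => (K * mild_sol s (x + Num.sqrt (t - s) * y))%R)
    (g := fun y => phi (mild_sol s (x + Num.sqrt (t - s) * y)%R)))//.
  - under eq_integral do rewrite EFinM.
    rewrite -[X in fine (X - _)]/(gheat (t - s) (fun z => K%:E * E s z) x) gheatZ//; last 2 first.
      exact: jmeas_sec mE.
      exact: ltW.
    by rewrite -[X in fine (_ - X)]/(gheat (t - s) (P s) x) fineB// fineM.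
  - exact: measurable_funM.
  - exact: (measurableT_comp mphi).
  - by move=> y _; rewrite mulr_ge0// ltW.
  - under eq_integral do rewrite EFinM.
    rewrite -[X in X < _]/(gheat (t - s) (fun z => K%:E * E s z) x) gheatZ//; last 2 first.
      exact: jmeas_sec mE.
      exact: ltW.
    by rewrite ltey_eq KEf.
  - by rewrite -[X in X < _]/(gheat (t - s) (P s) x) ltey_eq gPf.
under eq_integral do rewrite inner.
have duh_fin H C : jmeas H -> (forall s z, 0 <= H s z) -> (forall s, gheat (t - s) (H s) x <= C%:E) ->
    duh H t x \is a fin_num.
  move=> mH H0 HC; rewrite ge0_fin_numE ?duh_ge0//.
  apply: (@le_lt_trans _ _ (\int[mu]_(s in `[0%R, t]) C%:E)).
    apply: ge0_le_integral => //; first by move=> s _; exact: gheat_ge0.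
    by apply: measurable_funTS; exact: measurable_duh_arg.
  rewrite integral_cst//= lebesgue_measure_itv/= lte_fin.
  by case: ifP => _; rewrite ?mule0 ?ltry// -EFinB -EFinM ltry.
have dE : duh E t x \is a fin_num by apply: (duh_fin _ _ mE).
have dP : duh P t x \is a fin_num by apply: (duh_fin _ _ mP).
have mfE : measurable_fun setT (fun s : RR => fine (gheat (t - s) (E s) x) : RR).
  by apply: (measurableT_comp (fine_measurable measurableT)); exact: measurable_duh_arg.
have mfP : measurable_fun setT (fun s : RR => fine (gheat (t - s) (P s) x) : RR).
  by apply: (measurableT_comp (fine_measurable measurableT)); exact: measurable_duh_arg.
have iE : \int[mu]_(s in `[0%R, t]) (K * fine (gheat (t - s) (E s) x))%:E = K%:E * duh E t x.
  rewrite /duh -ge0_integralZl//.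
  - by apply: eq_integral => s _; rewrite EFinM fineK.
  - by apply: measurable_funTS; exact: measurable_duh_arg.
  - by move=> s _; exact: gheat_ge0.
  - by rewrite lee_fin ltW.
have iP : \int[mu]_(s in `[0%R, t]) (fine (gheat (t - s) (P s) x))%:E = duh P t x.
  by apply: eq_integral => s _; rewrite fineK.
rewrite (ge0_integralB (m := mu) (f := fun s => (K * fine (gheat (t - s) (E s) x))%R)
    (g := fun s => fine (gheat (t - s) (P s) x)))//.
- rewrite iE iP fineB ?fin_numM//.
  have := mild_sol_nonneg_eq x t0.
  move/(congr1 (@fine R)); rewrite fineD// ?fin_numM// fineD//= => h.
  by rewrite addrA h addrK.
- by apply: measurable_funTS; exact: measurable_funM.
- exact: measurable_funTS.
- by move=> s _; rewrite mulr_ge0 ?fine_ge0 ?gheat_ge0// ltW.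
- by move=> s _; rewrite fine_ge0 ?gheat_ge0.
- by rewrite iE ltey_eq fin_numM.
- by rewrite iP ltey_eq dP.
Qed.

End iteration.

Let mild_spec (u : R -> R -> R) : Prop :=
  [/\ mfun2 u,
      forall t x, (0 <= t)%R -> (0 <= u t x <= k t)%R,
      forall t x, (0 <= t)%R -> (u t x)%:E <= (expR (beta * t))%:E * gheat t (EFin \o G) x &
      forall t x, (0 <= t)%R -> (u t x + fine (\int[mu]_(s in `[0%R, t])
         (fine (\int[gauss R]_y (ps (u s (x + Num.sqrt (t - s) * y)))%:E))%:E)
        = fine (gheat t (EFin \o G) x))%R].

Let k_ge0 t : (0 <= t)%R -> (beta / alpha <= k t)%R. Proof. exact: dom_gt. Qed.

Lemma mild_exists_aux : exists u, mild_spec u.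
Proof.
(* Zero is a subsolution because [iter_op] takes nonnegative values. *)
pose u0 (_ _ : R) : R := 0%R.
have mu0 : mfun2 u0 by exact: measurable_cst.
have u0k t x : (0 <= t)%R -> (0 <= u0 t x <= k t)%R.
  by move=> t0; rewrite lexx /= (le_trans _ (k_ge0 t0))// divr_ge0// ltW.
have u0ub t x : (0 <= t)%R -> (u0 t x)%:E <= (expR (beta * t))%:E * gheat t (EFin \o G) x.
  by move=> t0; rewrite mule_ge0// gheat_ge0.
have u0sub t x : (0 <= t)%R -> (u0 t x)%:E <= iter_op u0 t x by move=> _; exact: iter_op_ge0.
exists (mild_sol u0); split.
- exact: measurable_mild_sol.
- by move=> *; exact: mild_sol_bounds.
- by move=> *; exact: mild_sol_ub.
- by move=> *; exact: mild_sol_eq.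
Qed.

(** The iteration is started at the desired lower bound. Up to time [L] it stays below [u1], where
    [phi u >= (K + beta - eps) u], and [iter_op_exp] with [c = beta - eps] shows that it is a
    subsolution. *)
Lemma mild_exists_lb_aux eps u1 L : (0 < eps)%R -> (eps <= beta)%R -> (0 < u1)%R ->
  (u1 <= beta / alpha)%R -> (0 <= L)%R -> (expR (beta * L) * M0 <= u1)%R ->
  (forall u, 0 <= u -> u <= u1 -> ps u <= (eps - beta) * u)%R ->
  exists2 u, mild_spec u & forall t x, (0 <= t)%R -> (t <= L)%R ->
    (expR ((beta - eps) * t))%:E * gheat t (EFin \o G) x <= (u t x)%:E.
Proof.
move=> eps0 epsb u10 u1ba L0 LM psu.
pose w t x := (expR ((beta - eps) * t))%:E * gheat t (EFin \o G) x.
have wfin t x : w t x \is a fin_num by rewrite fin_numM.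
have w0 t x : 0 <= w t x by rewrite mule_ge0// gheat_ge0.
have wub t x : (0 <= t)%R -> w t x <= (expR (beta * t))%:E * gheat t (EFin \o G) x.
  move=> t0; apply: lee_wpmul2r; first exact: gheat_ge0.
  by rewrite lee_fin ler_expR ler_wpM2r// gerBl ltW.
have wu1 t x : (0 <= t)%R -> (t <= L)%R -> (fine (w t x) <= u1)%R.
  move=> t0 tL; rewrite -lee_fin fineK//; apply: (le_trans (wub t x t0)).
  apply: (@le_trans _ _ ((expR (beta * t))%:E * M0%:E)).
    by apply: lee_wpmul2l => //; rewrite lee_fin expR_ge0.
  rewrite -EFinM lee_fin; apply: le_trans LM; rewrite ler_pM2r//.
  by rewrite ler_expR ler_pM2l.
(* After time [L] the function [w] may exceed [u1]; cutting it to 0 there keeps a subsolution at all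
   times. *)
pose u0 (t x : R) : R := (fine (w t x) * \1_(`]-oo, L]%classic) t)%R.
have u0E t x : (t <= L)%R -> u0 t x = fine (w t x).
  by move=> tL; rewrite /u0 indicE mem_set ?mulr1//= in_itv.
have u0N t x : (L < t)%R -> u0 t x = 0%R.
  by move=> tL; rewrite /u0 indicE memNset ?mulr0//= in_itv/= leNgt tL.
have mu0 : mfun2 u0.
  apply: measurable_funM.
    apply: (measurableT_comp (f := @fine R) (fine_measurable measurableT)).
    apply: emeasurable_funM; last exact: mgG.
    by apply/measurable_EFinP; exact: mexpK.
  exact: (measurableT_comp (measurable_indic _)).
have u0ge t x : (0 <= u0 t x)%R by rewrite mulr_ge0// fine_ge0.
have u0k t x : (0 <= t)%R -> (0 <= u0 t x <= k t)%R.
  move=> t0; rewrite u0ge/= (le_trans _ (k_ge0 t0))// (le_trans _ u1ba)//.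
  by have [tL|Lt] := leP t L; [rewrite u0E// wu1|rewrite u0N// ltW].
have u0ub t x : (0 <= t)%R -> (u0 t x)%:E <= (expR (beta * t))%:E * gheat t (EFin \o G) x.
  move=> t0; have [tL|Lt] := leP t L; first by rewrite u0E// fineK// wub.
  by rewrite u0N// mule_ge0// gheat_ge0.
have u0sub t x : (0 <= t)%R -> (u0 t x)%:E <= iter_op u0 t x.
  move=> t0; have [tL|Lt] := leP t L; last by rewrite u0N// iter_op_ge0.
  rewrite u0E// fineK// /w -(@iter_op_exp (beta - eps)%R)//; last by rewrite addr_ge0 ?subr_ge0// ltW.
  rewrite /iter_op; apply: lee_wpmul2l; first by rewrite lee_fin expR_ge0.
  rewrite leeD2l//; apply: duh_le; [exact: mexpG|exact: mF| |exact: F0|].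
    move=> s z; rewrite mule_ge0 ?gheat_ge0// lee_fin mulr_ge0 ?expR_ge0//.
    by rewrite addr_ge0 ?subr_ge0// ltW.
  move=> s z /andP[s0 st]; have sL := le_trans st tL.
  rewrite (_ : (_ * expR _)%R = (expR (K * s) * ((K + (beta - eps)) * expR ((beta - eps) * s)))%R); last first.
    by rewrite [((K + _) * s)%R]mulrDl expRD; ring.
  rewrite EFinM -muleA /F [(expR _ * phi _)%:E]EFinM; apply: lee_wpmul2l; first by rewrite lee_fin expR_ge0.
  rewrite EFinM -muleA -/(w s z) -(fineK (wfin s z)) -EFinM lee_fin -u0E//.
  have ule : (u0 s z <= u1)%R by rewrite u0E// wu1.
  rewrite /phi clampE//.
    have := psu _ (u0ge s z) ule; lra.
  by rewrite (le_trans ule)// (le_trans u1ba)// /M lerDl ltW.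
exists (mild_sol u0).
  split.
  - exact: measurable_mild_sol.
  - by move=> *; exact: mild_sol_bounds.
  - by move=> *; exact: mild_sol_ub.
  - by move=> *; exact: mild_sol_eq.
move=> t x t0 tL; rewrite -/(w t x) -(fineK (wfin t x)) lee_fin -u0E//.
exact: mild_sol_lb.
Qed.

End mild.

(** A mild solution bundled with the two upper bounds given by the construction: the one by [dom],
    insensitive to the height of [G], and the linear one. *)
Definition mild (R : realType) (beta alpha M0 : R) (ps G : R -> R) (u : R -> R -> R) : Prop :=
  [/\ measurable_fun setT (fun p : measurableTypeR R * measurableTypeR R => u p.1 p.2),
      forall t x, 0 <= t -> 0 <= u t x <= dom beta alpha M0 t,
      forall t x, 0 <= t ->
        ((u t x)%:E <= (expR (beta * t))%:E * gheat t (EFin \o G) x)%E &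
      forall t x, 0 <= t -> u t x + fine (\int[lebesgue_measure]_(s in `[0%R, t])
         (fine (\int[gauss R]_y (ps (u s (x + Num.sqrt (t - s) * y)))%:E))%:E)%E
        = fine (gheat t (EFin \o G) x)].

Lemma mild_exists (R : realType) (beta alpha M0 : R) (ps G : R -> R) :
  0 < beta -> 0 < alpha -> branching beta alpha ps -> 0 < M0 ->
  measurable_fun setT G -> (forall x, 0 <= G x) -> (forall x, G x <= M0) ->
  exists u, mild beta alpha M0 ps G u.
Proof.
move=> b0 a0 bps M00 mG G0 GM; have [_ _ h _ _] := bps.
have [K K0 lipK] := h (beta / alpha + M0).
exact: (mild_exists_aux b0 a0 bps M00 mG G0 GM K0 lipK).
Qed.

(** The height [M0] is chosen before [G], so the same smallness serves every window when the bound
    is iterated. *)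
Lemma mild_exists_lb (R : realType) (beta alpha : R) (ps : R -> R) eps L :
  0 < beta -> 0 < alpha -> branching beta alpha ps -> 0 < eps -> eps <= beta -> 0 <= L ->
  exists2 M0, 0 < M0 & forall G : R -> R,
  measurable_fun setT G -> (forall x, 0 <= G x) -> (forall x, G x <= M0) ->
  exists2 u, mild beta alpha M0 ps G u & forall t x, 0 <= t -> t <= L ->
    ((expR ((beta - eps) * t))%:E * gheat t (EFin \o G) x <= (u t x)%:E)%E.
Proof.
move=> b0 a0 bps e0 eb L0; have [_ _ h _ h2] := bps.
have [u1' u1'0 psu] := h2 _ e0.
have ba : 0 < beta / alpha by rewrite divr_gt0.
pose u1 := Num.min u1' (beta / alpha).
have u10 : 0 < u1 by rewrite lt_min u1'0.
have u1u : u1 <= u1' by rewrite ge_min lexx.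
have u1b : u1 <= beta / alpha by rewrite ge_min lexx orbT.
(* Growth at rate [beta] during time [L] brings a datum of this height exactly to [u1]. *)
exists (u1 * expR (- (beta * L))); first by rewrite mulr_gt0// expR_gt0.
move=> G mG G0 GM; set M0 := (u1 * _) in GM *.
have M00 : 0 < M0 by rewrite mulr_gt0// expR_gt0.
have [K K0 lipK] := h (beta / alpha + M0).
apply: (mild_exists_lb_aux b0 a0 bps M00 mG G0 GM K0 lipK e0 eb u10 u1b L0).
  by rewrite /M0 mulrCA -expRD subrr expR0 mulr1.
by move=> u u0 /le_trans/(_ u1u); exact: psu.
Qed.

(** * The branching mechanism [psi] satisfies [branching] *)

Section psi.
Context (R : realType) (beta alpha : R) (n : {measure set R -> \bar R}).
Hypotheses (beta0 : 0 < beta) (alpha0 : 0 < alpha).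
Let D : set R := `]0%R, +oo[%classic.
Let g (y : R) : R := Num.min (y ^+ 2) y.
Hypothesis gfin : (\int[n]_(y in D) (g y)%:E < +oo)%E.
Variable gam : R.
Hypotheses (gam0 : 0 < gam)
  (lfin : (\int[n]_(y in (`[1%R, +oo[ : set R)) (y * (ln y `^ (2 + gam)))%:E < +oo)%E).

Let f (u y : R) : R := expR (- (u * y)) - 1 + u * y.

Let mf u (E : set R) : measurable_fun E (f u).
Proof.
apply: measurable_funTS; apply: measurable_funD; last exact: measurable_funM.
apply: measurable_funB => //; apply: (measurableT_comp (@measurable_expR R)).
by apply: measurable_funN; exact: measurable_funM.
Qed.

Let mg (E : set R) : measurable_fun E g.
Proof. by apply: measurable_funTS; apply: measurable_minr => //; exact: measurable_funX. Qed.

Let f_ge0 u y : 0 <= f u y.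
Proof. rewrite /f; have := expR_ge1Dx (- (u * y)); lra. Qed.

Let Dgt0 y : D y -> 0 < y. Proof. by rewrite /D/= in_itv/= andbT. Qed.

Let g_ge0 y : D y -> 0 <= g y.
Proof. by move=> /Dgt0 y0; rewrite le_min sqr_ge0 ltW. Qed.

(** Convexity of [f] in its first argument: the increment is at most [w - u] times the derivative at
    [w]. *)
Let f_inc u w y : 0 <= y -> 0 <= u -> u <= w ->
  f w y - f u y <= (w - u) * y * (1 - expR (- (w * y))).
Proof.
move=> y0 u0 uw; rewrite /f.
have h1 := expR_ge1Dx ((w - u) * y).
have h2 : expR (- (u * y)) = expR (- (w * y)) * expR ((w - u) * y).
  by rewrite -expRD; congr expR; ring.
have h3 := ler_wpM2l (expR_ge0 (- (w * y))) h1.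
rewrite h2; lra.
Qed.

Let f_nd u w y : 0 <= y -> 0 <= u -> u <= w -> f u y <= f w y.
Proof.
move=> y0 u0 uw; rewrite /f.
have h2 : expR (- (w * y)) = expR (- (u * y)) * expR (- ((w - u) * y)).
  by rewrite -expRD; congr expR; ring.
have h1 := expR_ge1Dx (- ((w - u) * y)).
have e1 : expR (- (u * y)) <= 1 by rewrite -[leRHS]expR0 ler_expR oppr_le0 mulr_ge0.
have h3 := ler_wpM2l (expR_ge0 (- (u * y))) h1.
have p : 0 <= (w - u) * y by rewrite mulr_ge0// subr_ge0.
have h4 := ler_wpM2r p e1.
rewrite h2; lra.
Qed.

(** [1 - e^{-w y}] is at most 1 and at most [w y]; the first bound is used for large [y], the second
    for small [y], which produces [min(y^2, y)]. *)
Let f_incg u w y : D y -> 0 <= u -> u <= w ->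
  f w y - f u y <= (w - u) * Num.max 1 w * g y.
Proof.
move=> /Dgt0 y0 u0 uw; apply: (le_trans (f_inc (ltW y0) u0 uw)).
rewrite -!mulrA; apply: ler_wpM2l; first by rewrite subr_ge0.
have w0 := le_trans u0 uw.
have e0 := expR_ge0 (- (w * y)).
have e1 := expR_ge1Dx (- (w * y)).
rewrite /g; have [y1|y1] := leP (y ^+ 2) y.
  apply: (@le_trans _ _ (y * (w * y))); first by rewrite ler_pM2l//; lra.
  rewrite mulrCA -expr2 ler_wpM2r ?sqr_ge0//.
  by rewrite le_max lexx orbT.
apply: (@le_trans _ _ y); first by rewrite -[leRHS]mulr1 ler_pM2l//; lra.
by rewrite -[leLHS]mul1r ler_pM2r// le_max lexx.
Qed.

Let J (u : R) : R := fine (\int[n]_(y in D) (f u y)%:E)%E.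

Let C : R := fine (\int[n]_(y in D) (g y)%:E)%E.

Let mD : measurable D. Proof. exact: measurable_itv. Qed.

Let gI0 : (0 <= \int[n]_(y in D) (g y)%:E)%E.
Proof. by apply: integral_ge0 => y /g_ge0. Qed.

Let CE : (\int[n]_(y in D) (g y)%:E = C%:E)%E.
Proof. by rewrite /C fineK// ge0_fin_numE. Qed.

Let C0 : 0 <= C. Proof. exact: fine_ge0. Qed.

Let inc_le u w : 0 <= u -> u <= w ->
  (\int[n]_(y in D) (f w y - f u y)%:E <= ((w - u) * Num.max 1 w * C)%:E)%E.
Proof.
move=> u0 uw; have k0 : 0 <= (w - u) * Num.max 1 w.
  by rewrite mulr_ge0 ?subr_ge0// le_max ler01.
rewrite EFinM -CE -ge0_integralZl//.
- apply: ge0_le_integral => //.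
  + by move=> y /Dgt0 y0; rewrite lee_fin subr_ge0 f_nd// ltW.
  + by apply/measurable_EFinP; apply: measurable_funB.
  + by apply: emeasurable_funM => //; apply/measurable_EFinP.
  + by move=> y Dy; rewrite -EFinM lee_fin f_incg.
- by apply/measurable_EFinP.
Qed.

Let f0E y : f 0 y = 0. Proof. by rewrite /f mul0r oppr0 expR0 subrr addr0. Qed.

Let fI_fin u : 0 <= u -> (\int[n]_(y in D) (f u y)%:E < +oo)%E.
Proof.
move=> u0; have := inc_le (lexx 0) u0.
under eq_integral do rewrite f0E subr0.
by move=> /le_lt_trans; apply; rewrite ltry.
Qed.

Let JE u : 0 <= u -> (\int[n]_(y in D) (f u y)%:E = (J u)%:E)%E.
Proof.
by move=> u0; rewrite /J fineK// ge0_fin_numE ?fI_fin//; apply: integral_ge0 => y _; rewrite lee_fin.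
Qed.

Let J_ge0 u : 0 <= J u.
Proof. by apply: fine_ge0; apply: integral_ge0 => y _; rewrite lee_fin. Qed.

Let JB u w : 0 <= u -> u <= w ->
  ((J w - J u)%:E = \int[n]_(y in D) (f w y - f u y)%:E)%E.
Proof.
move=> u0 uw; have w0 := le_trans u0 uw.
by rewrite ge0_integralB// ?fI_fin// !JE.
Qed.

Let J_lip u w : 0 <= u -> u <= w -> J w - J u <= (w - u) * Num.max 1 w * C.
Proof. by move=> u0 uw; rewrite -lee_fin JB// inc_le. Qed.

Let J_nd u w : 0 <= u -> u <= w -> J u <= J w.
Proof.
move=> u0 uw; rewrite -subr_ge0 -lee_fin JB//; apply: integral_ge0 => y /Dgt0 y0.
by rewrite lee_fin subr_ge0 f_nd// ltW.
Qed.

Let h : R -> R := (fun y => y * (ln y `^ (2 + gam))) \_ (`[1%R, +oo[%classic).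

Let h_ge0 y : 0 <= h y.
Proof.
rewrite /h patchE; case: ifPn => //; rewrite inE/= in_itv/= andbT => y1.
by rewrite mulr_ge0 ?powR_ge0// (le_trans _ y1).
Qed.

Let mh E : measurable_fun E (EFin \o h).
Proof.
apply/measurable_EFinP/measurable_funTS; apply/(measurable_restrictT _ _).1 => //.
apply: measurable_funTS; apply: measurable_funM => //.
exact: (measurableT_comp (measurable_powR (R:=R) (2 + gam)) (@measurable_ln R)).
Qed.

Let C2 : R := fine (\int[n]_(y in D) (h y)%:E)%E.

Let C2E : (\int[n]_(y in D) (h y)%:E = C2%:E)%E.
Proof.
rewrite /C2 fineK// ge0_fin_numE; last by apply: integral_ge0 => y _; rewrite lee_fin.
rewrite (eq_integral ((EFin \o (fun y => y * (ln y `^ (2 + gam)))) \_ (`[1%R, +oo[%classic))); last first.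
  by move=> y _; rewrite restrict_EFin.
rewrite -integral_mkcondr (_ : D `&` _ = `[1%R, +oo[%classic)//.
apply/seteqP; split => y /=; rewrite /D/= !in_itv/= !andbT; first by case.
by move=> y1; split => //; rewrite (lt_le_trans ltr01).
Qed.

Let C20 : 0 <= C2. Proof. by apply: fine_ge0; apply: integral_ge0 => y _; rewrite lee_fin. Qed.

(** Jumps are split at size [e^B]. Small ones contribute quadratically in [u]; for large ones
    [f u y <= u y], and [ln y >= B >= 1] lets the logarithmic moment supply the factor [1 / B]. *)
Let f_split u B y : D y -> 0 <= u -> 1 <= B ->
  f u y <= u ^+ 2 * expR B * g y + u / B * h y.
Proof.
move=> Dy u0 B1; have y0 := Dgt0 Dy.
have fuy : f u y <= u * y * Num.min 1 (u * y).
  have := f_inc (ltW y0) (lexx 0) u0; rewrite f0E !subr0 => /le_trans; apply.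
  apply: ler_wpM2l; first by rewrite mulr_ge0// ltW.
  rewrite le_min lerBlDr lerDl expR_ge0/=.
  have := expR_ge1Dx (- (u * y)); lra.
have uy0 : 0 <= u * y by rewrite mulr_ge0// ltW.
have [yA|yA] := leP y (expR B).
  apply: (le_trans fuy); rewrite -[leLHS]addr0 lerD//; last first.
    by rewrite mulr_ge0// divr_ge0// (le_trans ler01).
  apply: (@le_trans _ _ (u * y * (u * y))).
    by rewrite ler_wpM2l// ge_min lexx orbT.
  rewrite (_ : u * y * (u * y) = u ^+ 2 * y ^+ 2); last by ring.
  rewrite -mulrA ler_wpM2l ?sqr_ge0// /g.
  have [y1|y1] := leP (y ^+ 2) y.
    rewrite -[leLHS]mul1r ler_wpM2r ?sqr_ge0// -[leLHS]expR0 ler_expR.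
    exact: le_trans B1.
  by rewrite expr2 ler_pM2r.
apply: (@le_trans _ _ (u * y)).
  apply: (le_trans fuy); rewrite -[leRHS]mulr1 ler_wpM2l// ge_min lexx//.
rewrite -[leLHS]add0r lerD//.
  by rewrite !mulr_ge0 ?expR_ge0// g_ge0.
have y1 : 1 <= y by rewrite (le_trans _ (ltW yA))// -[leLHS]expR0 ler_expR (le_trans _ B1).
rewrite /h patchE mem_set/=; last by rewrite in_itv/= andbT.
have lB : B <= ln y by rewrite -ler_expR lnK ?posrE// ltW.
have B0 : 0 < B by rewrite (lt_le_trans ltr01).
rewrite -mulrA ler_wpM2l// mulrCA ler_peMr ?(ltW y0)//.
rewrite mulrC ler_pdivlMr// mul1r (le_trans lB)//.
have l1 : 1 <= ln y by rewrite (le_trans B1).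
rewrite -[leLHS]powRr1 ?(le_trans _ l1)//.
by apply: ler_powR => //; move: gam0; lra.
Qed.

Let J_split u B : 0 <= u -> 1 <= B -> J u <= u ^+ 2 * expR B * C + u / B * C2.
Proof.
move=> u0 B1; have B0 : 0 < B by rewrite (lt_le_trans ltr01).
have k1 : 0 <= u ^+ 2 * expR B by rewrite mulr_ge0 ?sqr_ge0 ?expR_ge0.
have k2 : 0 <= u / B by rewrite divr_ge0// ltW.
rewrite -lee_fin -JE// EFinD !(EFinM _ C) !(EFinM _ C2) -CE -C2E.
rewrite -!ge0_integralZl//.
- rewrite -ge0_integralD//.
  + apply: ge0_le_integral => //.
    * by move=> y _; rewrite lee_fin.
    * by apply/measurable_EFinP.
    * apply: emeasurable_funD; apply: emeasurable_funM => //.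
      by apply/measurable_EFinP.
    * by move=> y Dy; rewrite -!EFinM -EFinD lee_fin f_split.
  + by move=> y Dy; rewrite -EFinM lee_fin mulr_ge0// g_ge0.
  + by apply: emeasurable_funM => //; apply/measurable_EFinP.
  + by move=> y Dy; rewrite -EFinM lee_fin mulr_ge0.
  + by apply: emeasurable_funM.
- by move=> y _; rewrite lee_fin.
- by apply/measurable_EFinP.
Qed.

Lemma branching_psi : branching beta alpha (psi beta alpha n).
Proof.
have psiE u : psi beta alpha n u = - beta * u + alpha * u ^+ 2 + J u by [].
split.
- rewrite psiE /J; under eq_integral do rewrite f0E.
  by rewrite integral0/= mulr0 expr0n/= mulr0 !addr0.
- by move=> u u0; rewrite psiE; have := J_ge0 u; lra.
(* Lipschitz constants of [alpha u^2] and of the jump integral on [[0, M]]; the 1 makes the sum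
   positive, and the term [- beta u] only lowers the increment. *)
- move=> M; exists (2 * alpha * `|M| + Num.max 1 M * C + 1).
    rewrite ltr_wpDl//; rewrite addr_ge0//; rewrite mulr_ge0//.
      by rewrite mulr_ge0// ltW.
    by rewrite le_max ler01.
  move=> u w u0 uw wM; rewrite !psiE.
  have w0 := le_trans u0 uw.
  have h1 := J_lip u0 uw.
  have h2 : (w - u) * Num.max 1 w * C <= (w - u) * (Num.max 1 M * C).
    rewrite -mulrA ler_wpM2l ?subr_ge0// ler_wpM2r//.
    by rewrite ge_max le_max lexx/= le_max wM orbT.
  have h3 : alpha * (w ^+ 2 - u ^+ 2) <= (2 * alpha * `|M|) * (w - u).
    rewrite subr_sqr mulrCA [leRHS]mulrC ler_wpM2l ?subr_ge0//.
    rewrite (mulrC 2) -mulrA ler_wpM2l ?(ltW alpha0)//.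
    have := ler_norm M; lra.
  have h4 : 0 <= beta * (w - u) by rewrite mulr_ge0 ?subr_ge0// ltW.
  lra.
- move=> u w u0 uw; rewrite !psiE.
  have := J_nd u0 uw.
  have : 0 <= alpha * (w ^+ 2 - u ^+ 2).
    by rewrite mulr_ge0 ?(ltW alpha0)// subr_ge0 ler_pXn2r ?nnegrE// (le_trans u0).
  lra.
(* [B] makes the large-jump slope [C2 / B] at most [eps / 2]; then [u] is taken small enough for the
   quadratic part, of coefficient [A], to cost another [eps / 2]. *)
- move=> eps eps0; pose B := 2 * C2 / eps + 1.
  have B1 : 1 <= B by rewrite lerDr divr_ge0 ?mulr_ge0// ltW.
  have B0 : 0 < B by rewrite (lt_le_trans ltr01).
  pose A := alpha + expR B * C.
  have A0 : 0 < A by rewrite ltr_pwDl// mulr_ge0 ?expR_ge0.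
  exists (eps / (2 * A)); first by rewrite divr_gt0// mulr_gt0.
  move=> u u0; rewrite ler_pdivlMr ?mulr_gt0// => uA.
  rewrite psiE; have := J_split u0 B1.
  have h1 : C2 / B <= eps / 2.
    rewrite ler_pdivrMr// /B mulrDr mulr1.
    rewrite (_ : eps / 2 * (2 * C2 / eps) = C2); last by field; rewrite gt_eqF.
    by rewrite lerDl divr_ge0// ltW.
  have h2 := ler_wpM2l u0 h1.
  have h3 := ler_wpM2l u0 uA.
  have -> : u / B * C2 = u * (C2 / B) by ring.
  rewrite /A in h3 *; lra.
Qed.

End psi.

(** * Reduction of the equation in dimension [d] to dimension one *)

Lemma continuous_addr (R : realType) (T : topologicalType) (f g : T -> R) : continuous f -> continuous g -> continuous (fun x => f x + g x).
Proof. by move=> cf cg x; apply: (@cvgD R R^o _ _ _ f g); [exact: cf|exact: cg]. Qed.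
Lemma continuous_mulr (R : realType) (T : topologicalType) (f g : T -> R) : continuous f -> continuous g -> continuous (fun x => f x * g x).
Proof. by move=> cf cg x; apply: cvgM; [exact: cf|exact: cg]. Qed.
Lemma continuous_sumr (R : realType) (T : topologicalType) (I : Type) (l : seq I) (f : I -> T -> R) :
  (forall i, continuous (f i)) -> continuous (fun x => \sum_(i <- l) f i x).
Proof.
move=> cf; elim: l => [|i l ih].
  by rewrite (_ : (fun _ => _) = cst 0) => [|]; [exact: cst_continuous|apply/funext => y; rewrite big_nil].
rewrite (_ : (fun _ => _) = (fun y => f i y + \sum_(j <- l) f j y)); first exact: continuous_addr.
by apply/funext => y; rewrite big_cons.
Qed.

Section signed_gauss.
Context (R : realType).
Notation RR := (measurableTypeR R).

Definition gconv (a : R) (f : R -> R) (z : R) : R :=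
  fine (\int[gauss R]_y (f (z + a * y))%:E)%E.

Let bnd (f : R -> R) (B : R) := forall z, `|f z| <= B.

Lemma measurable_shift (f : R -> R) (z a : R) : measurable_fun setT (f : RR -> RR) ->
  measurable_fun setT (fun y : RR => f (z + a * y) : RR).
Proof.
move=> mf; apply: (measurableT_comp mf).
by apply: measurable_funD => //; exact: measurable_funM.
Qed.

Lemma gconv_integrable (f : R -> R) B z a : measurable_fun setT (f : RR -> RR) -> bnd f B ->
  (gauss R).-integrable setT (fun y => (f (z + a * y))%:E).
Proof.
move=> mf fB; apply: measurable_bounded_integrable => //.
- by rewrite -ge0_fin_numE//; exact: fin_num_measure.
- exact: measurable_shift.
- exists B; split; first exact: num_real.
  by move=> w Bw y _; apply: (le_trans (fB _)); exact: ltW.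
Qed.

Lemma gconvD (f : R -> R) B c a z : measurable_fun setT (f : RR -> RR) -> bnd f B ->
  gconv a (fun w => f w + c) z = gconv a f z + c.
Proof.
move=> mf fB; rewrite /gconv.
under eq_integral do rewrite EFinD.
rewrite integralD//.
- rewrite fineD//; first by rewrite integral_gauss_cst.
    exact: (integrable_fin_num _ (gconv_integrable _ _ mf fB)).
  by rewrite integral_gauss_cst.
- exact: gconv_integrable mf fB.
- apply: (@gconv_integrable (fun=> c) `|c| 0 0) => //.
Qed.

Lemma gconv_ge0E (f : R -> R) B a z : measurable_fun setT (f : RR -> RR) -> bnd f B ->
  ((gconv a f z)%:E = \int[gauss R]_y (f (z + a * y))%:E)%E.
Proof.
move=> mf fB; rewrite /gconv fineK//.
exact: (integrable_fin_num _ (gconv_integrable _ _ mf fB)).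
Qed.

Lemma gconv_le (f : R -> R) B a z : measurable_fun setT (f : RR -> RR) -> bnd f B ->
  `|gconv a f z| <= B.
Proof.
move=> mf fB; rewrite -lee_fin -abse_EFin (gconv_ge0E _ _ mf fB).
apply: (le_trans (le_abse_integral _ _ _)) => //.
  by apply/measurable_EFinP; exact: measurable_shift.
rewrite -[leRHS](integral_gauss_cst (R:=R)); apply: ge0_le_integral => //.
- by apply: measurableT_comp => //; apply/measurable_EFinP; exact: measurable_shift.
- by move=> y _; rewrite /= lee_fin.
Qed.

Lemma measurable_gconv (f : R -> R) a : measurable_fun setT (f : RR -> RR) ->
  (forall z, 0 <= f z) -> measurable_fun setT (gconv a f : RR -> RR).
Proof.
move=> mf f0; apply: (measurableT_comp (fine_measurable measurableT)).
apply: (measurable_fun_fubini_tonelli_F (m2 := gauss R) (fun q : RR * RR => (f (q.1 + a * q.2))%:E)) => //.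
  apply/measurable_EFinP; apply: (measurableT_comp mf).
  by apply: measurable_funD => //; exact: measurable_funM.
by move=> q; rewrite lee_fin.
Qed.

(** Adding the constant [B] makes [f] nonnegative, where [ge0_gauss_conv] applies; constants commute
    with [gconv]. *)
Lemma gconv_comp (f : R -> R) B a b z : measurable_fun setT (f : RR -> RR) -> bnd f B ->
  gconv a (gconv b f) z = gconv (Num.sqrt (a ^+ 2 + b ^+ 2)) f z.
Proof.
move=> mf fB; pose h w := f w + B.
have mh : measurable_fun setT (h : RR -> RR) by exact: measurable_funD.
have h0 w : 0 <= h w by have := fB w; rewrite ler_norml /h; lra.
have hB : bnd h (B + B).
  move=> w; rewrite ger0_norm ?h0//; have := fB w; rewrite ler_norml /h; lra.
have E c w : gconv c f w = gconv c h w - B by rewrite (gconvD _ _ _ mf fB) addrK.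
have -> : gconv b f = fun w => gconv b h w - B by apply/funext => w.
rewrite (gconvD (B := B + B)); [|exact: measurable_gconv|by move=> w; exact: gconv_le].
rewrite E; congr (_ - _).
rewrite /gconv; congr fine.
under eq_integral do rewrite (gconv_ge0E _ _ mh hB).
have -> : (\int[gauss R]_y (h (z + Num.sqrt (a ^+ 2 + b ^+ 2) * y))%:E =
  \int[gauss R]_z0 \int[gauss R]_y (fun w => (h (z + w))%:E) (b * y + a * z0)%R)%E.
  rewrite (ge0_gauss_conv b a (f := fun w => (h (z + w))%:E)).
  - by rewrite addrC.
  - apply/measurable_EFinP; apply: (measurableT_comp mh); exact: measurable_funD.
  - by move=> w; rewrite lee_fin.
by apply: eq_integral => y _; apply: eq_integral => w _; congr ((h _)%:E); ring.
Qed.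

End signed_gauss.

Section direction.
Context (R : realType) (d : nat).
Notation RR := (measurableTypeR R).

Definition dot (e x : 'rV[R]_d) : R := \sum_(i < d) e ord0 i * x ord0 i.

Lemma dotD e x y : dot e (x + y) = dot e x + dot e y.
Proof.
by rewrite /dot -big_split/=; apply: eq_bigr => i _; rewrite mxE mulrDr.
Qed.

Lemma dot_delta e (i : 'I_d) y : dot e (y *: delta_mx ord0 i) = e ord0 i * y.
Proof.
rewrite /dot (bigD1 i)//= big1 ?addr0; last first.
  by move=> j ji; rewrite !mxE eqxx (negbTE ji)/= mulr0 mulr0.
by rewrite !mxE !eqxx/= mulr1.
Qed.

Lemma continuous_dot e : continuous (dot e).
Proof.
by apply: continuous_sumr => i; apply: continuous_mulr;
  [exact: cst_continuous|exact: coord_continuous].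
Qed.

Lemma heat1_dot e (i : 'I_d) (t : R) (h : R -> R) x : 0 < t ->
  measurable_fun setT (h : RR -> RR) ->
  heat1 i t (h \o dot e) x = gconv (e ord0 i * Num.sqrt t) h (dot e x).
Proof.
move=> t0 mh; rewrite /heat1 /gconv; congr fine.
rewrite (eq_integral (fun y : RR => (h (dot e x + e ord0 i * y) * normal_pdf 0 (Num.sqrt t) y)%:E)).
  rewrite (gauss_scale (f := fun y => h (dot e x + e ord0 i * y)))//; last exact: measurable_shift.
    by apply: eq_integral => y _; rewrite mulrA.
  by rewrite sqrtr_gt0.
by move=> y _; rewrite /= dotD dot_delta.
Qed.

(** On functions of [dot e x] the [i]-th factor of [heat] is a one-dimensional convolution of
    variance [t e_i^2]. Variances add along the fold, and the total is [t] for a unit vector. *)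
Lemma heat_dot (e : 'rV[R]_d) (t : R) (F : R -> R) B x : 0 <= t -> \sum_(i < d) e ord0 i ^+ 2 = 1 ->
  measurable_fun setT (F : RR -> RR) -> (forall z, `|F z| <= B) ->
  heat t (F \o dot e) x = gconv (Num.sqrt t) F (dot e x).
Proof.
rewrite le_eqVlt => /predU1P[<-|t0] e1 mF FB.
  rewrite /heat lexx /gconv sqrtr0.
  by under eq_integral do rewrite mul0r addr0; rewrite integral_gauss_cst.
rewrite /heat leNgt t0/=.
pose h w := F w + B.
have mh : measurable_fun setT (h : RR -> RR) by exact: measurable_funD.
have h0 w : 0 <= h w by have := FB w; rewrite ler_norml /h; lra.
have hB : forall w, `|h w| <= B + B.
  move=> w; rewrite ger0_norm ?h0//; have := FB w; rewrite ler_norml /h; lra.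
have E c : gconv c F = fun w => gconv c h w - B.
  by apply/funext => w; rewrite (gconvD _ _ _ mF FB) addrK.
have mc c : measurable_fun setT (gconv c F : RR -> RR).
  by rewrite E; apply: measurable_funB => //; exact: measurable_gconv.
suff H (l : seq 'I_d) : foldr (fun i h => heat1 i t h) (F \o dot e) l =
    gconv (Num.sqrt (t * \sum_(i <- l) e ord0 i ^+ 2)) F \o dot e.
  by rewrite H big_enum/= e1 mulr1.
elim: l => [|i l ih] /=.
  apply/funext => y /=; rewrite big_nil mulr0 sqrtr0 /gconv.
  by under eq_integral do rewrite mul0r addr0; rewrite integral_gauss_cst.
apply/funext => y; rewrite ih heat1_dot// (gconv_comp _ _ _ mF FB) /=.
rewrite (_ : (_ ^+ 2 + _ ^+ 2) = t * \sum_(j <- i :: l) e ord0 j ^+ 2)//.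
rewrite exprMn !sqr_sqrtr ?(ltW t0)//; last first.
  by rewrite mulr_ge0 ?(ltW t0)// sumr_ge0// => j _; rewrite sqr_ge0.
by rewrite big_cons mulrDr [_ * t]mulrC.
Qed.

End direction.

Section mild_pde.
Context (R : realType) (d : nat).
Notation RR := (measurableTypeR R).

Lemma open_measurable_Rd (A : set (Rd R d)) : @open (matrix R 1 d) A -> measurable A.
Proof. by move=> oA; apply: sub_sigma_algebra. Qed.

Lemma continuous_measurable_Rd (f : 'rV[R]_d -> R) : continuous f ->
  measurable_fun setT (f : Rd R d -> RR).
Proof.
move=> /continuousP cf; apply: (measurability _ (RGenOpens.measurableE R)).
move=> _ [_ [a [b ->] <-]]; rewrite setTI; apply: open_measurable_Rd.
by apply: cf; exact: interval_open.
Qed.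

Lemma measurable_dot (e : 'rV[R]_d) : measurable_fun setT (dot e : Rd R d -> RR).
Proof. by apply: continuous_measurable_Rd; exact: continuous_dot. Qed.

Variables (beta alpha : R) (ps : R -> R).
Hypotheses (beta0 : 0 < beta) (alpha0 : 0 < alpha) (bps : branching beta alpha ps).

(** Measurability comes from monotonicity: [ps v + beta v] is nondecreasing on the half-line, and is
    extended to the line by its value at 0. *)
Lemma branching_measurable (M : R) (w : R -> R) : measurable_fun setT (w : RR -> RR) ->
  (forall z, 0 <= w z <= M) ->
  measurable_fun setT (fun z : RR => ps (w z) : RR) /\ exists B, forall z, `|ps (w z)| <= B.
Proof.
move=> mw w0M; have [ps0 lb lip nd _] := bps.
pose q (v : R) : R := ps (Num.max v 0) + beta * Num.max v 0.
have mq : measurable_fun setT (q : RR -> RR).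
  apply: nondecreasing_measurable => // r s rs; rewrite /q.
  have r0 : 0 <= Num.max r 0 by rewrite le_max lexx orbT.
  have rs' : Num.max r 0 <= Num.max s 0 by rewrite ge_max !le_max rs lexx !orbT.
  have := nd _ _ r0 rs'; lra.
split.
  rewrite (_ : (fun z => _) = (fun z : RR => q (w z) - beta * w z)).
    apply: measurable_funB; first exact: (measurableT_comp mq).
    exact: measurable_funM.
  by apply/funext => z; have /andP[z0 _] := w0M z; rewrite /q max_l// addrK.
have [K K0 lipK] := lip M.
have M0 : 0 <= M by have /andP[a b] := w0M 0; exact: le_trans b.
exists ((K + beta) * M) => z; have /andP[z0 zM] := w0M z.
have h1 := lipK _ _ (lexx 0) z0 zM; have h2 := nd _ _ (lexx 0) z0.
rewrite ps0 !subr0 in h1 h2.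
have h3 := ler_wpM2l (ltW K0) zM; have h4 := ler_wpM2l (ltW beta0) zM.
have h5 := mulr_ge0 (ltW beta0) z0; have h6 := mulr_ge0 (ltW K0) M0.
have h7 := mulr_ge0 (ltW beta0) M0.
rewrite ler_norml; apply/andP; split; lra.
Qed.

(** Plane waves: by [heat_dot] the equation for functions of [dot e x] is the one-dimensional
    one. *)
Lemma mild_pde (e : 'rV[R]_d) (M0 : R) (G : R -> R) (u : R -> R -> R) :
  \sum_(i < d) e ord0 i ^+ 2 = 1 -> 0 < M0 -> measurable_fun setT (G : RR -> RR) ->
  (forall z, 0 <= G z <= M0) -> mild beta alpha M0 ps G u ->
  pde_solution ps (G \o dot e) (fun t x => u t (dot e x)).
Proof.
move=> e1 M00 mG G0M [mu u0k uub ueq]; split; [|split; [|split]].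
- apply: (measurableT_comp mu (g := fun p : RR * Rd R d => (p.1, dot e p.2 : RR))).
  apply: measurable_fun_pair => //; exact: measurableT_comp (measurable_dot e) _.
- by move=> t x t0; case/andP: (u0k t (dot e x) t0).
- move=> T T0; exists (beta / alpha + M0) => t x /andP[t0 _].
  case/andP: (u0k t (dot e x) t0) => _ /le_trans; apply; exact: dom_le.
- move=> t x t0; rewrite (heat_dot _ (B := M0))//; last first.
    by move=> z; have /andP[a b] := G0M z; rewrite ger0_norm.
  rewrite -[RHS](ueq t (dot e x) t0); congr (_ + fine _).
  apply: eq_integral => s; rewrite inE/= in_itv/= => /andP[s0 st]; congr EFin.
  have mus : measurable_fun setT (u s : RR -> RR) by exact: (measurableT_comp mu (pair1_measurable s)).
  have us z : 0 <= u s z <= beta / alpha + M0.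
    have /andP[a b] := u0k s z s0; rewrite a (le_trans b)//; exact: dom_le.
  have [mp [B pB]] := branching_measurable mus us.
  by rewrite -[heat _ _ _]/(heat (t - s) ((fun z => ps (u s z)) \o dot e) x) (heat_dot _ (B := B))// subr_ge0.
Qed.

End mild_pde.

(** * Masses of half-spaces and measurability of integrals against the process *)

Section masses.
Context (R : realType) (d : nat).
Context (dO : measure_display) (Omega : measurableType dO).
Variable X : R -> Omega -> {finite_measure set Rd R d -> \bar R}.
Notation RR := (measurableTypeR R).

Lemma bounded_nonneg_meas_integrable g (nu : {finite_measure set Rd R d -> \bar R}) :
  bounded_nonneg_meas g -> nu.-integrable setT (fun x => (g x)%:E).
Proof.
move=> [mg [g0 [M gM]]]; apply: measurable_bounded_integrable => //.
- by rewrite -ge0_fin_numE//; exact: fin_num_measure.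
- exists M; split; first exact: num_real.
  by move=> w Mw y _ /=; rewrite ger0_norm// (le_trans (gM _))// ltW.
Qed.

Lemma mintE g (nu : {finite_measure set Rd R d -> \bar R}) : bounded_nonneg_meas g ->
  ((mint nu g)%:E = \int[nu]_x (g x)%:E)%E.
Proof.
by move=> /bounded_nonneg_meas_integrable h; rewrite /mint fineK//; exact: (integrable_fin_num _ (h nu)).
Qed.

Lemma mint_ge0 g (nu : {finite_measure set Rd R d -> \bar R}) :
  (forall x, 0 <= g x) -> 0 <= mint nu g.
Proof. by move=> g0; apply: fine_ge0; apply: integral_ge0 => x _; rewrite lee_fin. Qed.

Lemma mint_le g h (nu : {finite_measure set Rd R d -> \bar R}) :
  bounded_nonneg_meas g -> bounded_nonneg_meas h -> (forall x, g x <= h x) ->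
  mint nu g <= mint nu h.
Proof.
move=> bg bh gh; rewrite -lee_fin !mintE//; apply: le_integral => //.
- exact: bounded_nonneg_meas_integrable.
- exact: bounded_nonneg_meas_integrable.
- by move=> x _; rewrite lee_fin.
Qed.

Definition halfspace (e : 'rV[R]_d) (r : R) : set 'rV[R]_d := [set x | r < dot e x].

Lemma measurable_halfspace e r : measurable (halfspace e r : set (Rd R d)).
Proof.
have := measurable_dot e; rewrite /halfspace => h.
have := h measurableT `]r, +oo[%classic; rewrite setTI => /(_ (measurable_itv _)).
by congr measurable; apply/seteqP; split => x /=; rewrite in_itv/= andbT.
Qed.

Definition hmass (e : 'rV[R]_d) (r t : R) (w : Omega) : R := fine (X t w (halfspace e r)).
Definition tmass (t : R) (w : Omega) : R := fine (X t w setT).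

Lemma hmass_ge0 e r t w : 0 <= hmass e r t w. Proof. exact: fine_ge0. Qed.
Lemma tmass_ge0 t w : 0 <= tmass t w. Proof. exact: fine_ge0. Qed.

Lemma hmass_le e r r' t w : r <= r' -> hmass e r' t w <= hmass e r t w.
Proof.
move=> rr'; apply: fine_le; [exact: fin_num_measure (measurable_halfspace _ _)|exact: fin_num_measure (measurable_halfspace _ _)|].
apply: le_measure; rewrite ?inE; [exact: measurable_halfspace|exact: measurable_halfspace|].
by move=> x; rewrite /halfspace/=; exact: le_lt_trans.
Qed.

End masses.

Section measurable_integral_param.
Local Open Scope ereal_scope.
Context d1 d2 (S : measurableType d1) (T : measurableType d2) (R : realType).
Variable l : S -> {measure set T -> \bar R}.
Hypothesis ml : forall B, measurable B -> measurable_fun setT (fun x => l x B).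

Import HBNNSimple.

Lemma measurable_integral_param (g : T -> \bar R) : measurable_fun setT g ->
  (forall y, 0 <= g y) -> measurable_fun setT (fun x => \int[l x]_y g y).
Proof.
move=> mg g0; pose h := nnsfun_approx measurableT mg.
apply: (emeasurable_fun_cvg (fun n x => \int[l x]_y (h n y)%:E)).
- move=> n; under eq_fun do rewrite integralT_nnsfun sintegralE.
  apply: emeasurable_fsum => [//|r].
  exact: measurable_funeM (ml _).
- move=> x _.
  under [in X in _ --> X]eq_integral do
    rewrite -(cvg_lim _ (cvg_nnsfun_approx measurableT mg (fun y _ => g0 y) Logic.I))//.
  apply: cvg_monotone_convergence => //.
  + by move=> n; exact/measurable_EFinP.
  + by move=> n y _; rewrite lee_fin.
  + by move=> y _ a b ab; rewrite lee_fin; exact/lefP/nd_nnsfun_approx.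
Qed.

End measurable_integral_param.

(** * One-step estimates from the Laplace functional *)

Section step.
Context (R : realType) (d : nat) (beta alpha : R) (ps : R -> R).
Context (dO : measure_display) (Omega : measurableType dO) (P : probability Omega R).
Variable X : R -> Omega -> {finite_measure set Rd R d -> \bar R}.
Notation RR := (measurableTypeR R).
Hypotheses (beta0 : 0 < beta) (alpha0 : 0 < alpha) (bps : branching beta alpha ps).
Hypothesis sbm : is_SBM ps P X.

Lemma measurable_mass t (B : set (Rd R d)) : measurable B ->
  measurable_fun setT (fun w => fine (X t w B) : RR).
Proof. by move=> mB; case: sbm => h _ _ _; exact: h. Qed.

Lemma measurable_mint t g : bounded_nonneg_meas g ->
  measurable_fun setT (fun w => mint (X t w) g : RR).
Proof.
move=> [mg [g0 _]]; apply: (measurableT_comp (fine_measurable measurableT)).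
apply: (@measurable_integral_param _ _ _ (Rd R d) R (X t) _ (fun x : Rd R d => (g x)%:E)).
- move=> B mB; rewrite (_ : (fun w => _) = EFin \o (fun w => fine (X t w B))).
    by apply/measurable_EFinP; exact: measurable_mass.
  by apply/funext => w /=; rewrite fineK// fin_num_measure.
- exact/measurable_EFinP.
- by move=> y; rewrite lee_fin.
Qed.

Lemma integral_one_minus_exp (A : set Omega) (f : Omega -> R) : measurable A ->
  measurable_fun setT (f : Omega -> RR) -> (forall w, 0 <= f w) ->
  (\int[P]_(w in A) (1 - expR (- f w))%:E = P A - \int[P]_(w in A) (expR (- f w))%:E)%E.
Proof.
move=> mA mf f0.
have me : measurable_fun A (fun w => expR (- f w) : RR).
  apply: measurable_funTS; apply: (measurableT_comp (@measurable_expR R)).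
  exact: measurable_funN.
have i1 : (\int[P]_(w in A) 1%:E = P A)%E by rewrite integral_cst// mul1e.
have fP : (P A < +oo)%E by rewrite ltey_eq fin_num_measure.
rewrite (ge0_integralB (f := fun=> 1)) ?i1//.
apply: le_lt_trans fP; rewrite -i1; apply: ge0_le_integral => //.
  - exact/measurable_EFinP.
  - by move=> w _; rewrite lee_fin -[leRHS]expR0 ler_expR oppr_le0.
Qed.

Lemma measurable_one_minus_exp (A : set Omega) (f : Omega -> R) :
  measurable_fun setT (f : Omega -> RR) ->
  measurable_fun A (fun w => (1 - expR (- f w))%:E).
Proof.
move=> mf; apply/measurable_EFinP/measurable_funTS; apply: measurable_funB => //.
apply: (measurableT_comp (@measurable_expR R)); exact: measurable_funN.
Qed.

Lemma one_minus_exp_ge0 (x : R) : 0 <= x -> 0 <= 1 - expR (- x).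
Proof. by move=> x0; rewrite subr_ge0 -[leRHS]expR0 ler_expR oppr_le0. Qed.

Lemma one_minus_exp_le (x : R) : 1 - expR (- x) <= x.
Proof. have := expR_ge1Dx (- x); lra. Qed.

Lemma filtration_setT s : 0 <= s -> natural_filtration X s setT.
Proof.
move=> s0; apply: sub_sigma_algebra; exists s, setT, setT.
by split; rewrite ?lexx ?s0.
Qed.

Variable e : 'rV[R]_d.
Hypothesis e1 : \sum_(i < d) e ord0 i ^+ 2 = 1.

Lemma filtration_hmass s r m : 0 <= s ->
  natural_filtration X s [set w | hmass X e r s w <= m].
Proof.
move=> s0; apply: sub_sigma_algebra; exists s, (halfspace e r), `]-oo, m]%classic.
split => //; rewrite ?lexx ?s0//; first exact: measurable_halfspace.
Qed.

Let mH r t : measurable_fun setT (hmass X e r t : Omega -> RR).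
Proof. by apply: measurable_mass; exact: measurable_halfspace. Qed.

Let mT t : measurable_fun setT (tmass X t : Omega -> RR).
Proof. exact: measurable_mass. Qed.

Lemma bounded_nonneg_dot (M0 : R) (G : R -> R) : measurable_fun setT (G : RR -> RR) ->
  (forall z, 0 <= G z <= M0) -> bounded_nonneg_meas (G \o dot e).
Proof.
move=> mG GM; split; first exact: (measurableT_comp mG (measurable_dot e)).
split; first by move=> x /=; case/andP: (GM (dot e x)).
by exists M0 => x /=; case/andP: (GM (dot e x)).
Qed.

Lemma mild_bounded_nonneg M0 G u t : mild beta alpha M0 ps G u -> 0 < M0 -> 0 <= t ->
  bounded_nonneg_meas (u t \o dot e).
Proof.
move=> [mu uk _ _] M00 t0; apply: (bounded_nonneg_dot (M0 := beta / alpha + M0)).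
  exact: (measurableT_comp mu (pair1_measurable t)).
by move=> z; have /andP[-> /le_trans] := uk t z t0; apply; exact: dom_le.
Qed.

Lemma laplace_mild M0 G u s t (A : set Omega) : 0 < M0 -> measurable_fun setT (G : RR -> RR) ->
  (forall z, 0 <= G z <= M0) -> mild beta alpha M0 ps G u -> 0 <= s -> 0 <= t ->
  natural_filtration X s A ->
  (\int[P]_(w in A) (expR (- mint (X (s + t) w) (G \o dot e)))%:E =
   \int[P]_(w in A) (expR (- mint (X s w) (u t \o dot e)))%:E)%E.
Proof.
move=> M00 mG GM mu s0 t0 As; case: sbm => _ _ _ /(_ s (s + t)).
rewrite s0 lerDl t0 => /(_ isT) h.
rewrite (h _ _ (bounded_nonneg_dot mG GM) (mild_pde beta0 alpha0 bps e1 M00 mG GM mu) _ As).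
by rewrite addrC addKr.
Qed.

Lemma laplace0 M0 G u t : 0 < M0 -> measurable_fun setT (G : RR -> RR) ->
  (forall z, 0 <= G z <= M0) -> mild beta alpha M0 ps G u -> 0 <= t ->
  (\int[P]_w (expR (- mint (X t w) (G \o dot e)))%:E = (expR (- u t 0))%:E)%E.
Proof.
move=> M00 mG GM mu t0.
have := laplace_mild M00 mG GM mu (lexx 0) t0 (filtration_setT (lexx 0)).
rewrite add0r => ->; case: sbm => _ _ /(_ _ (mild_bounded_nonneg mu M00 t0)) -> _ /=.
by rewrite /dot big1// => i _; rewrite mxE mulr0.
Qed.

(** Substitute for a first-moment formula: the left side is [1 - e^{-u(s,0)}], hence at most
    [u(s,0)], and the linear upper bound for [u] applies. *)
Lemma mean_bound M0 G s : 0 < M0 -> measurable_fun setT (G : RR -> RR) ->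
  (forall z, 0 <= G z <= M0) -> 0 <= s ->
  (\int[P]_w (1 - expR (- mint (X s w) (G \o dot e)))%:E <=
   (expR (beta * s))%:E * gheat s (EFin \o G) 0)%E.
Proof.
move=> M00 mG GM s0.
have G0 x : 0 <= G x by case/andP: (GM x).
have [u mu] := mild_exists beta0 alpha0 bps M00 mG G0 (fun x => (andP (GM x)).2).
have [_ _ ub _] := mu.
have bG := bounded_nonneg_dot mG GM.
rewrite integral_one_minus_exp//; [|exact: measurable_mint|by move=> w; apply: mint_ge0 => x /=].
rewrite (laplace0 M00 mG GM mu s0) probability_setT -EFinB.
apply: (le_trans _ (ub s 0 s0)); rewrite lee_fin; exact: one_minus_exp_le.
Qed.

Lemma mint_indic k c r (nu : {finite_measure set Rd R d -> \bar R}) : 0 <= k -> 0 <= c ->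
  mint nu ((fun z => k * \1_(`]r, +oo[%classic) z + c) \o dot e) =
  k * fine (nu (halfspace e r)) + c * fine (nu setT).
Proof.
move=> k0 c0; rewrite /mint.
have mh := measurable_halfspace e r.
have -> : (\int[nu]_x (((fun z => k * \1_(`]r, +oo[%classic) z + c) \o dot e) x)%:E =
   \int[nu]_x (k%:E * (\1_(halfspace e r : set (Rd R d)) x)%:E + c%:E))%E.
  apply: eq_integral => x _ /=; rewrite EFinD EFinM; congr (_ * (_)%:E + _)%E.
  by rewrite !indicE; congr (nat_of_bool _)%:R; apply/idP/idP; rewrite !inE/= in_itv/= andbT.
rewrite ge0_integralD//.
- rewrite ge0_integralZl//; last by apply/measurable_EFinP; exact: measurable_indic.
  rewrite integral_indic// setIT integral_cst// fineD ?fineM// ?fin_numM//.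
  + exact: fin_num_measure.
  + exact: fin_num_measure.
  + exact: fin_num_measure.
  + exact: fin_num_measure.
- by move=> x _; rewrite mule_ge0.
- apply: emeasurable_funM => //; apply/measurable_EFinP; exact: measurable_indic.
Qed.

(** [kap] bounds a solution at time [delta] whatever its initial height. [zet] bounds it at distance
    at least [eta] from the support of an initial datum of height [1 / m']. *)
Definition kap (delta : R) : R := beta / alpha + (alpha * delta)^-1.
Definition zet (delta eta m' : R) : R := expR (beta * delta) * (m'^-1 * expR (- eta ^+ 2 / (2 * delta))).

Lemma gheat_tail (delta eta m' r z : R) : 0 < delta -> 0 <= eta -> 0 < m' -> z <= r ->
  (gheat delta (EFin \o (fun x : R => m'^-1 * \1_(`]r + eta, +oo[%classic) x)%R) z <=
   (m'^-1 * expR (- eta ^+ 2 / (2 * delta)))%:E)%E.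
Proof.
move=> d0 eta0 m0 zr; rewrite /gheat.
have sd : 0 < Num.sqrt delta by rewrite sqrtr_gt0.
pose T := [set y : RR | eta / Num.sqrt delta < y].
have mTl : measurable T.
  rewrite (_ : T = `]eta / Num.sqrt delta, +oo[%classic)//.
  by apply/seteqP; split => y /=; rewrite in_itv/= andbT.
apply: (@le_trans _ _ (\int[gauss R]_y (m'^-1%:E * (\1_T y)%:E))%E).
  apply: ge0_le_integral => //.
  - by move=> y _; rewrite lee_fin mulr_ge0// invr_ge0 ltW.
  - apply/measurable_EFinP; apply: (measurable_shift (f := fun x => m'^-1 * \1_(`]r + eta, +oo[%classic) x)).
    by apply: measurable_funM => //; exact: measurable_indic.
  - by apply: emeasurable_funM => //; apply/measurable_EFinP; exact: measurable_indic.
  - move=> y _; rewrite -EFinM lee_fin ler_wpM2l ?invr_ge0 ?(ltW m0)// !indicE.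
    have [|] := boolP (z + Num.sqrt delta * y \in `]r + eta, +oo[%classic); last by rewrite ler0n.
    rewrite inE/= in_itv/= andbT => h; rewrite mem_set// /T/= ltr_pdivrMr//.
    by rewrite mulrC; move: h zr; lra.
rewrite ge0_integralZl//; [|by apply/measurable_EFinP; exact: measurable_indic|by rewrite lee_fin invr_ge0 ltW].
rewrite integral_indic// setIT EFinM; apply: lee_wpmul2l.
  by rewrite lee_fin invr_ge0 ltW.
apply: (le_trans (gauss_tail _)); first by rewrite divr_ge0// ltW.
rewrite lee_fin ler_expR expr_div_n sqr_sqrtr ?(ltW d0)//.
by rewrite le_eqVlt; apply/orP; left; apply/eqP; field; rewrite gt_eqF.
Qed.

(** Test with height [1 / m'] beyond [r + eta]: mass above [m'] there makes [1 - e^{-X(G)}] at least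
    [1 - e^{-1}]. The Markov property replaces [G] by the solution [u] after time [delta], at the
    earlier time [s]. *)
Lemma jump_bound (A : set Omega) (s delta eta r m' : R) : 0 <= s -> 0 < delta -> 0 <= eta -> 0 < m' ->
  measurable A -> natural_filtration X s A ->
  ((1 - expR (- 1))%:E * P (A `&` [set w | (m' < hmass X e (r + eta) (s + delta) w)%R]) <=
   \int[P]_(w in A) (1 - expR (- (kap delta * hmass X e r s w + zet delta eta m' * tmass X s w)))%:E)%E.
Proof.
move=> s0 d0 eta0 m0 mA FA.
have m0' : 0 < m'^-1 by rewrite invr_gt0.
pose G z : R := m'^-1 * \1_(`]r + eta, +oo[%classic) z.
have mG : measurable_fun setT (G : RR -> RR).
  by apply: measurable_funM => //; exact: measurable_indic.
have GM z : 0 <= G z <= m'^-1.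
  by rewrite /G indicE; case: (_ \in _); rewrite ?mulr1 ?mulr0 ?lexx ltW.
have G0 x : 0 <= G x by case/andP: (GM x).
have [u mu] := mild_exists beta0 alpha0 bps m0' mG G0 (fun x => (andP (GM x)).2).
have [_ uk ub _] := mu.
have bG := bounded_nonneg_dot mG GM.
have k0 : 0 <= kap delta by rewrite addr_ge0 ?divr_ge0 ?invr_ge0 ?mulr_ge0 ?ltW.
have z0 : 0 <= zet delta eta m' by rewrite !mulr_ge0 ?expR_ge0 ?ltW.
(* Beyond [r] the height-free bound is used; up to [r] the support of [G] is at distance [eta] or
   more, so the Gaussian tail is. *)
pose H z : R := kap delta * \1_(`]r, +oo[%classic) z + zet delta eta m'.
have uH z : u delta z <= H z.
  have /andP[_ uk'] := uk delta z (ltW d0).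
  rewrite /H indicE; have [|] := boolP (z \in `]r, +oo[%classic).
    move=> _; rewrite mulr1 (le_trans uk')// (le_trans (dom_le_inv _ _ _ d0))//.
    by rewrite /kap lerDl.
  rewrite notin_setE/= in_itv/= andbT -lee_fin => /negP; rewrite -leNgt => zr.
  rewrite mulr0 add0r; apply: (le_trans (ub delta z (ltW d0))).
  rewrite /zet EFinM; apply: lee_wpmul2l; first by rewrite lee_fin expR_ge0.
  exact: gheat_tail.
have mH' : measurable_fun setT (H : RR -> RR).
  apply: measurable_funD => //; apply: measurable_funM => //; exact: measurable_indic.
have HM z : 0 <= H z <= kap delta + zet delta eta m'.
  rewrite /H indicE; case: (_ \in _); rewrite ?mulr1 ?mulr0 ?add0r; last by rewrite z0 lerDr.
  by rewrite addr_ge0/=.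
have bH := bounded_nonneg_dot mH' HM.
have bu := mild_bounded_nonneg mu m0' (ltW d0).
apply: (@le_trans _ _ (\int[P]_(w in A) (1 - expR (- mint (X (s + delta) w) (G \o dot e)))%:E)%E).
  have mB : measurable [set w | (m' < hmass X e (r + eta) (s + delta) w)%R].
    rewrite -[X in measurable X]setTI.
    have := mH (r + eta) (s + delta) measurableT (measurable_itv `]m', +oo[).
    by congr measurable; apply/seteqP; split => w [_ /=]; rewrite in_itv/= andbT.
  have -> : ((1 - expR (- 1))%:E * P (A `&` [set w | (m' < hmass X e (r + eta) (s + delta) w)%R]) =
     \int[P]_(w in A `&` [set w | (m' < hmass X e (r + eta) (s + delta) w)%R]) (1 - expR (- 1))%:E)%E.
    by rewrite integral_cst//; exact: measurableI.
  apply: (@le_trans _ _ (\int[P]_(w in A `&` [set w | (m' < hmass X e (r + eta) (s + delta) w)%R]) (1 - expR (- mint (X (s + delta) w) (G \o dot e)))%:E)%E).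
    apply: ge0_le_integral => //.
    - exact: measurableI.
    - by apply: measurable_one_minus_exp; exact: measurable_mint.
    - move=> w [_ /= hw]; rewrite lee_fin lerD2l lerN2 ler_expR lerN2.
      have -> : mint (X (s + delta) w) (G \o dot e) = m'^-1 * hmass X e (r + eta) (s + delta) w.
        have := mint_indic (r + eta) (X (s + delta) w) (ltW m0') (lexx 0).
        rewrite mul0r addr0 => <-.
        by congr mint; apply/funext => x /=; rewrite addr0.
      by rewrite mulrC ler_pdivlMr// mul1r ltW.
  apply: ge0_subset_integral => //.
  - exact: measurableI.
  - by apply: measurable_one_minus_exp; exact: measurable_mint.
  - by move=> w _; rewrite lee_fin one_minus_exp_ge0// mint_ge0// => x /=.
rewrite integral_one_minus_exp//; [|exact: measurable_mint|by move=> w; apply: mint_ge0 => x /=].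
rewrite (laplace_mild m0' mG GM mu s0 (ltW d0) FA).
rewrite -integral_one_minus_exp//; [|exact: measurable_mint|by move=> w; apply: mint_ge0 => x /=; case/andP: (uk delta (dot e x) (ltW d0))].
apply: ge0_le_integral => //.
- move=> w _; rewrite lee_fin one_minus_exp_ge0// mint_ge0// => x /=.
  by case/andP: (uk delta (dot e x) (ltW d0)).
- by apply: measurable_one_minus_exp; exact: measurable_mint.
- apply: measurable_one_minus_exp; apply: measurable_funD; apply: measurable_funM => //; [exact: mH|exact: mT].
- move=> w _; rewrite lee_fin lerD2l lerN2 ler_expR lerN2.
  rewrite -mint_indic//; apply: mint_le => // x; exact: uH.
Qed.

End step.

Section jump.
Context (R : realType) (d : nat) (beta alpha : R) (ps : R -> R).
Context (dO : measure_display) (Omega : measurableType dO) (P : probability Omega R).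
Variable X : R -> Omega -> {finite_measure set Rd R d -> \bar R}.
Notation RR := (measurableTypeR R).
Hypotheses (beta0 : 0 < beta) (alpha0 : 0 < alpha) (bps : branching beta alpha ps).
Hypothesis sbm : is_SBM ps P X.
Variable e : 'rV[R]_d.
Hypothesis e1 : \sum_(i < d) e ord0 i ^+ 2 = 1.

Let mH r t : measurable_fun setT (hmass X e r t : Omega -> RR).
Proof. by apply: (measurable_mass sbm); exact: measurable_halfspace. Qed.

Let mT t : measurable_fun setT (tmass X t : Omega -> RR).
Proof. exact: (measurable_mass sbm). Qed.

Lemma measurable_hmass_gt r t m : measurable [set w | m < hmass X e r t w].
Proof.
rewrite -[X in measurable X]setTI.
have := mH r t measurableT (measurable_itv `]m, +oo[).
by congr measurable; apply/seteqP; split => w [_ /=]; rewrite in_itv/= andbT.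
Qed.

Lemma measurable_hmass_le r t m : measurable [set w | hmass X e r t w <= m].
Proof.
rewrite -[X in measurable X]setTI.
have := mH r t measurableT (measurable_itv `]-oo, m]).
by congr measurable; apply/seteqP; split => w [_ /=]; rewrite in_itv.
Qed.

Let half_le : (2^-1 <= 1 - expR (-1) :> R).
Proof.
have h : 2 <= expR 1 :> R by have := expR_ge1Dx (1 : R); lra.
by rewrite expRN lerBrDr -lerBrDl -[leRHS](_ : 2^-1 = _); [rewrite lef_pV2 ?posrE ?expR_gt0|lra].
Qed.

Let prob_le (A : set Omega) (b : R) : measurable A ->
  ((1 - expR (- 1))%:E * P A <= b%:E)%E -> fine (P A) <= 2 * b.
Proof.
move=> mA h; have fA : P A \is a fin_num by rewrite fin_num_measure.
move: h; rewrite -[in X in (X <= _)%E -> _](fineK fA) -EFinM lee_fin => h.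
have p0 : 0 <= fine (P A) by exact: fine_ge0.
have := ler_wpM2r p0 half_le; lra.
Qed.

Let zet_gt0 delta eta m' : 0 < m' -> 0 < zet beta delta eta m'.
Proof. by move=> m0; rewrite !mulr_gt0 ?expR_gt0 ?invr_gt0. Qed.

Lemma kap_ge0 delta : 0 < delta -> 0 <= kap beta alpha delta.
Proof. by move=> d0; rewrite addr_ge0// ?divr_ge0 ?invr_ge0 ?mulr_ge0 // ltW. Qed.

(** Chaining step: on the event of small mass beyond [r] the half-space term is at most [kap * m],
    and the total mass enters only with the tiny factor [zet]. *)
Lemma jump_small s delta eta r m m' : 0 <= s -> 0 < delta -> 0 <= eta -> 0 < m' -> 0 <= m ->
  fine (P ([set w | hmass X e r s w <= m] `&`
           [set w | m' < hmass X e (r + eta) (s + delta) w])) <=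
  2 * (kap beta alpha delta * m + zet beta delta eta m' * expR (beta * s)).
Proof.
move=> s0 d0 eta0 m'0 m0; set A := [set w | hmass X e r s w <= m].
have mA : measurable A by exact: measurable_hmass_le.
apply: prob_le; first by apply: measurableI => //; exact: measurable_hmass_gt.
have FA : natural_filtration X s A by exact: filtration_hmass.
apply: (le_trans (jump_bound beta0 alpha0 bps sbm e1 r s0 d0 eta0 m'0 mA FA)).
set k := kap _ _ _; set z := zet _ _ _ _.
have k0 : 0 <= k by exact: kap_ge0.
have z0 : 0 < z by exact: zet_gt0.
have mz : measurable_fun setT (fun w => z * tmass X s w : RR) by apply: measurable_funM => //; exact: mT.
have zt0 w : 0 <= z * tmass X s w by rewrite mulr_ge0 ?tmass_ge0// ltW.
(* [1 - e^{-(a+b)} <= a + (1 - e^{-b})] for nonnegative [a], [b]. The total-mass part stays in the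
   exponential, because it is estimated by [mean_bound]. *)
apply: (@le_trans _ _ (\int[P]_(w in A) ((k * m)%:E + (1 - expR (- (z * tmass X s w)))%:E))%E).
  apply: ge0_le_integral => //.
  - move=> w _; rewrite lee_fin one_minus_exp_ge0// addr_ge0// mulr_ge0// ?hmass_ge0 ?tmass_ge0//.
  - apply: measurable_one_minus_exp; apply: measurable_funD; [apply: measurable_funM => //; exact: mH|exact: mz].
  - by apply: emeasurable_funD => //; exact: measurable_one_minus_exp.
  - move=> w Aw; rewrite -EFinD lee_fin opprD expRD.
    have h1 := one_minus_exp_le (k * hmass X e r s w).
    have h2 : k * hmass X e r s w <= k * m by rewrite ler_wpM2l.
    have h3 := one_minus_exp_ge0 (mulr_ge0 k0 (hmass_ge0 X e r s w)).
    have h4 := one_minus_exp_ge0 (zt0 w).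
    have h5 := expR_ge0 (- (z * tmass X s w)).
    nra.
rewrite ge0_integralD//; first last.
- exact: measurable_one_minus_exp.
- by move=> w _; rewrite lee_fin one_minus_exp_ge0.
- by move=> w _; rewrite lee_fin mulr_ge0.
rewrite EFinD; apply: leeD.
  rewrite integral_cst// -[leRHS]mule1; apply: lee_wpmul2l; last exact: probability_le1.
  by rewrite lee_fin mulr_ge0.
apply: (@le_trans _ _ (\int[P]_w (1 - expR (- (z * tmass X s w)))%:E)%E).
  apply: ge0_subset_integral => //; first exact: measurable_one_minus_exp.
  by move=> w _; rewrite lee_fin one_minus_exp_ge0.
(* A constant test function turns the half-space machinery into a bound on the total mass. *)
have := mean_bound beta0 alpha0 bps sbm e1 z0 (G := fun=> z) _ _ s0.
rewrite gheat_cst -EFinM [expR _ * z]mulrC.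
under eq_integral => w _.
  rewrite (_ : mint _ _ = z * tmass X s w); last first.
    have := mint_indic e 0 (X s w) (lexx 0) (ltW z0); rewrite mul0r add0r => <-.
    by congr mint; apply/funext => x /=; rewrite mul0r add0r.
  over.
apply => //.
by move=> _; rewrite lexx ltW.
Qed.

(** Start of the chaining, with no information at time [s]. Smoothing over [delta] first replaces
    the height [1 / m'] by [kap]; the mean of the mass beyond [r] then gives the Gaussian factor. *)
Lemma jump_mean s t delta eta r m' : 0 <= s -> s <= t -> 0 < t -> 0 < delta -> 0 <= eta -> 0 < m' -> 0 <= r ->
  fine (P [set w | m' < hmass X e (r + eta) (s + delta) w]) <=
  2 * (expR (beta * t) * (kap beta alpha delta * expR (- r ^+ 2 / (2 * t)) + zet beta delta eta m')).
Proof.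
move=> s0 st t0 d0 eta0 m'0 r0.
apply: prob_le; first exact: measurable_hmass_gt.
have FT : natural_filtration X s setT by exact: filtration_setT.
have := jump_bound beta0 alpha0 bps sbm e1 r s0 d0 eta0 m'0 measurableT FT.
rewrite setTI => /le_trans; apply.
set k := kap _ _ _; set z := zet _ _ _ _.
have k0 : 0 <= k by exact: kap_ge0.
have z0 : 0 < z by exact: zet_gt0.
pose H (y : R) : R := k * \1_(`]r, +oo[%classic) y + z.
have mI : measurable_fun setT (\1_(`]r, +oo[%classic) : RR -> RR) by exact: measurable_indic.
have mHH : measurable_fun setT (H : RR -> RR) by apply: measurable_funD => //; apply: measurable_funM.
have HM y : 0 <= H y <= k + z.
  rewrite /H indicE; case: (_ \in _); rewrite ?mulr1 ?mulr0 ?add0r; last by rewrite (ltW z0) lerDr.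
  by rewrite addr_ge0/= ?(ltW z0).
have := mean_bound beta0 alpha0 bps sbm e1 (ltr_wpDl k0 z0) mHH HM s0.
under eq_integral do rewrite mint_indic ?(ltW z0)//.
move=> /le_trans; apply.
rewrite EFinM; apply: lee_pmul.
- by rewrite lee_fin expR_ge0.
- by apply: gheat_ge0 => y; rewrite lee_fin; case/andP: (HM y).
- by rewrite lee_fin ler_expR ler_pM2l.
rewrite (_ : EFin \o H = fun y => k%:E * (\1_(`]r, +oo[%classic) y)%:E + z%:E)%E; last first.
  by apply/funext => y /=.
have mIE : measurable_fun setT (fun y : RR => (\1_(`]r, +oo[%classic) y)%:E : \bar R) by exact/measurable_EFinP.
rewrite gheatD//; first last.
- by move=> y; rewrite lee_fin ltW.
- by move=> y; rewrite mule_ge0.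
- exact: emeasurable_funM.
rewrite gheat_cst gheatZ// .
rewrite [leRHS]EFinD; apply: leeD => //; rewrite [leRHS]EFinM; apply: lee_wpmul2l => //.
(* [gheat_tail] needs a positive time; at time 0 the indicator beyond [r >= 0] vanishes at the
   origin. *)
have [s_gt0|s_le0] := ltP 0 s.
  have := gheat_tail s_gt0 r0 ltr01 (lexx 0).
  rewrite invr1 mul1r add0r.
  rewrite (_ : EFin \o _ = fun y => (\1_(`]r, +oo[%classic) y)%:E); last first.
    by apply/funext => y /=; rewrite mul1r.
  move=> /le_trans; apply; rewrite lee_fin ler_expR !mulNr lerN2 ler_wpM2l ?sqr_ge0//.
  by rewrite lef_pV2 ?posrE ?mulr_gt0// ler_pM2l.
have -> : s = 0 by apply/eqP; rewrite eq_le s_le0 s0.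
rewrite /gheat sqrtr0; under eq_integral do rewrite mul0r addr0.
rewrite integral_gauss_cst lee_fin indicE memNset ?expR_ge0//=.
by rewrite in_itv/= andbT; apply/negP; rewrite -leNgt.
Qed.

Lemma hmass0 r m : 0 < m -> 0 <= r -> fine (P [set w | m < hmass X e r 0 w]) = 0.
Proof.
move=> m0 r0; pose G (z : R) : R := m^-1 * \1_(`]r, +oo[%classic) z.
have m0' : 0 < m^-1 by rewrite invr_gt0.
have mG : measurable_fun setT (G : RR -> RR).
  by apply: measurable_funM => //; exact: measurable_indic.
have GM z : 0 <= G z <= m^-1.
  by rewrite /G indicE; case: (_ \in _); rewrite ?mulr1 ?mulr0 ?lexx ltW.
have := mean_bound beta0 alpha0 bps sbm e1 m0' mG GM (lexx 0).
rewrite /gheat sqrtr0; under [X in (_ <= _ * X)%E -> _]eq_integral do rewrite mul0r addr0.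
rewrite integral_gauss_cst /= {2}/G indicE memNset ?mulr0 ?mule0; last first.
  by rewrite /= in_itv/= andbT; apply/negP; rewrite -leNgt.
have GE w : mint (X 0 w) (G \o dot e) = m^-1 * hmass X e r 0 w.
  have := mint_indic e r (X 0 w) (ltW m0') (lexx 0); rewrite mul0r addr0 => <-.
  by congr mint; apply/funext => x /=; rewrite addr0.
under eq_integral do rewrite GE.
move=> h; apply/eqP; rewrite eq_le fine_ge0// andbT.
rewrite -[leRHS](mulr0 2); apply: prob_le; first exact: measurable_hmass_gt.
apply: le_trans h.
have mB := measurable_hmass_gt r 0 m.
have mf : measurable_fun setT (fun w => m^-1 * hmass X e r 0 w : RR).
  by apply: measurable_funM => //; exact: mH.
have f0 w : 0 <= m^-1 * hmass X e r 0 w by rewrite mulr_ge0 ?hmass_ge0// ltW.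
apply: (@le_trans _ _ (\int[P]_(w in [set w | (m < hmass X e r 0 w)%R]) (1 - expR (- (m^-1 * hmass X e r 0 w)))%:E)%E).
  rewrite -integral_cst//; apply: ge0_le_integral => //.
  - by move=> w _; rewrite lee_fin one_minus_exp_ge0.
  - exact: measurable_one_minus_exp.
  - move=> w /= hw; rewrite lee_fin lerD2l lerN2 ler_expR lerN2.
    by rewrite mulrC ler_pdivlMr// mul1r ltW.
apply: ge0_subset_integral => //; first exact: measurable_one_minus_exp.
by move=> w _; rewrite lee_fin one_minus_exp_ge0.
Qed.

End jump.

(** * Union bounds for real-valued probabilities *)

Section prob.
Context (R : realType) (dO : measure_display) (Omega : measurableType dO) (P : probability Omega R).

Lemma fine_prob_le (A B : set Omega) : measurable A -> measurable B -> A `<=` B ->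
  fine (P A) <= fine (P B).
Proof.
move=> mA mB AB; apply: fine_le; [exact: fin_num_measure|exact: fin_num_measure|].
by apply: le_measure; rewrite ?inE.
Qed.

Lemma fine_probU (A B : set Omega) : measurable A -> measurable B ->
  fine (P (A `|` B)) <= fine (P A) + fine (P B).
Proof.
move=> mA mB; rewrite -fineD; [|exact: fin_num_measure|exact: fin_num_measure].
apply: fine_le; [|by rewrite fin_numD !fin_num_measure|exact: measureU2].
by apply: fin_num_measure; exact: measurableU.
Qed.

Lemma fine_prob_bigU (I : Type) (l : seq I) (A : I -> set Omega) (b : R) :
  (forall i, measurable (A i)) -> (forall i, fine (P (A i)) <= b) ->
  fine (P (\big[setU/set0]_(i <- l) A i)) <= (size l)%:R * b.
Proof.
move=> mA Ab; elim: l => [|i l ih]; first by rewrite big_nil measure0 mul0r.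
have mU : measurable (\big[setU/set0]_(i <- l) A i) by exact: bigsetU_measurable.
rewrite big_cons (le_trans (fine_probU _ _))//=.
by rewrite -natr1 mulrDl mul1r addrC lerD.
Qed.

Lemma fine_prob_nondecreasing_bigcup (F : nat -> set Omega) (b : R) :
  (forall n, measurable (F n)) -> (forall n, F n `<=` F n.+1) ->
  (forall n, fine (P (F n)) <= b) -> fine (P (\bigcup_n F n)) <= b.
Proof.
move=> mF ndF Fb.
have mU : measurable (\bigcup_n F n) by exact: bigcup_measurable.
have ndF' : nondecreasing_seq F by apply/nondecreasing_seqP => n; apply/subsetPset; exact: ndF.
have cP := nondecreasing_cvg_mu (mu := P) mF mU ndF'.
rewrite -lee_fin fineK ?fin_num_measure//.
rewrite -(cvg_lim _ cP)//.
apply: lime_le.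
  by apply/cvg_ex; exists (P (\bigcup_n F n)).
apply: nearW => n /=; have fF : P (F n) \is a fin_num by rewrite fin_num_measure.
by rewrite -(fineK fF) lee_fin.
Qed.

End prob.

(** * Chaining over dyadic time grids for one half-space *)

Section chain.
Context (R : realType) (d : nat) (beta alpha : R) (ps : R -> R).
Context (dO : measure_display) (Omega : measurableType dO) (P : probability Omega R).
Variable X : R -> Omega -> {finite_measure set Rd R d -> \bar R}.
Notation RR := (measurableTypeR R).
Hypotheses (beta0 : 0 < beta) (alpha0 : 0 < alpha) (bps : branching beta alpha ps).
Hypothesis sbm : is_SBM ps P X.
Variable e : 'rV[R]_d.
Hypothesis e1 : \sum_(i < d) e ord0 i ^+ 2 = 1.

Definition grid (tau : R) (k j : nat) : R := j%:R * (tau / 2 ^+ k).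

Lemma grid_double tau k j : grid tau k.+1 j.*2 = grid tau k j.
Proof. by rewrite /grid -muln2 natrM exprS; field; rewrite expf_neq0. Qed.

Variables (rho eps t : R) (N : nat).
Hypotheses (rho0 : 0 < rho) (eps0 : 0 < eps) (t0 : 0 < t) (N0 : (0 < N)%N).
Let tau := t / N%:R.
Hypotheses (tau_ge : 2^-1 <= tau) (tau_le : tau <= 1).
Let L := rho ^+ 2 / 2.
Hypothesis tbig1 : (beta + 2 * L) * t <= eps ^+ 2 * t ^+ 2 / 32.
Hypothesis tbig2 : 40 <= eps ^+ 2 * t ^+ 2 / 32.
(** The first two terms bound [kap] up to the factor [2 ^+ k], using [tau >= 1/2]; the third pays
    for the Gaussian error, with 8 from [m k.+1] and [expR beta] from growth during a step of length
    at most 1. *)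
Let Cst := beta / alpha + 4 / alpha + 8 * expR beta.
Let E := expR ((beta - L) * t).
Let m (k : nat) := expR (- (L * t)) / 8 ^+ k.
(** Runs from [(rho + eps) t] to its limit [(rho + 2 eps) t]. The first [eps t] is the room for the
    single jump that starts the chain, the second is shared by all refinements as the [eta k]. *)
Let r (k : nat) := rho * t + eps * t + eps * t * (1 - (3 / 4) ^+ k).
Let eta (k : nat) := eps * t * (3 / 4) ^+ k / 4.
Let Bset k j := [set w | m k < hmass X e (r k) (grid tau k j) w].
Let A k := \big[setU/set0]_(j <- iota 0 (N * 2 ^ k).+1) Bset k j.

Let tau_gt0 : 0 < tau. Proof. by rewrite (lt_le_trans _ tau_ge). Qed.

Let tE : t = N%:R * tau. Proof. by rewrite /tau mulrC divfK// pnatr_eq0 -lt0n. Qed.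

Let m_gt0 k : 0 < m k. Proof. by rewrite divr_gt0 ?expR_gt0 ?exprn_gt0. Qed.

Let rS k : r k.+1 = r k + eta k.
Proof. by rewrite /r /eta exprS; field. Qed.

Let pow34 k : 0 < (3 / 4) ^+ k :> R. Proof. by rewrite exprn_gt0. Qed.

Let pow34_le1 k : (3 / 4) ^+ k <= 1 :> R.
Proof. by rewrite exprn_ile1//; lra. Qed.

Let eta_ge0 k : 0 <= eta k.
Proof. by rewrite divr_ge0// !mulr_ge0// ltW. Qed.

Let r_ge0 k : 0 <= r k.
Proof.
rewrite /r !addr_ge0 ?mulr_ge0 ?(ltW rho0) ?(ltW eps0) ?(ltW t0)//.
by rewrite subr_ge0.
Qed.

Let mB k j : measurable (Bset k j). Proof. exact: (measurable_hmass_gt sbm). Qed.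

Let mA k : measurable (A k). Proof. by apply: bigsetU_measurable. Qed.

Let AP k w : A k w <-> exists2 j, (j <= N * 2 ^ k)%N & Bset k j w.
Proof.
rewrite /A; split.
  rewrite -bigcup_seq => -[j jl Bj]; have : j \in iota 0 (N * 2 ^ k).+1 by [].
  by rewrite mem_iota add0n ltnS => /andP[_ jN]; exists j.
by move=> [j jN Bj]; rewrite -bigcup_seq; exists j => //; rewrite /mkset mem_iota add0n ltnS jN.
Qed.

Let del k := tau / 2 ^+ k.

Let del_gt0 k : 0 < del k. Proof. by rewrite divr_gt0// exprn_gt0. Qed.

(** A step lasts between [del k.+1] and twice that. [kap] is largest for the short duration and
    [zet] for the long one, whence the 4 in the Gaussian exponent. *)
Let b k := 2 * (kap beta alpha (del k.+1) * m k +
  expR (2 * beta * del k.+1) * ((m k.+1)^-1 * expR (- eta k ^+ 2 / (4 * del k.+1))) * expR (beta * t)).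

(* The time of index j.+1 in the grid of mesh k.+1 is compared with the time of index
   j./2 in the coarser grid, which precedes it by one or two fine steps. *)
Let Dset k j := if j is 0%N then Bset k.+1 0%N else
  [set w | hmass X e (r k) (grid tau k (j.-1)./2) w <= m k] `&` Bset k.+1 j.

Let mD k j : measurable (Dset k j).
Proof.
case: j => [|j]; first exact: mB.
by apply: measurableI; [exact: (measurable_hmass_le sbm)|exact: mB].
Qed.

Let Dset_le k j : (j <= N * 2 ^ k.+1)%N -> fine (P (Dset k j)) <= b k.
Proof.
have kp := kap_ge0 beta0 alpha0 (del_gt0 k.+1).
case: j => [_|j jN].
  rewrite /Dset /Bset /grid mul0r (hmass0 beta0 alpha0 bps sbm e1)//.
  rewrite /b mulr_ge0// addr_ge0//; first by rewrite mulr_ge0// ltW.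
  by rewrite !mulr_ge0 ?expR_ge0// invr_ge0 ltW.
rewrite /Dset /=; set q := j./2.
pose delta := grid tau k.+1 j.+1 - grid tau k q.
have jq : j = (odd j + q.*2)%N by rewrite /q odd_double_half.
have dE : delta = ((odd j)%:R + 1) * del k.+1.
  rewrite /delta -(grid_double tau k q) /grid /del -mulrBl; congr (_ * _).
  by rewrite -natr1 {1}jq natrD; ring.
have dlo : del k.+1 <= delta.
  by rewrite dE ler_peMl ?(ltW (del_gt0 _))// lerDr ler0n.
have dhi : delta <= 2 * del k.+1.
  rewrite dE ler_wpM2r ?(ltW (del_gt0 _))//; case: (odd j) => /=; rewrite ?mulr1n ?mulr0n; lra.
have d0 : 0 < delta by exact: lt_le_trans dlo.
have gE : grid tau k.+1 j.+1 = grid tau k q + delta by rewrite /delta addrC subrK.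
have g0 : 0 <= grid tau k q by rewrite mulr_ge0 ?ler0n// ltW ?del_gt0.
have gt : grid tau k q <= t.
  apply: (@le_trans _ _ (grid tau k.+1 j.+1)); first by rewrite gE lerDl ltW.
  rewrite tE /grid mulrCA [leRHS]mulrC ler_wpM2l ?(ltW tau_gt0)//.
  by rewrite ler_pdivrMr ?exprn_gt0// -natrX -natrM ler_nat.
rewrite /Bset rS gE.
apply: (le_trans (jump_small beta0 alpha0 bps sbm e1 (r k) g0 d0 (eta_ge0 k) (m_gt0 k.+1) (ltW (m_gt0 k)))).
rewrite /b ler_pM2l// lerD//.
  rewrite ler_wpM2r ?(ltW (m_gt0 k))// /kap lerD2l lef_pV2 ?posrE ?(mulr_gt0 alpha0 d0) ?(mulr_gt0 alpha0 (del_gt0 _))//.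
  by rewrite ler_pM2l.
apply: ler_pM; rewrite ?expR_ge0//.
- by rewrite !mulr_ge0 ?expR_ge0// invr_ge0 ltW.
- apply: ler_pM; rewrite ?expR_ge0 ?mulr_ge0 ?expR_ge0 ?invr_ge0 ?(ltW (m_gt0 _))//.
    by rewrite ler_expR [2 * beta]mulrC -mulrA ler_pM2l.
  rewrite ler_wpM2l ?invr_ge0 ?(ltW (m_gt0 _))// ler_expR !mulNr lerN2.
  rewrite ler_wpM2l ?sqr_ge0// lef_pV2 ?posrE ?(mulr_gt0 _ d0) ?(mulr_gt0 _ (del_gt0 _))//.
  by rewrite (_ : 4 * _ = 2 * (2 * del k.+1)); [rewrite ler_pM2l|ring].
- by rewrite ler_expR ler_pM2l.
Qed.

(** If [A k] fails, every coarse grid time has mass at most [m k] beyond [r k], so an exceedance on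
    the finer grid is one of the jumps [Dset k j]. *)
Let A_step k : fine (P (A k.+1)) <= fine (P (A k)) + (N * 2 ^ k.+1).+1%:R * b k.
Proof.
(* The guard empties the indices past the end, since [fine_prob_bigU] asks for the same bound at
   every index while [Dset_le] holds only inside the grid. *)
pose DU := \big[setU/set0]_(j <- iota 0 (N * 2 ^ k.+1).+1)
  (if (j <= N * 2 ^ k.+1)%N then Dset k j else set0).
have mDU : measurable DU by apply: bigsetU_measurable => j _; case: ifP.
apply: (@le_trans _ _ (fine (P (A k `|` DU)))).
  apply: fine_prob_le => //; first exact: measurableU.
  move=> w /AP[j jN Bj]; have [Aw|nAw] := pselect (A k w); [by left|right].
  rewrite /DU -bigcup_seq; exists j; first by rewrite /mkset mem_iota add0n ltnS jN.
  rewrite jN; case: j jN Bj => [//|j] jN Bj; split => //=.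
  rewrite leNgt; apply/negP => h; apply: nAw; apply/AP; exists j./2 => //.
  rewrite -leq_double (leq_trans (leq_trans (n:=j) _ (leqnSn j)))//.
    by rewrite -[leqRHS](odd_double_half j) leq_addl.
  by rewrite (leq_trans jN)// expnS mulnCA mul2n.
apply: (le_trans (fine_probU _ _ _)) => //; rewrite lerD2l.
rewrite -[X in _ <= X%:R * _](size_iota 0).
apply: fine_prob_bigU => j; case: ifP => // jN; first exact: Dset_le.
rewrite measure0 /b mulr_ge0// addr_ge0//.
  by rewrite mulr_ge0 ?(ltW (m_gt0 k))// kap_ge0.
by rewrite !mulr_ge0 ?expR_ge0// invr_ge0 ltW.
Qed.

Let E' := expR (- (L * t)).

Let E'_gt0 : 0 < E'. Proof. exact: expR_gt0. Qed.

Let E'_le : E' <= E.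
Proof. by rewrite ler_expR mulrBl lerDr mulr_ge0// ltW. Qed.

Let expR1_ge2 : 2 <= expR 1 :> R.
Proof. have := expR_ge1Dx (1 : R); lra. Qed.

Let bernoulli k : 1 + k%:R / 8 <= (9 / 8) ^+ k :> R.
Proof.
elim: k => [|k ih]; first by rewrite mul0r addr0 expr0.
rewrite exprS -natr1.
have h : 0 <= k%:R :> R by [].
have : (9 / 8) * (1 + k%:R / 8) <= 9 / 8 * (9 / 8) ^+ k :> R by rewrite ler_pM2l//; lra.
lra.
Qed.

Let Q := eps ^+ 2 * t ^+ 2 / 32.

(** The exponent equals [Q (9/8)^k / tau], at least [Q (1 + k/8)] by Bernoulli. As [Q >= 40], this
    exceeds [Q] by [5 k], and [e^{-5} <= 1/32] because [e >= 2]. The base 32 is [8 * 4]: it cancels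
    the growth of [1 / m k] and leaves [4^-k]. *)
Let exp_eta k : expR (- eta k ^+ 2 / (4 * del k.+1)) <= expR (- Q) * (32^-1) ^+ k.
Proof.
have Q0 : 0 <= Q by rewrite (le_trans _ tbig2).
have h1 : Q * (1 + k%:R / 8) <= eta k ^+ 2 / (4 * del k.+1).
  have -> : eta k ^+ 2 / (4 * del k.+1) = Q * (9 / 8) ^+ k / tau.
    rewrite (_ : (9 / 8) ^+ k = ((3 / 4) ^+ k) ^+ 2 * 2 ^+ k); last first.
      by rewrite -exprM mulnC exprM -exprMn; congr (_ ^+ _); field.
    rewrite /eta /del /Q (exprS 2 k); set p := (3 / 4) ^+ k; set p2 := 2 ^+ k.
    by field; rewrite expf_neq0//= gt_eqF.
  rewrite ler_pdivlMr// (le_trans (ler_wpM2l _ tau_le))//.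
    by rewrite mulr_ge0// addr_ge0// divr_ge0.
  by rewrite mulr1 ler_wpM2l.
have h2 : 5 * k%:R <= Q * (k%:R / 8).
  have := ler_wpM2r (ler0n R k) tbig2; rewrite -/Q; lra.
have h3 : (32^-1 : R) >= expR (- 5).
  rewrite expRN lef_pV2 ?posrE ?expR_gt0//.
  have -> : expR 5 = expR 1 ^+ 5 :> R by rewrite -expRM_natl mulr1.
  have := @lerXn2r R 5 2 (expR 1); rewrite !nnegrE (ler0n _ 2) expR_ge0 => /(_ isT isT expR1_ge2).
  by apply: le_trans; rewrite -natrX ler_nat.
apply: (@le_trans _ _ (expR (- Q) * expR (- 5) ^+ k)); last first.
  by rewrite ler_wpM2l ?expR_ge0// lerXn2r ?nnegrE ?expR_ge0// invr_ge0.
by rewrite -expRM_natl -expRD ler_expR -mulr_natr; lra.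
Qed.

(** Both parts decay like [4^-k]: the first as [2^k 8^-k], the second as [8^k 32^-k]. [tbig1] says
    that [e^{-Q}] absorbs [e^{(L + beta) t}] and still leaves [E']. *)
Let b_le k : b k <= 2 * Cst * (4^-1) ^+ k * E'.
Proof.
have p2 : 0 < 2 ^+ k :> R by rewrite exprn_gt0.
have p2' : 1 <= 2 ^+ k :> R by rewrite exprn_ege1// ler1n.
have p4 : 0 < (4^-1) ^+ k :> R by rewrite exprn_gt0.
have p8 : 0 < 8 ^+ k :> R by rewrite exprn_gt0.
have h1 : kap beta alpha (del k.+1) <= (beta / alpha + 4 / alpha) * 2 ^+ k.
  rewrite mulrDl lerD//.
    by rewrite ler_peMr// divr_ge0// ltW.
  rewrite /del exprS (_ : (alpha * _)^-1 = 2 / alpha * 2 ^+ k * tau^-1); last first.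
    by field; rewrite !gt_eqF.
  have : tau^-1 <= 2 by rewrite -[leRHS]invrK lef_pV2 ?posrE.
  have c0 : 0 <= 2 / alpha * 2 ^+ k by rewrite mulr_ge0 ?divr_ge0 // ltW.
  by move=> /(ler_wpM2l c0) /le_trans; apply; lra.
have m1 : kap beta alpha (del k.+1) * m k <= (beta / alpha + 4 / alpha) * (4^-1) ^+ k * E'.
  apply: (@le_trans _ _ ((beta / alpha + 4 / alpha) * 2 ^+ k * m k)).
    by rewrite ler_wpM2r// ltW.
  rewrite /m -/E' le_eqVlt; apply/orP; left; apply/eqP.
  rewrite (_ : 4^-1 = 2 / 8 :> R); last by field.
  by rewrite expr_div_n; field; rewrite !gt_eqF.
have m2 : expR (2 * beta * del k.+1) * ((m k.+1)^-1 * expR (- eta k ^+ 2 / (4 * del k.+1))) * expR (beta * t)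
   <= 8 * expR beta * (4^-1) ^+ k * E'.
  have e2 : expR (2 * beta * del k.+1) <= expR beta.
    rewrite ler_expR /del exprS.
    rewrite (_ : 2 * beta * _ = beta * (tau / 2 ^+ k)); last by field; rewrite gt_eqF.
    rewrite ler_piMr ?(ltW beta0)// ler_pdivrMr// mul1r (le_trans tau_le)//.
  have mE : (m k.+1)^-1 = 8 * 8 ^+ k * expR (L * t).
    by rewrite /m expRN exprS; field; rewrite !gt_eqF ?expR_gt0.
  have e3 : expR (- Q) * expR (L * t) * expR (beta * t) <= E'.
    by rewrite -!expRD ler_expR; move: tbig1; rewrite -/Q; lra.
  rewrite mE.
  apply: (@le_trans _ _ (expR beta * (8 * 8 ^+ k * expR (L * t) * (expR (- Q) * (32^-1) ^+ k)) * expR (beta * t))).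
    rewrite ler_wpM2r ?expR_ge0//; apply: ler_pM; rewrite ?expR_ge0//.
    by rewrite ler_wpM2l// !mulr_ge0 ?expR_ge0// ltW.
  rewrite (_ : 4^-1 = 8 * 32^-1 :> R); last by field.
  have c0 : 0 <= 8 * expR beta * (8 * 32^-1) ^+ k by rewrite !mulr_ge0 ?expR_ge0// exprn_ge0.
  apply: le_trans (ler_wpM2l c0 e3); rewrite exprMn le_eqVlt; apply/orP; left; apply/eqP; ring.
rewrite /b (_ : 2 * Cst * _ * E' = 2 * (Cst * (4^-1) ^+ k * E')); last by ring.
rewrite ler_pM2l//.
apply: (le_trans (lerD m1 m2)); rewrite /Cst le_eqVlt; apply/orP; left; apply/eqP; ring.
Qed.

Let Cst_gt0 : 0 < Cst.
Proof. by rewrite !addr_gt0 ?divr_gt0 ?mulr_gt0 ?expR_gt0. Qed.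

Let N1 : 1 <= N%:R :> R. Proof. by rewrite ler1n. Qed.

(** About [N 2^k] grid times against [4^-k] each: the increments form a geometric series of ratio
    [1/2], written in closed form. *)
Let A_bound k : fine (P (A k)) <= fine (P (A 0)) + 16 * N%:R * Cst * E' * (1 - (2^-1) ^+ k).
Proof.
elim: k => [|k ih]; first by rewrite expr0 subrr mulr0 addr0.
apply: (le_trans (A_step k)).
have p2 : 0 < 2 ^+ k :> R by rewrite exprn_gt0.
have p2' : 1 <= 2 ^+ k :> R by rewrite exprn_ege1// ler1n.
have hN : (N * 2 ^ k.+1).+1%:R <= 4 * N%:R * 2 ^+ k :> R.
  rewrite -natr1 natrM natrX exprS.
  have : 1 <= N%:R * 2 ^+ k :> R by rewrite -[leLHS]mulr1 ler_pM.
  lra.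
have s2 : (N * 2 ^ k.+1).+1%:R * b k <= 8 * N%:R * Cst * E' * (2^-1) ^+ k.
  apply: (@le_trans _ _ (4 * N%:R * 2 ^+ k * (2 * Cst * (4^-1) ^+ k * E'))).
    apply: (@le_trans _ _ ((N * 2 ^ k.+1).+1%:R * (2 * Cst * (4^-1) ^+ k * E'))).
      by rewrite ler_wpM2l.
    by rewrite ler_wpM2r// !mulr_ge0 ?(ltW Cst_gt0) ?exprn_ge0 ?(ltW E'_gt0).
  rewrite (_ : 2^-1 = 2 * 4^-1 :> R); last by field.
  rewrite exprMn le_eqVlt; apply/orP; left; apply/eqP; ring.
rewrite exprS; move: ih s2.
set x := (2^-1) ^+ k; set y := 16 * _ * _ * _.
rewrite (_ : 8 * N%:R * Cst * E' = y / 2); last by rewrite /y; field.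
lra.
Qed.

(** Here the exponential rate arises: [jump_mean] at radius [rho t] has the factor
    [e^{beta t} e^{-(rho t)^2 / (2 t)}], which is [E]. At time 0 the process sits at the origin and
    [hmass0] applies. *)
Let A0_bound : fine (P (A 0)) <= N.+1%:R * (4 * Cst * E).
Proof.
rewrite /A expn0 muln1.
have E0 : 0 < E by exact: expR_gt0.
have -> : \big[setU/set0]_(j <- iota 0 N.+1) Bset 0 j =
   \big[setU/set0]_(j <- iota 0 N.+1) (if (j <= N)%N then Bset 0 j else set0).
  by apply: eq_big_seq => j; rewrite mem_iota add0n ltnS => /andP[_ ->].
rewrite -[X in _ <= X%:R * _](size_iota 0); apply: fine_prob_bigU.
  by move=> j; case: ifP.
move=> j; case: ifP => jN; last by rewrite measure0 !mulr_ge0 ?(ltW Cst_gt0) ?(ltW E0).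
case: j jN => [_|j jN].
  by rewrite /Bset /grid mul0r (hmass0 beta0 alpha0 bps sbm e1)// !mulr_ge0 ?(ltW Cst_gt0) ?(ltW E0).
have rE : r 0 = rho * t + eps * t by rewrite /r expr0 subrr mulr0 addr0.
have gE : grid tau 0 j.+1 = j%:R * tau + tau by rewrite /grid expr0 divr1 -natr1 mulrDl mul1r.
rewrite /Bset rE gE.
have s0 : 0 <= j%:R * tau by rewrite mulr_ge0// ltW.
have st : j%:R * tau <= t.
  by rewrite tE ler_wpM2r ?(ltW tau_gt0)// ler_nat ltnW.
have et0 : 0 <= eps * t by rewrite mulr_ge0// ltW.
have rt0 : 0 <= rho * t by rewrite mulr_ge0// ltW.
apply: (le_trans (jump_mean beta0 alpha0 bps sbm e1 s0 st t0 tau_gt0 et0 (m_gt0 0) rt0)).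
rewrite (_ : 4 * Cst * E = 2 * (Cst * E + Cst * E)); last by ring.
rewrite ler_pM2l// mulrDr lerD//.
  rewrite mulrCA -expRD.
  rewrite (_ : beta * t + - (rho * t) ^+ 2 / (2 * t) = (beta - L) * t); last first.
    by rewrite /L; field; rewrite gt_eqF.
  rewrite ler_wpM2r ?(ltW E0)// /kap /Cst -addrA lerD2l.
  rewrite invfM mulrC -[leLHS]addr0 lerD ?mulr_ge0 ?expR_ge0//.
  rewrite ler_wpM2r ?invr_ge0 ?(ltW alpha0)//.
  have : tau^-1 <= 2 by rewrite -[leRHS]invrK lef_pV2 ?posrE.
  lra.
have Q0 : 0 <= Q by rewrite (le_trans _ tbig2).
have h : expR (beta * t) * zet beta tau (eps * t) (m 0) <= expR beta * E'.
  have mE : (m 0)^-1 = expR (L * t) by rewrite /m expr0 divr1 expRN invrK.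
  have e2 : expR (- (eps * t) ^+ 2 / (2 * tau)) <= expR (- Q).
    rewrite ler_expR mulNr lerN2 ler_pdivlMr ?(mulr_gt0 _ tau_gt0)//.
    have := ler_wpM2l Q0 tau_le; rewrite /Q exprMn; set z := _ * t ^+ 2.
    move: Q0; rewrite /Q -/z; lra.
  have e3 : expR (- Q) * expR (L * t) * expR (beta * t) <= E'.
    by rewrite -!expRD ler_expR; move: tbig1; rewrite -/Q; lra.
  rewrite /zet mE.
  apply: (@le_trans _ _ (expR (beta * t) * (expR beta * (expR (L * t) * expR (- Q))))).
    rewrite ler_wpM2l ?expR_ge0//; apply: ler_pM; rewrite ?mulr_ge0 ?expR_ge0//.
      by rewrite ler_expR ler_piMr// ltW.
    by rewrite ler_wpM2l ?expR_ge0.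
  apply: le_trans (ler_wpM2l (expR_ge0 beta) e3).
  rewrite le_eqVlt; apply/orP; left; apply/eqP; ring.
apply: (le_trans h); apply: ler_pM; rewrite ?expR_ge0 ?(ltW E'_gt0)//.
rewrite /Cst; have : 0 < beta / alpha + 4 / alpha by rewrite addr_gt0 ?divr_gt0.
have := expR_gt0 beta; lra.
Qed.

Let A_final k : fine (P (A k)) <= 24 * N%:R * Cst * E.
Proof.
apply: (le_trans (A_bound k)).
have E0 : 0 < E by exact: expR_gt0.
have CE : 0 < Cst * E by rewrite mulr_gt0.
have h1 : fine (P (A 0)) <= 8 * N%:R * Cst * E.
  apply: (le_trans A0_bound); rewrite -natr1.
  have := ler_wpM2r (ltW CE) N1; lra.
have h2 : 16 * N%:R * Cst * E' * (1 - (2^-1) ^+ k) <= 16 * N%:R * Cst * E.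
  have c0 : 0 <= 16 * N%:R * Cst by rewrite !mulr_ge0// ltW.
  apply: (@le_trans _ _ (16 * N%:R * Cst * E')); last by rewrite ler_wpM2l.
  rewrite ler_piMr//; first by rewrite mulr_ge0// ltW.
lra.
Qed.

Definition far_event := [set w | exists k j, (j <= N * 2 ^ k)%N /\
  0 < hmass X e ((rho + 2 * eps) * t) (grid (t / N%:R) k j) w].

(** The thresholds [m k] at the limiting radius. With the radius fixed these events increase with
    [k], so continuity from below applies to their union. *)
Let F k := \big[setU/set0]_(j <- iota 0 (N * 2 ^ k).+1)
  [set w | m k < hmass X e ((rho + 2 * eps) * t) (grid tau k j) w].

Let FP k w : F k w <-> exists2 j, (j <= N * 2 ^ k)%N & m k < hmass X e ((rho + 2 * eps) * t) (grid tau k j) w.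
Proof.
rewrite /F; split.
  rewrite -bigcup_seq => -[j jl Bj]; have : j \in iota 0 (N * 2 ^ k).+1 by [].
  by rewrite mem_iota add0n ltnS => /andP[_ jN]; exists j.
by move=> [j jN Bj]; rewrite -bigcup_seq; exists j => //; rewrite /mkset mem_iota add0n ltnS jN.
Qed.

Let mF k : measurable (F k).
Proof. by apply: bigsetU_measurable => j _; exact: (measurable_hmass_gt sbm). Qed.

Let mS k : m k.+1 <= m k.
Proof.
rewrite /m ler_pM2l ?expR_gt0// lef_pV2 ?posrE ?exprn_gt0//.
by rewrite exprS ler_peMl ?exprn_ge0// ler1n.
Qed.

Let grid_add k l j : grid tau (k + l) (j * 2 ^ l) = grid tau k j.
Proof.
elim: l => [|l ih]; first by rewrite addn0 muln1.
by rewrite addnS expnS mulnCA mul2n grid_double ih.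
Qed.

(** Positive mass exceeds [m (k + l)] for [l] large, and a grid time of level [k] is also one of
    level [k + l]. *)
Let far_eventE : far_event = \bigcup_k F k.
Proof.
apply/seteqP; split => w; last first.
  move=> [k _ /FP[j jN h]]; exists k, j; split => //.
  by apply: lt_trans h; exact: m_gt0.
move=> [k [j [jN h]]].
have [l hl] : exists l, m (k + l) < hmass X e ((rho + 2 * eps) * t) (grid tau k j) w.
  set x := hmass _ _ _ _ _ in h *.
  have := truncnS_gt (E' / x); set l := (Num.truncn _).+1 => hl.
  have h2 : E' / x < 8 ^+ (k + l).
    apply: (lt_le_trans hl); rewrite -natrX ler_nat (leq_trans (leq_addl k l))// ltnW//.
    exact: ltn_expl.
  by exists l; rewrite /m ltr_pdivrMr ?exprn_gt0// [x * _]mulrC -ltr_pdivrMr.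
exists (k + l)%N => //; apply/FP; exists (j * 2 ^ l)%N.
  by rewrite expnD mulnA leq_mul2r jN orbT.
by rewrite grid_add.
Qed.

Lemma measurable_far_event : measurable far_event.
Proof. by rewrite far_eventE; apply: bigcup_measurable => k _. Qed.

Lemma far_event_le : fine (P far_event) <= 24 * N%:R * Cst * E.
Proof.
rewrite far_eventE; apply: fine_prob_nondecreasing_bigcup => // k.
  move=> w /FP[j jN h]; apply/FP; exists j.*2.
    by rewrite expnS mulnCA mul2n leq_double.
  by rewrite grid_double (le_lt_trans (mS k)).
apply: le_trans (A_final k); apply: fine_prob_le => // w /FP[j jN h].
apply/AP; exists j => //; rewrite /Bset /=; apply: (lt_le_trans h).
apply: hmass_le; rewrite /r.
have : 0 <= eps * t by rewrite mulr_ge0// ltW.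
have := ltW (pow34 k); set p := (3 / 4) ^+ k; nra.
Qed.

End chain.

(** * Lower bound by iterated moving windows *)

Section lower.
Context (R : realType) (d : nat) (beta alpha : R) (ps : R -> R).
Context (dO : measure_display) (Omega : measurableType dO) (P : probability Omega R).
Variable X : R -> Omega -> {finite_measure set Rd R d -> \bar R}.
Notation RR := (measurableTypeR R).
Hypotheses (beta0 : 0 < beta) (alpha0 : 0 < alpha) (bps : branching beta alpha ps).
Hypothesis sbm : is_SBM ps P X.
Variable e : 'rV[R]_d.
Hypothesis e1 : \sum_(i < d) e ord0 i ^+ 2 = 1.
Variables (rho eps : R).
Hypotheses (rho0 : 0 < rho) (eps0 : 0 < eps) (epsb : eps <= beta) (Lam0 : beta <= rho ^+ 2 / 2).
Let Lam := rho ^+ 2 / 2 - beta.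

Let win (a c z : R) : R := c * \1_(`[a, a + 1]%classic) z.

Let mwin a c : measurable_fun setT (win a c : RR -> RR).
Proof. by apply: measurable_funM => //; exact: measurable_indic. Qed.

Let win_bnd a c z : 0 <= c -> 0 <= win a c z <= c.
Proof. by move=> c0; rewrite /win indicE; case: (_ \in _); rewrite ?mulr1 ?mulr0 ?lexx ?c0. Qed.

Let C1 : R := expR (rho + 1) / normal_peak 1.

Let peak0 : 0 < normal_peak 1 :> R. Proof. by rewrite normal_peak_gt0. Qed.

Let C1_gt0 : 0 < C1. Proof. by rewrite divr_gt0 ?expR_gt0. Qed.

(** The displacement to the target window is at most [rho L + 1], so the Gaussian cost is
    [rho^2 L / 2 + rho + 1] up to the factor [peak / sqrt L]. One [eps] of the rate is already lost
    in the growth, the other absorbs [C1 L <= e^{eps L}]. The condition [1 <= rho * L] puts the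
    target to the right of [x]. *)
Lemma gheat_window L a c x : 1 <= L -> 1 <= rho * L -> 4 * C1 <= eps ^+ 2 * L -> 0 <= c ->
  a - rho * L <= x -> x <= a - rho * L + 1 ->
  ((c * expR (- ((Lam + 2 * eps) * L)))%:E <=
   (expR ((beta - eps) * L))%:E * gheat L (EFin \o win a c) x)%E.
Proof.
move=> L1 rL CL c0 ax xa.
have L0 : 0 < L by rewrite (lt_le_trans ltr01).
have sL : 0 < Num.sqrt L by rewrite sqrtr_gt0.
have sL2 : Num.sqrt L ^+ 2 = L by rewrite sqr_sqrtr// ltW.
pose p := (a - x) / Num.sqrt L; pose w := (Num.sqrt L)^-1.
have p0 : 0 <= p by rewrite divr_ge0 ?(ltW sL)//; lra.
have w0 : 0 < w by rewrite invr_gt0.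
have gE : gheat L (EFin \o win a c) x = (c%:E * gauss R `[p, (p + w)%R]%classic)%E.
  rewrite /gheat /win.
  rewrite (eq_integral (fun y : RR => c%:E * (\1_(`[p, p + w]%classic) y)%:E)%E).
    rewrite ge0_integralZl//; last by apply/measurable_EFinP; exact: measurable_indic.
    by rewrite integral_indic// setIT.
  move=> y _ /=; rewrite EFinM; congr (_ * (_)%:E)%E; rewrite !indicE.
  have pw : p + w = (a - x + 1) / Num.sqrt L by rewrite mulrDl mul1r.
  congr (nat_of_bool _)%:R; apply/idP/idP; rewrite !inE/= !in_itv/= pw ler_pdivrMr// ler_pdivlMr//
    [y * _]mulrC => /andP[h1 h2]; apply/andP; split; lra.
have gI := gauss_interval p0 w0.
rewrite gE muleA -EFinM.
have k0 : 0 <= expR ((beta - eps) * L) * c by rewrite mulr_ge0 ?expR_ge0.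
have := lee_wpmul2l _ gI => /(_ (expR ((beta - eps) * L) * c)%:E).
rewrite lee_fin => /(_ k0); apply: le_trans; rewrite -EFinM lee_fin.
have h1 : (p + w) ^+ 2 / 2 <= rho ^+ 2 * L / 2 + rho + 1.
  have -> : (p + w) ^+ 2 = (a - x + 1) ^+ 2 / L.
    by rewrite -[in RHS]sL2 /p /w; field; rewrite gt_eqF.
  rewrite -mulrA -invfM ler_pdivrMr ?mulr_gt0//.
  apply: (@le_trans _ _ ((rho * L + 1) ^+ 2)).
    by rewrite ler_pXn2r ?nnegrE//; lra.
  nra.
have h2 : L^-1 <= w.
  rewrite lef_pV2 ?posrE// -[leRHS]sL2 expr2 ler_peMl ?(ltW sL)//.
  by rewrite -[leLHS]sqrtr1 ler_sqrt// ltW.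
have h3 : C1 * L <= expR (eps * L).
  rewrite (_ : eps * L = eps * L / 2 + eps * L / 2); last by field.
  rewrite expRD; have g1 := expR_ge1Dx (eps * L / 2).
  have g0 : 0 <= eps * L / 2 by rewrite divr_ge0 ?mulr_ge0// ltW.
  have g2 : (eps * L / 2) ^+ 2 <= expR (eps * L / 2) * expR (eps * L / 2).
    by rewrite expr2; apply: ler_pM => //; lra.
  apply: le_trans g2; have := ler_wpM2r (ltW L0) CL; lra.
rewrite [leLHS]mulrC [leRHS]mulrAC ler_wpM2r//.
apply: (@le_trans _ _ (expR ((beta - eps) * L) * (L^-1 * (normal_peak 1 * expR (- (rho ^+ 2 * L / 2 + rho + 1)))))).
  have -> : expR (- ((Lam + 2 * eps) * L)) =
     expR ((beta - eps) * L) * expR (- (rho ^+ 2 * L / 2)) * expR (- (eps * L)).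
    by rewrite -!expRD; congr expR; rewrite /Lam; field.
  have -> : expR (- (rho ^+ 2 * L / 2 + rho + 1)) = expR (- (rho ^+ 2 * L / 2)) * (expR (rho + 1))^-1.
    by rewrite -expRN -expRD; congr expR; ring.
  rewrite -mulrA ler_wpM2l ?expR_ge0//.
  rewrite (_ : L^-1 * _ = expR (- (rho ^+ 2 * L / 2)) * (C1 * L)^-1); last first.
    by rewrite /C1; field; rewrite !gt_eqF ?expR_gt0.
  by rewrite ler_wpM2l ?expR_ge0// expRN lef_pV2 ?posrE ?expR_gt0 ?(mulr_gt0 C1_gt0 L0).
rewrite ler_wpM2l ?expR_ge0//; apply: ler_pM => //.
- by rewrite invr_ge0 ltW.
- by rewrite mulr_ge0 ?expR_ge0// ltW.
- by rewrite ler_wpM2l ?(ltW peak0)// ler_expR mulNr lerN2.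
Qed.

(** The expectations [I j] go back in time from [t] to 0 and increase with [j]. [I 0] dominates the
    probability of no mass in the half-space, and [I J] is explicit because the last window contains
    the origin, where [X 0] starts. *)
Lemma lower_bound : exists c T0, [/\ 0 < c, 0 < T0 & forall t, T0 <= t ->
  c * expR (- ((Lam + 2 * eps) * t)) <= fine (P [set w | 0 < hmass X e (rho * t - 1) t w])].
Proof.
(* One summand for each of the three lower bounds on [L] in [gheat_window]. *)
pose L0 := 1 + rho^-1 + 4 * C1 / eps ^+ 2.
have c1 : 0 < 4 * C1 / eps ^+ 2.
  by apply: divr_gt0; [apply: mulr_gt0|exact: exprn_gt0].
have r1 : 0 < rho^-1 by rewrite invr_gt0.
have L0_gt0 : 0 < L0 by rewrite /L0; lra.
have L00 : 0 <= 2 * L0 by rewrite mulr_ge0// ltW.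
have [M0 M00 H] := mild_exists_lb beta0 alpha0 bps eps0 epsb L00.
exists (M0 * expR (- M0)), L0; split; [by rewrite mulr_gt0 ?expR_gt0|by []|].
move=> t tL; have t0 : 0 < t by exact: lt_le_trans tL.
(* Equal steps of length between [L0] and [2 * L0]. The height [M0] was fixed for the horizon
   [2 * L0], so it does not depend on [t]. *)
pose J := Num.truncn (t / L0); pose L := t / J%:R.
have tL0 : 0 <= t / L0 by rewrite divr_ge0// ltW.
have /andP[Jle Jlt] := truncn_itv tL0; rewrite -/J in Jle Jlt.
have J0 : (0 < J)%N by rewrite truncn_gt0 ler_pdivlMr// mul1r.
have J1 : 1 <= J%:R :> R by rewrite ler1n.
have Jpos : 0 < J%:R :> R by rewrite ltr0n.
have LL : L0 <= L by rewrite ler_pdivlMr// mulrC -ler_pdivlMr.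
have LU : L <= 2 * L0.
  rewrite ler_pdivrMr//; move: Jlt; rewrite ltr_pdivrMr// -natr1.
  have := ler_wpM2l (ltW L0_gt0) J1; lra.
have Lpos : 0 < L by exact: lt_le_trans LL.
have tE : t = J%:R * L by rewrite /L mulrC divfK// gt_eqF.
have L1 : 1 <= L by apply: le_trans LL; rewrite /L0; lra.
have rL : 1 <= rho * L.
  have : rho^-1 <= L by apply: le_trans LL; rewrite /L0; lra.
  move=> /(ler_wpM2l (ltW rho0)).
  by rewrite mulfV// gt_eqF.
have CL : 4 * C1 <= eps ^+ 2 * L.
  rewrite [leRHS]mulrC -ler_pdivrMr ?exprn_gt0//; apply: le_trans LL; rewrite /L0; lra.
pose K := expR (- ((Lam + 2 * eps) * L)).
have K0 : 0 < K by exact: expR_gt0.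
have K1 : K <= 1.
  rewrite -[leRHS]expR0 ler_expR oppr_le0 mulr_ge0 ?(ltW Lpos)//.
  by rewrite addr_ge0 ?subr_ge0// mulr_ge0// ltW.
(* The window retreats by [rho L] and loses a factor [K] per step backwards; [K <= 1] keeps all
   heights below [M0], so the same small-data bound applies each time. *)
pose a j := rho * t - j%:R * (rho * L).
pose f j := win (a j) (M0 * K ^+ j).
have c0 j : 0 <= M0 * K ^+ j by rewrite mulr_ge0 ?exprn_ge0// ltW.
have cM j : M0 * K ^+ j <= M0 by rewrite ler_piMr ?(ltW M00)// exprn_ile1// ltW.
have fM j z : 0 <= f j z <= M0.
  by have /andP[-> /le_trans] := win_bnd (a j) z (c0 j); apply.
pose s j := (J - j)%:R * L.
pose I j := (\int[P]_w (expR (- mint (X (s j) w) (f j \o dot e)))%:E)%E.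
have mI t' g : bounded_nonneg_meas g -> measurable_fun setT (fun w => (expR (- mint (X t' w) g))%:E).
  move=> bg; apply/measurable_EFinP; apply: (measurableT_comp (@measurable_expR R)).
  by apply: measurable_funN; exact: (measurable_mint sbm).
have bf j : bounded_nonneg_meas (f j \o dot e).
  by apply: (bounded_nonneg_dot e (M0 := M0)); [exact: mwin|exact: fM].
have I_step j : (j < J)%N -> (I j <= I j.+1)%E.
  move=> jJ.
  have f0 z : 0 <= f j z by case/andP: (fM j z).
  have f1 z : f j z <= M0 by case/andP: (fM j z).
  have [u mu ulb] := H (f j) (mwin _ _) f0 f1.
  have sj0 : 0 <= s j.+1 by rewrite mulr_ge0// ltW.
  have sE : s j = s j.+1 + L by rewrite /s -(subnSK jJ) -natr1 mulrDl mul1r.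
  have FT : natural_filtration X (s j.+1) setT by exact: filtration_setT.
  rewrite /I sE (laplace_mild beta0 alpha0 bps sbm e1 M00 (mwin _ _) (fM j) mu sj0 (ltW Lpos) FT).
  have bu := mild_bounded_nonneg alpha0 e mu M00 (ltW Lpos).
  apply: ge0_le_integral => //.
  - exact: mI.
  - exact: mI.
  - move=> w _; rewrite lee_fin ler_expR lerN2; apply: mint_le => // x /=.
    rewrite {1}/f /win indicE; have [|] := boolP (dot e x \in `[a j.+1, a j.+1 + 1]%classic).
      rewrite inE/= in_itv/= => /andP[h1 h2]; rewrite mulr1 -lee_fin.
      apply: le_trans (ulb L (dot e x) (ltW Lpos) LU).
      rewrite exprS mulrCA [K * _]mulrC; apply: gheat_window => //.
      + by move: h1; rewrite /a -natr1; lra.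
      + by move: h2; rewrite /a -natr1; lra.
    by move=> _; rewrite mulr0; have [_ uk _ _] := mu; case/andP: (uk L (dot e x) (ltW Lpos)).
have I_le j : (j <= J)%N -> (I 0%N <= I j)%E.
  elim: j => [//|j ih] jJ; apply: (le_trans (ih (ltnW jJ))); exact: I_step.
have IJ : I J = (expR (- (M0 * K ^+ J)))%:E.
  rewrite /I /s subnn mul0r; case: sbm => _ _ -> // _; congr (expR (- _))%:E.
  rewrite /= /f /win indicE mem_set ?mulr1//=.
  have -> : dot e 0 = 0 by rewrite /dot big1// => i _; rewrite mxE mulr0.
  rewrite in_itv/= /a tE; apply/andP; split; lra.
have KJ : K ^+ J = expR (- ((Lam + 2 * eps) * t)).
  by rewrite /K -expRM_natl; congr expR; rewrite tE; ring.
pose S := [set w | 0 < hmass X e (rho * t - 1) t w].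
have mB : measurable S by exact: (measurable_hmass_gt sbm).
(* The closed window [[rho t, rho t + 1]] lies in the open half-space beyond [rho t - 1], so without
   mass there the exponential equals 1. *)
have I0 : (P (~` S) <= I 0%N)%E.
  rewrite -[leLHS]mul1e -integral_cst//; last exact: measurableC.
  apply: (@le_trans _ _ (\int[P]_(w in ~` S) (expR (- mint (X t w) (f 0%N \o dot e)))%:E)%E).
    apply: ge0_le_integral => //.
    - exact: measurableC.
    - by apply: measurable_funTS; exact: mI.
    - move=> w /= /negP; rewrite -leNgt => h; rewrite lee_fin -expR0 ler_expR lerNr oppr0.
      apply: (@le_trans _ _ (mint (X t w) ((fun z => M0 * \1_(`](rho * t - 1), +oo[%classic) z + 0) \o dot e))).
        apply: mint_le => //.
          apply: (bounded_nonneg_dot e (M0 := M0)).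
            apply: measurable_funD => //; apply: measurable_funM => //; exact: measurable_indic.
          by move=> z; rewrite addr0 indicE; case: (_ \in _); rewrite ?mulr1 ?mulr0 ?lexx ltW.
        move=> x /=; rewrite addr0 /f /win expr0 mulr1 ler_wpM2l ?(ltW M00)// !indicE.
        have [|] := boolP (dot e x \in `[a 0%N, a 0%N + 1]%classic); last by rewrite ler0n.
        rewrite inE/= in_itv/= /a mul0r subr0 => /andP[h1 _].
        by rewrite mem_set//= in_itv/= andbT; lra.
      rewrite mint_indic ?(ltW M00)// mul0r addr0 -/(hmass X e (rho * t - 1) t w).
      by rewrite pmulr_rle0.
  rewrite /I /s subn0 -tE; apply: ge0_subset_integral => //; first exact: measurableC.
  exact: mI.
have PI : (P (~` S) <= (expR (- (M0 * K ^+ J)))%:E)%E.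
  by apply: (le_trans I0); have := I_le J (leqnn J); rewrite IJ.
have {}PI : 1 - fine (P S) <= expR (- (M0 * K ^+ J)).
  by rewrite -lee_fin EFinB fineK ?(fin_num_measure P _ mB)// -(probability_setC P mB).
set x := M0 * K ^+ J in PI.
have x0 : 0 <= x by exact: c0.
have xM : x <= M0 by exact: cM.
(* [1 - e^{-x} >= x e^{-x}], and [x <= M0]: this is the source of the constant [M0 e^{-M0}]. *)
have h1 : x * expR (- M0) <= 1 - expR (- x).
  have g1 : expR (- M0) <= expR (- x) by rewrite ler_expR lerN2.
  have g2 := ler_wpM2l x0 g1.
  have g3 := ler_wpM2l (expR_ge0 (- x)) (expR_ge1Dx x).
  have g4 : expR (- x) * expR x = 1 by rewrite -expRD addNr expR0.
  rewrite g4 in g3; lra.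
rewrite -/S -KJ mulrAC -/x; lra.
Qed.

End lower.

(** * Covering by half-spaces, exteriors of balls and weak right-continuity *)

Section topology.
Context (R : realType) (d : nat).
Notation RR := (measurableTypeR R).

Lemma sqr_enorm (x : 'rV[R]_d) : enorm x ^+ 2 = \sum_(i < d) x ord0 i ^+ 2.
Proof. by rewrite sqr_sqrtr// sumr_ge0// => i _; exact: sqr_ge0. Qed.

Lemma continuous_sumsqr : continuous (fun x : 'rV[R]_d => \sum_(i < d) x ord0 i ^+ 2).
Proof. by apply: continuous_sumr => i; apply: continuous_mulr; exact: coord_continuous. Qed.

Lemma continuous_enorm : continuous (@enorm R d).
Proof.
move=> x; apply: (@continuous_comp _ _ _ (fun x : 'rV[R]_d => \sum_(i < d) x ord0 i ^+ 2) (@Num.sqrt R)).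
  exact: continuous_sumsqr.
exact: sqrt_continuous.
Qed.

Lemma measurable_enorm : measurable_fun setT (@enorm R d : Rd R d -> RR).
Proof. exact: continuous_measurable_Rd continuous_enorm. Qed.

Lemma coord_sqr_le (x : 'rV[R]_d) i : x ord0 i ^+ 2 <= \sum_(j < d) x ord0 j ^+ 2.
Proof. by rewrite (bigD1 i)//= lerDl sumr_ge0// => j _; exact: sqr_ge0. Qed.

Lemma coord_le_enorm (x : 'rV[R]_d) i : `|x ord0 i| <= enorm x.
Proof. by rewrite -sqrtr_sqr ler_wsqrtr// coord_sqr_le. Qed.

(* Compactness of the unit sphere: the complement of a ball is covered by finitely
   many half-spaces at distance almost its radius. *)
Lemma halfspace_cover (eps : R) : 0 < eps -> eps <= 1 ->
  exists2 l : seq 'rV[R]_d, (forall e, e \in l -> \sum_(i < d) e ord0 i ^+ 2 = 1) &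
    forall q x, 0 <= q -> q < enorm x -> exists2 e, e \in l & (1 - eps) * q < dot e x.
Proof.
move=> eps0 eps1.
pose S : set 'rV[R]_d := [set y | \sum_(i < d) y ord0 i ^+ 2 = 1].
have cS : compact S.
  apply: bounded_closed_compact.
    exists 1; split; first exact: num_real.
    move=> M M1 y Sy; rewrite /Num.norm/= mx_normrE.
    apply/bigmax_leP; split => [|[i j] _ /=]; first exact: ltW (lt_trans ltr01 M1).
    rewrite (ord1 i) (le_trans (coord_le_enorm y j))// /enorm Sy sqrtr1; exact: ltW.
  apply: (@closed_comp _ _ (fun y : 'rV[R]_d => \sum_(i < d) y ord0 i ^+ 2) [set 1]).
    by move=> y _; exact: continuous_sumsqr.
  exact: closed_eq.
have dotyy (y : 'rV[R]_d) : dot y y = \sum_(i < d) y ord0 i ^+ 2 by [].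
have ho (e : 'rV[R]_d) : open [set y | 1 - eps < dot e y].
  rewrite (_ : [set _ | _] = dot e @^-1` `]1 - eps, +oo[%classic).
    by move/continuousP: (@continuous_dot R d e); apply; exact: interval_open.
  by apply/seteqP; split => y /=; rewrite in_itv/= andbT.
move: cS; rewrite compact_cover => /(_ _ S (fun e => [set y | 1 - eps < dot e y])) [].
- by move=> e _; exact: ho.
- by move=> y Sy; exists y => //=; rewrite dotyy Sy; lra.
move=> D DS cov; exists (finmap.enum_fset D) => [e De|q x q0 qx].
  by have := DS e De; rewrite inE.
have x0 : 0 < enorm x by exact: le_lt_trans qx.
have Sx : S ((enorm x)^-1 *: x).
  rewrite /S /=; under eq_bigr do rewrite mxE exprMn.
  by rewrite -mulr_sumr -sqr_enorm -exprMn mulVf ?expr1n// gt_eqF.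
have [e De] := cov _ Sx; rewrite /=.
have -> : dot e ((enorm x)^-1 *: x) = (enorm x)^-1 * dot e x.
  by rewrite /dot mulr_sumr; apply: eq_bigr => i _; rewrite mxE; ring.
rewrite mulrC ltr_pdivlMr// => h; exists e => //; apply: le_lt_trans h.
by rewrite ler_wpM2l// ?(ltW qx)//; lra.
Qed.

Definition ext (q : R) : set 'rV[R]_d := [set x | q < enorm x].

Lemma measurable_ext q : measurable (ext q : set (Rd R d)).
Proof.
have h := measurable_enorm; have := h measurableT `]q, +oo[%classic; rewrite setTI => /(_ (measurable_itv _)).
by congr measurable; apply/seteqP; split => x /=; rewrite in_itv/= andbT.
Qed.

Lemma measurable_ext_closed q : measurable ([set x : 'rV[R]_d | q <= enorm x] : set (Rd R d)).
Proof.
have h := measurable_enorm; have := h measurableT `[q, +oo[%classic; rewrite setTI => /(_ (measurable_itv _)).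
by congr measurable; apply/seteqP; split => x /=; rewrite in_itv/= andbT.
Qed.

(** A bounded continuous function positive exactly on [ext q]: weak convergence can be tested on it,
    and its integral is positive precisely when [ext q] has mass. *)
Let ramp (q : R) (x : 'rV[R]_d) : R := Num.min 1 (Num.max 0 (enorm x - q)).

Let ramp_bnd q x : 0 <= ramp q x <= 1.
Proof. by rewrite /ramp le_min ler01 le_max lexx/= ge_min lexx. Qed.

Let continuous_ramp q : continuous (ramp q).
Proof.
move=> x; apply: (@continuous_comp _ _ _ (@enorm R d) (fun z : R => Num.min 1 (Num.max 0 (z - q)))).
  exact: continuous_enorm.
apply: (@continuous_min _ _ (fun=> 1) (fun z => Num.max 0 (z - q))); first exact: cvg_cst.
apply: (@continuous_max _ _ (fun=> 0) (fun z => z - q)); first exact: cvg_cst.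
by apply: cvgB; [exact: cvg_id|exact: cvg_cst].
Qed.

Let bounded_ramp q : bounded_nonneg_meas (ramp q).
Proof.
split; first by apply: continuous_measurable_Rd; exact: continuous_ramp.
split; first by move=> x; case/andP: (ramp_bnd q x).
by exists 1 => x; case/andP: (ramp_bnd q x).
Qed.

Let mint_ramp_le q (nu : {finite_measure set Rd R d -> \bar R}) : mint nu (ramp q) <= fine (nu (ext q)).
Proof.
pose h : 'rV[R]_d -> R := fun x => \1_(ext q : set (Rd R d)) x.
have bh : bounded_nonneg_meas h.
  split; first by apply: measurable_indic; exact: measurable_ext.
  by split => [x|]; [rewrite /h indicE ler0n|exists 1 => x; rewrite /h indicE; case: (_ \in _)].
have -> : fine (nu (ext q)) = mint nu h.
  by rewrite /mint /h integral_indic ?setIT//; exact: measurable_ext.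
apply: mint_le => // x; rewrite /h indicE; have [|qx] := boolP (x \in _).
  by case/andP: (ramp_bnd q x).
rewrite /ramp max_l ?ge_min ?lexx ?orbT//.
by move: qx; rewrite notin_setE /ext/= => /negP; rewrite -leNgt; lra.
Qed.

Let mint_ramp_gt0 q (nu : {finite_measure set Rd R d -> \bar R}) :
  0 < fine (nu (ext q)) -> 0 < mint nu (ramp q).
Proof.
move=> p; have m0 : 0 <= mint nu (ramp q).
  by apply: mint_ge0 => x; case/andP: (ramp_bnd q x).
rewrite lt_neqAle m0 andbT; apply/negP => /eqP h.
have /ae_eq_integral_abs : (\int[nu]_x `|(ramp q x)%:E| = 0)%E.
  rewrite -[RHS]/(0%R)%:E h (mintE nu (bounded_ramp q)); apply: eq_integral => x _.
  by rewrite abse_EFin ger0_norm//; case/andP: (ramp_bnd q x).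
move=> /(_ measurableT) H; have {}H : ae_eq nu setT (EFin \o ramp q) (cst 0%E).
  by apply: H; apply/measurable_EFinP; apply: continuous_measurable_Rd; exact: continuous_ramp.
have : nu (ext q) = 0%E.
  apply/negligibleP; first exact: measurable_ext.
  apply: negligibleS H => x qx /= /(_ I) [].
  move/eqP; rewrite /ramp /ext/= in qx *.
  by rewrite gt_eqF// lt_min ltr01/= lt_max subr_gt0 qx orbT.
by move=> h0; move: p; rewrite h0 ltxx.
Qed.

(* Weak right-continuity transfers mass of the open set [ext q] from time [s] to nearby later times. *)
Lemma ext_right (Y : R -> {finite_measure set Rd R d -> \bar R}) (q s : R) :
  cadlag_weak Y -> 0 <= s -> 0 < fine (Y s (ext q)) ->
  exists2 del, 0 < del & forall u, s < u < s + del -> 0 < fine (Y u (ext q)).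
Proof.
move=> [rc _] s0 p.
have bc : bounded_continuous (ramp q).
  split; first exact: continuous_ramp.
  by exists 1 => x; have /andP[a b] := ramp_bnd q x; rewrite ger0_norm.
have /cvgrPdist_lt /(_ _ (mint_ramp_gt0 p)) := rc s s0 _ bc.
rewrite near_withinE => /nbhs_ballP[del /= del0 H]; exists del => // u /andP[su ud].
apply: lt_le_trans (mint_ramp_le q (Y u)).
have := H u; rewrite /ball/= distrC ger0_norm ?subr_ge0 ?(ltW su)// => /(_ _ su).
rewrite ltrBlDl => /(_ ud) {H}; rewrite ltr_norml => /andP[_ H]; lra.
Qed.

Lemma grid_between (tau s del : R) (N : nat) : 0 < tau -> 0 <= s -> s < N%:R * tau -> 0 < del ->
  exists k j, (j <= N * 2 ^ k)%N /\ s < grid tau k j < s + del.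
Proof.
(* The mesh is taken below both [del] and the distance to the end, so the first grid time after [s]
   is within reach and has an admissible index. *)
move=> tau0 s0 st del0; pose g := Num.min del (N%:R * tau - s).
have g0 : 0 < g by rewrite lt_min del0 subr_gt0.
pose k := (Num.truncn (tau / g)).+1.
have p2 : 0 < 2 ^+ k :> R by rewrite exprn_gt0.
have hk : tau / 2 ^+ k < g.
  rewrite ltr_pdivrMr// mulrC -ltr_pdivrMr//; apply: (lt_trans (truncnS_gt _)).
  by rewrite -natrX ltr_nat; exact: ltn_expl.
have h0 : 0 < tau / 2 ^+ k by rewrite divr_gt0.
pose h := tau / 2 ^+ k; pose j := (Num.truncn (s / h)).+1.
have sh0 : 0 <= s / h by rewrite divr_ge0// ltW.
have /andP[jl ju] := truncn_itv sh0.
have h1 : s < grid tau k j by rewrite /grid -/h -ltr_pdivrMr.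
have h2 : grid tau k j < s + g.
  rewrite /grid -/h /j -natr1 mulrDl mul1r ler_ltD//.
  by rewrite -ler_pdivlMr.
have [gd gt] : g <= del /\ g <= N%:R * tau - s by rewrite /g !ge_min !lexx orbT.
exists k, j; split; last by rewrite h1/=; lra.
have : grid tau k j < N%:R * tau by lra.
rewrite /grid mulrCA [ltRHS]mulrC ltr_pM2l// ltr_pdivrMr// -natrX -natrM ltr_nat.
exact: ltnW.
Qed.

End topology.

(** * The range [Rt] expressed by exterior masses on grids *)

Section range.
Context (R : realType) (d : nat).
Context (dO : measure_display) (Omega : measurableType dO).
Variable X : R -> Omega -> {finite_measure set Rd R d -> \bar R}.
Notation RR := (measurableTypeR R).

Definition emass (q s : R) (w : Omega) : R := fine (X s w (ext q)).

Lemma emass_le q q' s w : q <= q' -> emass q' s w <= emass q s w.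
Proof.
move=> qq'; apply: fine_le; [exact: fin_num_measure (measurable_ext _)|exact: fin_num_measure (measurable_ext _)|].
by apply: le_measure; rewrite ?inE; [exact: measurable_ext|exact: measurable_ext|move=> x; exact: le_lt_trans].
Qed.

Lemma emass_gt0 q s w : (0 < emass q s w) = (X s w (ext q) != 0%E).
Proof.
have f : X s w (ext q) \is a fin_num by exact: fin_num_measure (measurable_ext q).
by rewrite -lte_fin /emass (fineK f) lt0e measure_ge0 andbT.
Qed.

(** [Rt] uses closed exteriors and [emass] open ones; working with radii strictly below [a] absorbs
    the difference, with the midpoint of [q] and [a] in one direction. *)
Lemma Rt_leP (a t : R) w : 0 < a ->
  (a%:E <= Rt X t w)%E <-> forall q, 0 <= q < a -> exists2 s, 0 <= s <= t & 0 < emass q s w.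
Proof.
move=> a0; split => [ha q /andP[q0 qa]|H].
- apply: contrapT => /forall2NP H.
  pose r := (q + a) / 2.
  have rS : (Rt X t w <= r%:E)%E.
    apply: ereal_inf_lbound; exists r => //; split; first by rewrite /r; lra.
    move=> s st; have [//|] := H s; rewrite emass_gt0 => /negP; rewrite negbK => /eqP h.
    apply: (subset_measure0 _ _ _ h); [exact: measurable_ext_closed|exact: measurable_ext|].
    by move=> x; apply: lt_le_trans; rewrite /r; lra.
  have := le_trans ha rS; rewrite lee_fin /r; lra.
- apply: le_ereal_inf_tmp => _ [r [r0 Hr] <-]; rewrite lee_fin leNgt; apply/negP => ra.
  have [s st] := H r (introT andP (conj (ltW r0) ra)).
  rewrite emass_gt0 => /eqP; apply.
  apply: (subset_measure0 _ _ _ (Hr s st)); [exact: measurable_ext|exact: measurable_ext_closed|].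
  by move=> x; exact: ltW.
Qed.

Hypothesis cX : forall w, cadlag_weak (fun t => X t w).

Lemma emass_grid (q tau s : R) (N : nat) w : 0 < tau -> 0 <= s <= N%:R * tau -> 0 < emass q s w ->
  exists k j, (j <= N * 2 ^ k)%N /\ 0 < emass q (grid tau k j) w.
Proof.
move=> tau0 /andP[s0]; rewrite le_eqVlt => /predU1P[->|sN] p.
  by exists 0%N, N; rewrite expn0 muln1 leqnn /grid expr0 divr1.
have [del del0 H] := ext_right (cX w) s0 p.
have [k [j [jN sj]]] := grid_between tau0 s0 sN del0.
by exists k, j; split => //; exact: H.
Qed.

Lemma grid_le (tau : R) (N k j : nat) : 0 < tau -> (j <= N * 2 ^ k)%N ->
  0 <= grid tau k j <= N%:R * tau.
Proof.
move=> tau0 jN; have p2 : 0 < 2 ^+ k :> R by rewrite exprn_gt0.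
rewrite /grid mulr_ge0 ?(ltW (divr_gt0 tau0 p2))//=.
rewrite mulrCA [leRHS]mulrC ler_pM2l// ler_pdivrMr// -natrX -natrM ler_nat//.
Qed.

Hypothesis mX : forall t (B : set (Rd R d)), measurable B ->
  measurable_fun setT (fun w => fine (X t w B)).

Let Ev (a tau : R) (N : nat) (n k j : nat) : set Omega :=
  if (j <= N * 2 ^ k)%N then [set w | 0 < emass (a * (1 - n.+1%:R^-1)) (grid tau k j) w] else set0.

(** Comparison of probabilities requires measurable events. Radii [a (1 - 1/(n+1))] increase to [a],
    and by [emass_grid] the grid times detect positive mass, so the event is a countable
    combination. *)
Lemma measurable_Rt_ge (a t : R) : 0 < a -> 0 < t -> measurable [set w | (a%:E <= Rt X t w)%E].
Proof.
move=> a0 t0.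
have -> : [set w | (a%:E <= Rt X t w)%E] = \bigcap_n \bigcup_k \bigcup_j Ev a t 1 n k j.
  apply/seteqP; split => w.
    move=> /(Rt_leP _ _ a0) H n _.
    have n0 : 0 < n.+1%:R^-1 :> R by rewrite invr_gt0.
    have n1 : n.+1%:R^-1 <= 1 :> R by rewrite invf_le1// ler1n.
    have [|s] := H (a * (1 - n.+1%:R^-1)).
      rewrite mulr_ge0 ?subr_ge0 ?(ltW a0)//= -[ltRHS]mulr1 ltr_pM2l//; lra.
    rewrite -{1}[t]mul1r => st p.
    have [k [j [jN pj]]] := @emass_grid _ _ _ 1 w t0 st p.
    by exists k => //; exists j => //; rewrite /Ev jN.
  move=> H; apply/(Rt_leP _ _ a0) => q /andP[q0 qa].
  (* Chosen so that [a / (n+1) <= a - q], hence [q <= a (1 - 1/(n+1))]. *)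
  pose n := Num.truncn (a / (a - q)).
  have aq : 0 < a - q by rewrite subr_gt0.
  have [k _ [j _]] := H n I; rewrite /Ev; case: ifP => // jN p.
  exists (grid t k j); first by have := grid_le t0 jN; rewrite mul1r.
  apply: lt_le_trans p (emass_le _ _ _).
  have := truncnS_gt (a / (a - q)); rewrite -/n ltr_pdivrMr// => h.
  have : a * n.+1%:R^-1 <= a - q by rewrite ler_pdivrMr// mulrC ltW.
  by rewrite mulrBr mulr1 lerBrDl -lerBrDr.
apply: bigcapT_measurable => n; apply: bigcup_measurable => k _; apply: bigcup_measurable => j _.
rewrite /Ev; case: ifP => // _.
have h := mX (grid t k j) (measurable_ext (a * (1 - n.+1%:R^-1))).
have := h measurableT `]0, +oo[%classic; rewrite setTI => /(_ (measurable_itv _)).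
by congr measurable; apply/seteqP; split => x /=; rewrite in_itv/= andbT.
Qed.

Lemma hmass_le_emass (e : 'rV[R]_d) (q r s : R) w :
  (forall x, r < dot e x -> q < enorm x) -> hmass X e r s w <= emass q s w.
Proof.
move=> H; apply: fine_le; [exact: fin_num_measure (measurable_halfspace _ _)|exact: fin_num_measure (measurable_ext _)|].
by apply: le_measure; rewrite ?inE; [exact: measurable_halfspace|exact: measurable_ext|move=> x; exact: H].
Qed.

Lemma hmass_Rt (i : 'I_d) (a r t : R) w : 0 < a -> a <= r -> 0 <= t ->
  0 < hmass X (delta_mx ord0 i) r t w -> (a%:E <= Rt X t w)%E.
Proof.
move=> a0 ar t0 p; apply/(Rt_leP _ _ a0) => q /andP[_ qa].
exists t; first by rewrite t0 lexx.
apply: (lt_le_trans p); apply: hmass_le_emass => x.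
have -> : dot (delta_mx ord0 i) x = x ord0 i.
  rewrite /dot (bigD1 i)//= big1 ?addr0; first by rewrite mxE !eqxx mul1r.
  by move=> j ji; rewrite mxE eqxx (negbTE ji) mul0r.
move=> rx; have := coord_le_enorm x i; have := ler_norm (x ord0 i); lra.
Qed.

Lemma emass_cover (l : seq 'rV[R]_d) (q q' s : R) w :
  (forall x, q < enorm x -> exists2 e, e \in l & q' < dot e x) ->
  0 < emass q s w -> exists2 e, e \in l & 0 < hmass X e q' s w.
Proof.
move=> H p; apply: contrapT => /forall2NP K; move: p; rewrite emass_gt0 => /negP; apply; apply/eqP.
have K' e : e \in l -> X s w (halfspace e q') = 0%E.
  move=> el; have [//|/negP] := K e; rewrite -leNgt => h.
  have f : X s w (halfspace e q') \is a fin_num by exact: fin_num_measure (measurable_halfspace _ _).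
  by apply/eqP; rewrite -(fineK f) eqe eq_le h/=; exact: fine_ge0.
have mU (l' : seq 'rV[R]_d) : measurable (\big[setU/set0]_(e <- l') halfspace e q' : set (Rd R d)).
  by apply: bigsetU_measurable => e _; exact: measurable_halfspace.
apply: (subset_measure0 (measurable_ext q) (mU l)).
  by move=> x /H[e el ex]; rewrite -bigcup_seq; exists e.
elim: l K' {H K} => [|e l ih] K'; first by rewrite big_nil measure0.
rewrite big_cons; apply: null_set_setU.
- exact: measurable_halfspace.
- exact: mU.
- by apply: K'; rewrite mem_head.
- by apply: ih => e' el; apply: K'; rewrite in_cons el orbT.
Qed.

End range.

(** * Exponential bounds for the range and the limit *)

Section speed.
Context (R : realType) (d : nat) (beta alpha : R) (ps : R -> R).
Context (dO : measure_display) (Omega : measurableType dO) (P : probability Omega R).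
Variable X : R -> Omega -> {finite_measure set Rd R d -> \bar R}.
Notation RR := (measurableTypeR R).
Hypotheses (beta0 : 0 < beta) (alpha0 : 0 < alpha) (bps : branching beta alpha ps).
Hypothesis sbm : is_SBM ps P X.
Variable rho : R.
Hypothesis rho0 : 0 < rho.

Let cX w : cadlag_weak (fun t => X t w). Proof. by case: sbm. Qed.

Let mX t (B : set (Rd R d)) : measurable B -> measurable_fun setT (fun w => fine (X t w B)).
Proof. by case: sbm => h _ _ _; exact: h. Qed.

Let prob (t : R) : R := fine (P [set w | ((rho * t)%:E <= Rt X t w)%E]).

Lemma Rt_prob_le (del : R) : 0 < del -> del < 1 ->
  exists C T0, forall t, T0 <= t ->
    prob t <= C * t * expR ((beta - ((1 - del) * rho) ^+ 2 / 2) * t).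
Proof.
(* Then [r1 + 2 eps = (1 - del/2) rho]. Passing to open exteriors and then to half-spaces costs a
   factor [1 - del/4] each, and [(1 - del/4)^2 >= 1 - del/2]. *)
move=> del0 del1; pose r1 := (1 - del) * rho; pose eps := del * rho / 4.
have r10 : 0 < r1 by rewrite mulr_gt0// subr_gt0.
have eps0 : 0 < eps by rewrite divr_gt0// mulr_gt0.
have d40 : 0 < del / 4 by lra.
have d41 : del / 4 <= 1 by lra.
have [l l1 lcov] := halfspace_cover d d40 d41.
pose Cst := beta / alpha + 4 / alpha + 8 * expR beta.
have Cst0 : 0 < Cst by rewrite !addr_gt0 ?divr_gt0 ?mulr_gt0 ?expR_gt0.
(* For [t >= 1], the single inequality [A t <= eps^2 t^2 / 32] gives both largeness conditions of
   the chaining. *)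
pose A := beta + 2 * (r1 ^+ 2 / 2) + 40.
have A0 : 40 <= A by rewrite /A; have := sqr_ge0 r1; move: (r1 ^+ 2) beta0 => z; lra.
have e20 : 0 < eps ^+ 2 by rewrite exprn_gt0.
have AE0 : 0 <= 32 * A / eps ^+ 2 by rewrite divr_ge0 ?(ltW e20)//; lra.
exists ((size l)%:R * (48 * Cst)), (1 + 32 * A / eps ^+ 2) => t tT.
have t1 : 1 <= t by lra.
have t0 : 0 < t by lra.
have hA : A * t <= eps ^+ 2 * t ^+ 2 / 32.
  have : 32 * A <= eps ^+ 2 * t by rewrite [leRHS]mulrC -ler_pdivrMr//; lra.
  move=> /(ler_wpM2r (ltW t0)); rewrite expr2; lra.
have hA1 : (beta + 2 * (r1 ^+ 2 / 2)) * t <= eps ^+ 2 * t ^+ 2 / 32.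
  by apply: le_trans hA; rewrite ler_pM2r// /A; lra.
have hA2 : 40 <= eps ^+ 2 * t ^+ 2 / 32.
  apply: le_trans hA; apply: (le_trans A0); rewrite ler_peMr//; lra.
(* For [t >= 1] this makes the coarse step [t / N] lie in [[1/2, 1]]. *)
pose N := (Num.truncn t).+1.
have /andP[Nl Nu] := truncn_itv (ltW t0).
have NR : N%:R <= 2 * t :> R by rewrite /N -natr1; lra.
have N0 : 0 < N%:R :> R by rewrite ltr0n.
have tN1 : t / N%:R <= 1 by rewrite ler_pdivrMr// mul1r ltW.
have tN2 : 2^-1 <= t / N%:R by rewrite ler_pdivlMr//; lra.
have tE : t = N%:R * (t / N%:R) by rewrite mulrC divfK// gt_eqF.
have tau0 : 0 < t / N%:R by rewrite divr_gt0.
pose F e := if e \in l then far_event X e r1 eps t N else set0.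
have mF e : measurable (F e).
  by rewrite /F; case: ifP => // _; exact: (measurable_far_event sbm).
pose E := expR ((beta - r1 ^+ 2 / 2) * t).
have E0 : 0 < E by exact: expR_gt0.
have bF e : fine (P (F e)) <= 48 * Cst * t * E.
  rewrite /F; case: ifP => el; last first.
    by rewrite measure0 !mulr_ge0// ?(ltW Cst0) ?(ltW t0) ?(ltW E0).
  apply: (le_trans (far_event_le beta0 alpha0 bps sbm (l1 _ el) r10 eps0 t0 _ tN2 tN1 hA1 hA2)) => //.
  rewrite -/Cst -/E ler_pM2r//.
  by have := ler_wpM2l (ltW Cst0) NR; lra.
apply: (@le_trans _ _ (fine (P (\big[setU/set0]_(e <- l) F e)))); last first.
  rewrite (_ : _ * t * _ = (size l)%:R * (48 * Cst * t * E)); last by rewrite /E /r1; ring.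
  exact: fine_prob_bigU.
apply: fine_prob_le.
- by apply: (measurable_Rt_ge cX mX) => //; exact: mulr_gt0.
- exact: bigsetU_measurable.
move=> w /= /(Rt_leP _ _ _ (mulr_gt0 rho0 t0)) /(_ ((1 - del / 4) * (rho * t))).
have rt0 : 0 < rho * t by exact: mulr_gt0.
case.
  by rewrite mulr_ge0 ?subr_ge0 ?(ltW rt0)//= -[ltRHS]mul1r ltr_pM2r//; lra.
move=> s; rewrite {1}tE => st p.
have [k [j [jN pj]]] := emass_grid cX tau0 st p.
have [|e el he] := emass_cover (l := l) (q' := (r1 + 2 * eps) * t) _ pj.
  move=> x qx; have [|e el ex] := lcov _ _ _ qx.
    by rewrite mulr_ge0 ?subr_ge0 ?(ltW rt0).
  exists e => //; apply: le_lt_trans ex.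
  have -> : (r1 + 2 * eps) * t = (1 - del / 2) * (rho * t) by rewrite /r1 /eps; field.
  rewrite mulrA ler_pM2r//; have := sqr_ge0 del; rewrite expr2; lra.
rewrite -bigcup_seq; exists e => //; rewrite /F el; exists k, j.
by split.
Qed.

(** The faster speed [rho + del] pays for the offset in [lower_bound]: [(rho + del) t - 1 >= rho t]
    once [t >= 1 / del]. The direction is a coordinate axis. *)
Lemma Rt_prob_ge (del eps : R) : (0 < d)%N -> 0 < del -> 0 < eps -> eps <= beta -> beta <= rho ^+ 2 / 2 ->
  exists c T0, 0 < c /\ forall t, T0 <= t ->
    c * expR (- (((rho + del) ^+ 2 / 2 - beta + 2 * eps) * t)) <= prob t.
Proof.
move=> d0 del0 eps0 epsb br.
have rd0 : 0 < rho + del by exact: addr_gt0.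
have br' : beta <= (rho + del) ^+ 2 / 2.
  by apply: (le_trans br); rewrite ler_pM2r// ler_pXn2r ?nnegrE ?(ltW rho0) ?(ltW rd0)// lerDl ltW.
pose i := Ordinal d0.
have e1 : \sum_(j < d) (delta_mx ord0 i : 'rV[R]_d) ord0 j ^+ 2 = 1.
  rewrite (bigD1 i)//= big1 ?addr0; first by rewrite mxE !eqxx expr1n.
  by move=> j ji; rewrite mxE eqxx (negbTE ji) expr0n.
have [c [T0 [c0 T00 H]]] := lower_bound beta0 alpha0 bps sbm e1 rd0 eps0 epsb br'.
exists c, (T0 + del^-1); split => // t tT.
have di : 0 < del^-1 by rewrite invr_gt0.
have t0 : 0 < t by lra.
apply: (le_trans (H t _)); first by lra.
apply: fine_prob_le.
- exact: (measurable_hmass_gt sbm).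
- by apply: (measurable_Rt_ge cX mX) => //; exact: mulr_gt0.
move=> w /=; apply: hmass_Rt; rewrite ?(ltW t0)//; first exact: mulr_gt0.
have : 1 <= del * t.
  by rewrite mulrC -ler_pdivrMr// div1r; lra.
lra.
Qed.

(** For a tolerance [eta], half of it covers the perturbation of the speed and of the growth rate,
    the other half absorbs the prefactors [C t] and [c] for large [t]. *)
Lemma Rt_log_limit : (0 < d)%N -> beta < rho ^+ 2 / 2 ->
  (fun t : R => ln (prob t) / t) @ +oo --> - (rho ^+ 2 / 2 - beta).
Proof.
move=> d0 br; apply/cvgrPdist_le => eta eta0.
have r20 : 0 < rho ^+ 2 by exact: exprn_gt0.
(* Lowering the speed to [(1 - del) rho] changes the exponent by at most [del rho^2 <= eta / 2]. *)
pose del := Num.min (2^-1) (eta / (2 * rho ^+ 2)).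
have [dl1 dl2] : del <= 2^-1 /\ del <= eta / (2 * rho ^+ 2).
  by rewrite /del !ge_min !lexx orbT.
have del0 : 0 < del by rewrite lt_min invr_gt0 ltr0n/= divr_gt0// mulr_gt0.
have del1 : del < 1 by lra.
have [C [T1 HU]] := Rt_prob_le del0 del1.
(* As [del' <= 1], raising the speed costs at most [del' (rho + 1) <= eta / 4]; the term [2 eps]
   takes the other [eta / 4]. *)
pose del' := Num.min 1 (eta / (4 * (rho + 1))).
have r1 : 0 < rho + 1 by rewrite addr_gt0.
have [dl3 dl4] : del' <= 1 /\ del' <= eta / (4 * (rho + 1)).
  by rewrite /del' !ge_min !lexx orbT.
have del'0 : 0 < del' by rewrite lt_min ltr01/= divr_gt0// mulr_gt0.
pose eps := Num.min beta (eta / 8).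
have eps0 : 0 < eps by rewrite lt_min beta0/= divr_gt0.
have [ep1 ep2] : eps <= beta /\ eps <= eta / 8 by rewrite /eps !ge_min !lexx orbT.
have [c [T2 [c0 HL]]] := Rt_prob_ge d0 del'0 eps0 ep1 (ltW br).
(* Beyond [T3], [C t <= (eta t / 4)^2 <= e^{eta t / 2}] and [e^{- eta t / 2} <= c]. *)
pose T3 := Num.max 1 (Num.max (16 * C / eta ^+ 2) (- 2 * ln c / eta)).
exists (Num.max T3 (Num.max T1 T2)); split; first exact: num_real.
move=> t; rewrite !gt_max => /andP[/andP[t1 /andP[tC tc]] /andP[tT1 tT2]].
have t0 : 0 < t by lra.
pose Lam := rho ^+ 2 / 2 - beta.
have lo : expR (- ((Lam + eta) * t)) <= prob t.
  apply: le_trans (HL t (ltW tT2)).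
  have h1 : (rho + del') ^+ 2 / 2 - beta + 2 * eps <= Lam + eta / 2.
    have : del' * (rho + 1) <= eta / 4.
      rewrite -ler_pdivlMr//; apply: (le_trans dl4).
      by rewrite -mulrA -invfM.
    rewrite /Lam; nra.
  have h2 : expR (- (eta / 2 * t)) <= c.
    rewrite -[leRHS]lnK ?posrE// ler_expR.
    by move: tc; rewrite ltr_pdivrMr//; lra.
  rewrite (_ : - ((Lam + eta) * t) = - (eta / 2 * t) + - ((Lam + eta / 2) * t)); last by field.
  rewrite expRD; apply: ler_pM; rewrite ?expR_ge0// ler_expR lerN2 ler_pM2r//.
have up : prob t <= expR (- ((Lam - eta) * t)).
  apply: (le_trans (HU t (ltW tT1))).
  have h1 : beta - ((1 - del) * rho) ^+ 2 / 2 <= - (Lam - eta / 2).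
    have : del * rho ^+ 2 <= eta / 2.
      rewrite -ler_pdivlMr//; apply: (le_trans dl2).
      by rewrite -mulrA -invfM.
    rewrite exprMn; have : 0 <= del ^+ 2 * rho ^+ 2 by rewrite mulr_ge0 ?sqr_ge0.
    rewrite /Lam; lra.
  have h2 : C * t <= expR (eta / 2 * t).
    have g1 := expR_ge1Dx (eta / 4 * t).
    have g0 : 0 <= eta / 4 * t by rewrite mulr_ge0 ?divr_ge0// ltW.
    have g2 : (eta / 4 * t) * (eta / 4 * t) <= expR (eta / 4 * t) * expR (eta / 4 * t).
      by apply: ler_pM => //; lra.
    rewrite -expRD (_ : _ + _ = eta / 2 * t) in g2; last by field.
    apply: le_trans g2; move: tC; rewrite ltr_pdivrMr ?exprn_gt0// => /ltW.
    move=> /(ler_wpM2r (ltW t0)); lra.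
  rewrite (_ : - ((Lam - eta) * t) = eta / 2 * t + - (Lam - eta / 2) * t); last by field.
  rewrite expRD; apply: (@le_trans _ _ (expR (eta / 2 * t) * expR ((beta - ((1 - del) * rho) ^+ 2 / 2) * t))).
    by rewrite ler_wpM2r ?expR_ge0.
  by rewrite ler_wpM2l ?expR_ge0// ler_expR ler_pM2r.
have p0 : 0 < prob t by apply: lt_le_trans lo; exact: expR_gt0.
have lo' : - ((Lam + eta) * t) <= ln (prob t) by rewrite -[leLHS]expRK ler_ln ?posrE ?expR_gt0.
have up' : ln (prob t) <= - ((Lam - eta) * t) by rewrite -[leRHS]expRK ler_ln ?posrE ?expR_gt0.
rewrite -/Lam ler_norml; apply/andP; split.
  rewrite -opprD lerN2 -lerBrDl ler_pdivrMr//; lra.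
rewrite lerBlDr -lerBlDl ler_pdivlMr//; lra.
Qed.

End speed.

Theorem theorem1 (R : realType) (d : nat) (beta alpha : R)
  (n : {measure set R -> \bar R})
  (dO : measure_display) (Omega : measurableType dO) (P : probability Omega R)
  (X : R -> Omega -> {finite_measure set Rd R d -> \bar R}) :
  (0 < d)%N -> 0 < beta -> 0 < alpha ->
  sigma_finite (`]0%R, +oo[ : set R) n ->
  (\int[n]_(y in (`]0%R, +oo[ : set R)) (Num.min (y ^+ 2) y)%:E < +oo)%E ->
  (exists gamma : R, 0 < gamma /\
     (\int[n]_(y in (`[1%R, +oo[ : set R)) (y * (ln y `^ (2 + gamma)))%:E < +oo)%E) ->
  is_SBM (psi beta alpha n) P X ->
  forall rho : R, Num.sqrt (2 * beta) < rho ->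
    (fun t : R => ln (fine (P [set w | ((rho * t)%:E <= Rt X t w)%E])) / t)
      @ +oo --> - (rho ^+ 2 / 2 - beta).
Proof.
move=> d0 beta0 alpha0 _ gfin [gam [gam0 lfin]] sbm rho hrho.
have bps := branching_psi beta0 alpha0 gfin gam0 lfin.
have b2 : 0 <= 2 * beta by rewrite mulr_ge0// ltW.
have rho0 : 0 < rho by exact: le_lt_trans (sqrtr_ge0 _) hrho.
apply: (Rt_log_limit beta0 alpha0 bps sbm rho0 d0).
rewrite ltr_pdivlMr// mulrC -[ltLHS]sqr_sqrtr// ltr_pXn2r ?nnegrE ?sqrtr_ge0//.
exact: ltW.
Qed.
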